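(* Suppose $S\in L^2(\mathbb{R}^3;S^{3\times3})$. Then $S\in L^2_{st}$ if and only if $$-\Delta S+2\nabla_{sym}\left(\operatorname{div}(S)\right)=0\qquad\text{and}\qquad\operatorname{tr}(S)=0,$$ where the first equation is understood to hold pointwise almost everywhere in Fourier space, that is, $$|\xi|^2\hat S(\xi)-(\xi\otimes\xi)\hat S(\xi)-\hat S(\xi)(\xi\otimes\xi)=0\quad\text{for almost every }\xi\in\mathbb{R}^3.$$
   Context: $S^{3\times3}$ denotes the space of real symmetric $3\times3$ matrices. $(\nabla_{sym}v)_{ij}=\frac12\left(\frac{\partial v_j}{\partial x_i}+\frac{\partial v_i}{\partial x_j}\right)$ for a vector field $v$; $\operatorname{div}(S)$ is the vector field with components $\operatorname{div}(S)_j=\sum_k\partial_{x_k}S_{kj}$; $(\xi\otimes\xi)_{ij}=\xi_i\xi_j$; $\hat S$ is the entrywise Fourier transform. In components, the first equation is $-\Delta S_{ij}+\sum_{k=1}^3\left(\partial_{x_i}\partial_{x_k}S_{kj}+\partial_{x_j}\partial_{x_k}S_{ki}\right)=0$. The strain subspace is $$L^2_{st}=\left\{\nabla_{sym}u:\ u\in\dot H^1(\mathbb{R}^3;\mathbb{R}^3),\ \nabla\cdot u=0\right\}\subset L^2(\mathbb{R}^3;S^{3\times3}).$$ *)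

(* Defs.v *)
From HB Require Import structures.
From mathcomp Require Import all_boot all_order all_algebra.
From mathcomp Require Import complex.
From mathcomp Require Import all_classical all_reals all_analysis.

Set Implicit Arguments.
Unset Strict Implicit.
Unset Printing Implicit Defensive.
Import Order.TTheory GRing.Theory Num.Theory.
Import numFieldNormedType.Exports.

Local Open Scope classical_set_scope.
Local Open Scope ring_scope.

(** R^3 is the iterated product, which carries both the
    normed-space structure (product topology) and the product Borel
    sigma-algebra. *)
Notation R3 R := (R * R * R)%type.

Section Euclidean.
Context {R : realType}.

Definition coord (i : 'I_3) (x : R3 R) : R := nth 0 [:: x.1.1; x.1.2; x.2] i.

Definition basis (i : 'I_3) : R3 R :=
  ((i == 0%N :> nat)%:R, (i == 1%N :> nat)%:R, (i == 2%N :> nat)%:R).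

Definition dot (x y : R3 R) : R := \sum_(i < 3) coord i x * coord i y.

(* The library norm on a product is the sup norm. *)
Definition enorm (x : R3 R) : R := Num.sqrt (dot x x).

End Euclidean.

Definition leb3 (R : realType) :
    {measure set (measurableTypeR R * measurableTypeR R * measurableTypeR R)%type
       -> \bar R} :=
  ((@lebesgue_measure R \x @lebesgue_measure R) \x @lebesgue_measure R)%E.
Arguments leb3 R : clear implicits.

Section Schwartz.
Context {R : realType}.
Implicit Types (phi : R3 R -> R) (T : (R3 R -> R) -> R).

Definition partial (i : 'I_3) phi : R3 R -> R := fun x => 'D_(basis i) phi x.

(* Multi-indices are words of directions. *)
Definition partials (s : seq 'I_3) phi : R3 R -> R := foldr partial phi s.

Definition smooth phi : Prop := forall s : seq 'I_3,
  continuous (partials s phi) /\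
  forall (x : R3 R) (i : 'I_3), derivable (partials s phi) x (basis i).

Definition weighted (N : nat) (s : seq 'I_3) phi (x : R3 R) : R :=
  (1 + dot x x) ^+ N * `|partials s phi x|.

Definition schwartz phi : Prop :=
  smooth phi /\
  forall (N : nat) (s : seq 'I_3), exists C : R, forall x, weighted N s phi x <= C.

Definition schwartz_norm (N : nat) phi : R :=
  sup [set r | exists (s : seq 'I_3) (x : R3 R),
                 (size s <= N)%N /\ r = weighted N s phi x].

(** Real tempered distributions, as functionals on real Schwartz functions;
    their complexification acts on phi1 + i phi2 by T phi1 + i T phi2, so real
    test functions suffice everywhere. The value of T off the Schwartz class is
    irrelevant. *)
Definition tempered T : Prop :=
  (forall (a : R) phi psi, schwartz phi -> schwartz psi ->
     T (fun x => a * phi x + psi x) = a * T phi + T psi) /\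
  (exists (N : nat) (C : R), forall phi, schwartz phi ->
     `|T phi| <= C * schwartz_norm N phi).

Definition dist_of (f : R3 R -> R) : (R3 R -> R) -> R :=
  fun phi => \int[leb3 R]_x (f x * phi x).

Definition dpartial (i : 'I_3) T : (R3 R -> R) -> R :=
  fun phi => - T (partial i phi).

(** The Fourier transform of a real test function phi,
      int e^{- 2 pi i x . xi} phi(x) dx = cos_tr phi xi - i sin_tr phi xi. *)
Definition cos_tr phi : R3 R -> R := fun xi =>
  \int[leb3 R]_x (cos (2 * pi * dot x xi) * phi x).

Definition sin_tr phi : R3 R -> R := fun xi =>
  \int[leb3 R]_x (sin (2 * pi * dot x xi) * phi x).

(** The complex function g is the Fourier transform of T : for every test
    function phi, <g, phi> = <T, phi^>, split into real and imaginary parts.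
    It is only used for g in L^2 or |xi| g in L^2, when the integrals converge
    absolutely. *)
Definition fourier_is T (g : R3 R -> R[i]) : Prop :=
  forall phi, schwartz phi ->
    dist_of (fun xi => complex.Re (g xi)) phi = T (cos_tr phi) /\
    dist_of (fun xi => complex.Im (g xi)) phi = - T (sin_tr phi).

End Schwartz.

Section Spaces.
Context {R : realType}.

Definition L2 (f : R3 R -> R) : Prop := f \in Lfun (leb3 R) 2%:E.

Definition L2C (g : R3 R -> R[i]) : Prop :=
  L2 (fun x => complex.Re (g x)) /\ L2 (fun x => complex.Im (g x)).

Definition L1loc (f : R3 R -> R) : Prop := forall r : R,
  (leb3 R).-integrable [set x | enorm x <= r] (EFin \o f).

Definition L1locC (g : R3 R -> R[i]) : Prop :=
  L1loc (fun x => complex.Re (g x)) /\ L1loc (fun x => complex.Im (g x)).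

(** The real homogeneous Sobolev space of order 1 on R^3: tempered distributions
    whose Fourier transform is a locally integrable function g with |xi| g in L^2. *)
Definition Hdot1 (u : (R3 R -> R) -> R) : Prop :=
  tempered u /\
  exists g : R3 R -> R[i],
    [/\ L1locC g, fourier_is u g & L2C (fun xi => (enorm xi)%:C%C * g xi)].

Definition div_free (u : 'I_3 -> (R3 R -> R) -> R) : Prop :=
  forall phi, schwartz phi -> \sum_(j < 3) dpartial j (u j) phi = 0.

Definition grad_sym (u : 'I_3 -> (R3 R -> R) -> R) (i j : 'I_3) :
    (R3 R -> R) -> R :=
  fun phi => 2^-1 * (dpartial i (u j) phi + dpartial j (u i) phi).

Definition L2sym (S : R3 R -> 'M[R]_3) : Prop :=
  (forall x, (S x)^T = S x) /\ forall i j, L2 (fun x => S x i j).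

Definition L2st (S : R3 R -> 'M[R]_3) : Prop :=
  L2sym S /\
  exists u : 'I_3 -> (R3 R -> R) -> R,
    [/\ forall j, Hdot1 (u j),
        div_free u
      & forall i j phi, schwartz phi ->
          dist_of (fun x => S x i j) phi = grad_sym u i j phi].

(** Entrywise Fourier transform of an L^2 matrix field; by Plancherel it exists
    and is unique up to almost everywhere equality. *)
Definition L2_fourier_is (S : R3 R -> 'M[R]_3) (hS : R3 R -> 'M[R[i]]_3) : Prop :=
  forall i j, L2C (fun xi => hS xi i j) /\
    fourier_is (dist_of (fun x => S x i j)) (fun xi => hS xi i j).

Definition tens (xi : R3 R) : 'M[R[i]]_3 :=
  \matrix_(i, j) (coord i xi * coord j xi)%:C%C.

End Spaces.

(* Main.v *)
Require Import Defs.
From HB Require Import structures.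
From mathcomp Require Import all_boot all_order all_algebra.
From mathcomp Require Import complex.
From mathcomp Require Import all_classical all_reals all_analysis.
From mathcomp Require Import measurable_realfun normal_distribution.
From mathcomp Require Import ring lra.
Import Order.TTheory GRing.Theory Num.Theory Defs.
Import numFieldNormedType.Exports.
Local Open Scope classical_set_scope.
Local Open Scope ring_scope.

(** The Fourier transform of the strain of a velocity u is [pi i (xi (x) v + v
    (x) xi)], where v is the transform of u, and u is divergence free exactly
    when [xi . v = 0]. Let M be such a matrix. Because [xi . v = 0], the
    products [(xi (x) xi) M] and [M (xi (x) xi)] are |xi|^2 times the two
    summands of M, so they add up to [|xi|^2 M]; the trace of M is [2 pi i (xi
    . v) = 0]. Conversely, a symmetric M with [|xi|^2 M = (xi (x) xi) M + M
    (xi (x) xi)] is recovered, where xi is not 0, from [v = - i (M xi) / (pi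
    |xi|^2)], and the trace of the equation is [|xi|^2 tr M = 2 (xi . M xi)],
    so that v is transverse when [tr M = 0]. These pointwise computations are
    [grad_hat_equation], [riesz_strain] and [riesz_transverse].

    The analysis carries them to distributions, whose transforms are only
    known through pairings with Schwartz functions. Both trigonometric
    transforms preserve the Schwartz class (see [schwartz_ft]), so that a
    derivative can be moved onto a transformed test function and becomes a
    multiplication by a coordinate. Schwartz functions separate square-
    integrable functions (see [schwartz_separating]), which turns the
    resulting identities between integrals into identities almost everywhere:
    transversality of the transform in one direction; symmetry, vanishing
    trace and Hermitian symmetry of the transform of S in the other.

    The field v built from M is singular at the origin, and only [|xi| v] is
    known to be square integrable. In dimension three |xi|^-2 is locally
    integrable (see [itg_inv_dot]), so v can be paired with Schwartz functions
    and its inverse transform [inv_ft] is a tempered distribution. That its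
    transform is v again uses the Hermitian symmetry of v and Fourier
    inversion on the Schwartz class (see [fourier_inversion]). The latter is
    obtained by damping the frequency integral with Gaussians. *)

Set Implicit Arguments.
Unset Strict Implicit.
Unset Printing Implicit Defensive.

Local Notation o0 := (@Ordinal 3 0 isT).
Local Notation o1 := (@Ordinal 3 1 isT).
Local Notation o2 := (@Ordinal 3 2 isT).

(** * Integration over products *)

(** The product measure under a name of its own, which carries sigma-finiteness:
    an iterated product has a product as a factor, and Fubini asks that factor
    to be sigma-finite. *)
Definition sprod d1 d2 (T1 : measurableType d1) (T2 : measurableType d2)
    (R : realType) (m1 : {sigma_finite_measure set T1 -> \bar R})
    (m2 : {sigma_finite_measure set T2 -> \bar R}) : set (T1 * T2) -> \bar R :=
  (m1 \x m2)%E.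
Section SigmaFiniteProduct.
Context d1 d2 (T1 : measurableType d1) (T2 : measurableType d2) (R : realType).
Variables (m1 : {sigma_finite_measure set T1 -> \bar R})
          (m2 : {sigma_finite_measure set T2 -> \bar R}).
HB.instance Definition _ := Measure.copy (sprod m1 m2) (m1 \x m2)%E.

Let sprod_sigma_finite : sigma_finite setT (sprod m1 m2).
Proof.
have /sigma_finiteP[F [TF ndF mF]] := sigma_finiteT m1.
have /sigma_finiteP[G [TG ndG mG]] := sigma_finiteT m2.
exists (fun n => F n `*` G n) => [|n].
  apply/seteqP; split=> // -[x y] _ /=.
  have [i _ Fx] : (\bigcup_n F n) x by rewrite -TF.
  have [j _ Gy] : (\bigcup_n G n) y by rewrite -TG.
  exists (maxn i j) => //; split=> /=.
    by have /subsetPset := ndF _ _ (leq_maxl i j); apply.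
  by have /subsetPset := ndG _ _ (leq_maxr i j); apply.
have [[mFn Fn] [mGn Gn]] := (mF n, mG n); split; first exact: measurableX.
by rewrite /sprod product_measure1E// lte_mul_pinfty// ge0_fin_numE.
Qed.

HB.instance Definition _ :=
  Measure_isSigmaFinite.Build _ _ _ (sprod m1 m2) sprod_sigma_finite.
End SigmaFiniteProduct.

Section ProductMeasure.
Context d1 d2 (T1 : measurableType d1) (T2 : measurableType d2) (R : realType).
Variables (m1 : {sigma_finite_measure set T1 -> \bar R})
          (m2 : {sigma_finite_measure set T2 -> \bar R}).

Lemma integrable_prod_fun (f : T1 -> R) (g : T2 -> R) :
  m1.-integrable setT (EFin \o f) -> m2.-integrable setT (EFin \o g) ->
  (m1 \x m2)%E.-integrable setT (EFin \o (fun z => f z.1 * g z.2)).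
Proof.
move=> intf intg.
have mf : measurable_fun setT f.
  by apply/measurable_EFinP; exact: (measurable_int m1).
have mg : measurable_fun setT g.
  by apply/measurable_EFinP; exact: (measurable_int m2).
apply/integrable12ltyP.
  apply/measurable_EFinP; apply: measurable_funM.
    by apply: (measurableT_comp mf); exact: measurable_fst.
  by apply: (measurableT_comp mg); exact: measurable_snd.
under eq_integral => x _.
  under eq_integral => y _ do rewrite /= normrM EFinM.
  rewrite ge0_integralZl//; last first.
    by apply/measurable_EFinP; exact: measurableT_comp.
  over.
rewrite ge0_integralZr//; last 2 first.
  by apply/measurable_EFinP; exact: measurableT_comp.
  exact: integral_ge0.
case/integrableP: intf => _ /= ?; case/integrableP: intg => _ /= ?.
by rewrite lte_mul_pinfty ?integral_ge0// ge0_fin_numE ?integral_ge0.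
Qed.

Lemma Rintegral_prod_fun (f : T1 -> R) (g : T2 -> R) :
  m1.-integrable setT (EFin \o f) -> m2.-integrable setT (EFin \o g) ->
  \int[(m1 \x m2)%E]_z (f z.1 * g z.2) = (\int[m1]_x f x) * \int[m2]_y g y.
Proof.
move=> intf intg.
rewrite /Rintegral -integral12_prod_meas1; last exact: integrable_prod_fun.
rewrite /fubini_F /=.
under eq_integral => x _.
  under eq_integral => y _ do rewrite EFinM.
  rewrite integralZl//; over.
have [r Hr] : exists r, (\int[m2]_y (g y)%:E)%E = r%:E.
  by exists (fine (\int[m2]_y (g y)%:E)%E); rewrite fineK//; exact: integrable_fin_num.
have [s Hs] : exists s, (\int[m1]_x (f x)%:E)%E = s%:E.
  by exists (fine (\int[m1]_x (f x)%:E)%E); rewrite fineK//; exact: integrable_fin_num.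
rewrite Hr Hs integralZr//.
by rewrite [X in (X * _)%E]Hs.
Qed.

(** The slices need to be examined only where they are integrable, because
    almost all of them are. *)
Lemma integral_prod_slice0r (f : T1 * T2 -> \bar R) :
  (m1 \x m2)%E.-integrable setT f ->
  (forall x, m2.-integrable setT (fun y => f (x, y)) ->
     (\int[m2]_y f (x, y) = 0)%E) ->
  (\int[(m1 \x m2)%E]_z f z = 0)%E.
Proof.
move=> fi f0; rewrite -integral12_prod_meas1//.
rewrite (ae_eq_integral (cst 0%E)) ?integral0//.
  exact: (measurable_fubini_F fi).
by have := ae_integrable1 fi; apply: filterS => x ix _; exact: f0.
Qed.

Lemma integral_prod_slice0l (f : T1 * T2 -> \bar R) :
  (m1 \x m2)%E.-integrable setT f ->
  (forall y, m1.-integrable setT (fun x => f (x, y)) ->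
     (\int[m1]_x f (x, y) = 0)%E) ->
  (\int[(m1 \x m2)%E]_z f z = 0)%E.
Proof.
move=> fi f0; rewrite -integral21_prod_meas1//.
rewrite (ae_eq_integral (cst 0%E)) ?integral0//.
  exact: (measurable_fubini_G fi).
by have := ae_integrable2 fi; apply: filterS => x ix _; exact: f0.
Qed.

Lemma Rintegral_Fubini (f : T1 * T2 -> R) :
  (m1 \x m2)%E.-integrable setT (EFin \o f) ->
  (forall x, m2.-integrable setT (fun y => (f (x, y))%:E)) ->
  (forall y, m1.-integrable setT (fun x => (f (x, y))%:E)) ->
  \int[m1]_x (\int[m2]_y f (x, y)) = \int[m2]_y (\int[m1]_x f (x, y)).
Proof.
move=> fi f1 f2; rewrite /Rintegral; congr fine.
have := Fubini fi; rewrite /= => E.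
under eq_integral => x _ do rewrite fineK ?(integrable_fin_num measurableT (f1 x))//.
rewrite E; apply: eq_integral => y _.
by rewrite fineK// (integrable_fin_num measurableT (f2 y)).
Qed.

(** The two measures agree on rectangles, and a product of sigma-finite measures
    is determined by its values there. *)
Lemma prod_pushforward (f1 : T1 -> T1) (f2 : T2 -> T2) :
  measurable_fun setT f1 -> measurable_fun setT f2 ->
  (forall A, measurable A -> m1 (f1 @^-1` A) = m1 A) ->
  (forall A, measurable A -> m2 (f2 @^-1` A) = m2 A) ->
  forall A, measurable A ->
    (m1 \x m2)%E ((fun z => (f1 z.1, f2 z.2)) @^-1` A) = (m1 \x m2)%E A.
Proof.
move=> mf1 mf2 H1 H2 A mA.
pose F (z : T1 * T2) := (f1 z.1, f2 z.2).
have mF : measurable_fun setT F.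
  apply: measurable_fun_pair.
    by apply: (measurableT_comp mf1); exact: measurable_fst.
  by apply: (measurableT_comp mf2); exact: measurable_snd.
apply/esym; apply: (@product_measure_unique _ _ _ _ _ m1 m2
  (pushforward (m1 \x m2)%E F : {measure set _ -> \bar R})) => // B C mB mC.
rewrite /= /pushforward.
have -> : F @^-1` (B `*` C) = (f1 @^-1` B) `*` (f2 @^-1` C) by [].
rewrite product_measure1E//.
- by congr (_ * _)%E; [exact: H1|exact: H2].
- by rewrite -[X in measurable X]setTI; exact: mf1.
- by rewrite -[X in measurable X]setTI; exact: mf2.
Qed.

End ProductMeasure.
Section MeasurePreserving.
Context d (T : measurableType d) (R : realType) (m : {measure set T -> \bar R}).
Variable h : T -> T.
Hypothesis mh : measurable_fun setT h.
Hypothesis hP : forall A, measurable A -> m (h @^-1` A) = m A.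

Lemma ge0_integral_preserved (f : T -> \bar R) : measurable_fun setT f ->
  (forall x, 0 <= f x)%E -> (\int[m]_x f (h x) = \int[m]_x f x)%E.
Proof.
move=> mf f0; rewrite -[setT in LHS](preimage_setT h).
rewrite -(ge0_integral_pushforward mh)//.
by apply: eq_measure_integral => A mA _; exact: hP.
Qed.

Lemma integrable_preserved (f : T -> R) : m.-integrable setT (EFin \o f) ->
  m.-integrable setT (EFin \o (f \o h)).
Proof.
move=> /integrableP[mf fi]; apply/integrableP; split.
  exact: (measurableT_comp mf mh).
have mabs : measurable_fun setT (abse \o (EFin \o f)).
  by apply: (measurableT_comp _ mf); exact: abse_measurable.
by have /= -> := ge0_integral_preserved mabs (fun=> abse_ge0 _).
Qed.

Lemma Rintegral_preserved (f : T -> R) : m.-integrable setT (EFin \o f) ->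
  \int[m]_x f (h x) = \int[m]_x f x.
Proof.
move=> /integrableP[mf _]; rewrite /Rintegral integralE [in RHS]integralE.
rewrite (_ : (fun x => (f (h x))%:E) = (EFin \o f) \o h)// funepos_comp funeneg_comp.
congr (fine (_ - _)%E).
  exact: (ge0_integral_preserved (measurable_funepos mf) (funepos_ge0 _)).
exact: (ge0_integral_preserved (measurable_funeneg mf) (funeneg_ge0 _)).
Qed.

End MeasurePreserving.

Section MeasureOnSpace.
Context {R : realType}.
Notation mu := (leb3 R).
Implicit Types (f g : R3 R -> R).

Definition msr f := measurable_fun setT f.
Definition itg f := mu.-integrable setT (EFin \o f).
Notation "'∫' f" := (Rintegral mu setT f) (at level 36).

Lemma ae_imp (P Q : R3 R -> Prop) : (forall x, P x -> Q x) ->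
  {ae mu, forall x, P x} -> {ae mu, forall x, Q x}.
Proof. by move=> PQ; apply: (@filterS _ _ (ae_filter_ringOfSetsType mu)). Qed.

Lemma ae_conj (P Q : R3 R -> Prop) : {ae mu, forall x, P x} ->
  {ae mu, forall x, Q x} -> {ae mu, forall x, P x /\ Q x}.
Proof.
apply: (@filterS2 _ _ (ae_filter_ringOfSetsType mu)) => x; exact: conj.
Qed.

Lemma itg_msr f : itg f -> msr f.
Proof. by move=> /(measurable_int mu) /measurable_EFinP. Qed.

Lemma itg_le f g : msr f -> itg g -> (forall x, `|f x| <= g x) -> itg f.
Proof.
move=> mf ig fg; apply: (le_integrable _ _ _ ig) => //; first exact/measurable_EFinP.
move=> x _; rewrite /= lee_fin (le_trans (fg x))//; exact: ler_norm.
Qed.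

Lemma itgD f g : itg f -> itg g -> itg (fun x => f x + g x).
Proof.
move=> fi gi; rewrite /itg (_ : _ \o _ = (EFin \o f) \+ (EFin \o g))%E.
  exact: integrableD.
by apply/funext.
Qed.

Lemma itgZ (c : R) f : itg f -> itg (fun x => c * f x).
Proof.
move=> fi; rewrite /itg (_ : _ \o _ = (fun x => c%:E * (EFin \o f) x))%E.
  exact: integrableZl.
by apply/funext.
Qed.

Lemma itgN f : itg f -> itg (fun x => - f x).
Proof. by move=> /(itgZ (-1)); under eq_fun do rewrite mulN1r. Qed.

Lemma itgB f g : itg f -> itg g -> itg (fun x => f x - g x).
Proof. by move=> fi gi; apply: itgD => //; exact: itgN. Qed.

Lemma itg0 : itg (fun=> 0).
Proof. exact: integrable0. Qed.

Lemma IntD f g : itg f -> itg g -> ∫ (fun x => f x + g x) = ∫ f + ∫ g.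
Proof. exact: RintegralD. Qed.

Lemma IntB f g : itg f -> itg g -> ∫ (fun x => f x - g x) = ∫ f - ∫ g.
Proof. exact: RintegralB. Qed.

Lemma IntZ (c : R) f : itg f -> ∫ (fun x => c * f x) = c * ∫ f.
Proof. by move=> ?; rewrite RintegralZl. Qed.

Lemma IntN f : itg f -> ∫ (fun x => - f x) = - ∫ f.
Proof.
move=> fi; rewrite -mulN1r -IntZ//; congr Rintegral.
by apply/funext => x; rewrite mulN1r.
Qed.

Lemma Int0 : ∫ (fun=> 0) = 0.
Proof. by rewrite /Rintegral integral0. Qed.

Lemma Int_abs f g : msr f -> itg g -> (forall x, `|f x| <= g x) -> `|∫ f| <= ∫ g.
Proof.
move=> mf ig fg; have fi := itg_le mf ig fg.
apply: le_trans (le_normr_Rintegral _ fi) _ => //.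
apply: le_Rintegral => //.
rewrite (_ : _ \o _ = (abse \o (EFin \o f)))//; exact: integrable_abse.
Qed.

Lemma msr_coord i : msr (coord i).
Proof.
case: i => -[|[|[|//]]] Hi; rewrite /coord /=; last exact: measurable_snd.
- by apply: (measurableT_comp (f := fst)); [exact: measurable_fst|exact: measurable_fst].
- by apply: (measurableT_comp (f := snd)); [exact: measurable_snd|exact: measurable_fst].
Qed.

Lemma msrD f g : msr f -> msr g -> msr (fun x => f x + g x).
Proof. exact: measurable_funD. Qed.

Lemma msrM f g : msr f -> msr g -> msr (fun x => f x * g x).
Proof. exact: measurable_funM. Qed.

Lemma msrN f : msr f -> msr (fun x => - f x).
Proof. by move=> mf; apply: (measurableT_comp _ mf); exact: oppr_measurable. Qed.

Lemma msr_cst (c : R) : msr (fun=> c).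
Proof. exact: measurable_cst. Qed.

Lemma dotE (x y : R3 R) :
  dot x y = x.1.1 * y.1.1 + x.1.2 * y.1.2 + x.2 * y.2.
Proof. by rewrite /dot !big_ord_recl big_ord0 /coord /= addr0 addrA. Qed.

Lemma dot_ge0 (x : R3 R) : 0 <= dot x x.
Proof. by rewrite dotE !addr_ge0// -expr2 sqr_ge0. Qed.

Lemma enorm_sqr (x : R3 R) : enorm x ^+ 2 = dot x x.
Proof. by rewrite sqr_sqrtr// dot_ge0. Qed.

Lemma coord_sqr_le i (x : R3 R) : coord i x ^+ 2 <= dot x x.
Proof.
rewrite dotE; case: i => -[|[|[|//]]] Hi; rewrite /coord /=; nra.
Qed.

Lemma coord_le_enorm i (x : R3 R) : `|coord i x| <= enorm x.
Proof. by rewrite -sqrtr_sqr ler_wsqrtr// coord_sqr_le. Qed.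

(** The form in which membership is proved and used throughout: sums and
    products are then bounded pointwise. *)
Lemma L2P f : L2 f <-> msr f /\ itg (fun x => f x ^+ 2).
Proof.
split=> [L2f|[mf f2]].
  split; last exact: Lfun2_integrable_sqr.
  by move: L2f; rewrite /L2 inE => /andP[]; rewrite inE.
rewrite /L2 inE; apply/andP; rewrite !inE /=; split=> //.
rewrite /finite_norm unlock; apply: poweR_lty.
case/integrableP: f2 => _; apply: le_lt_trans.
rewrite le_eqVlt; apply/orP; left; apply/eqP; apply: eq_integral => x _ /=.
by rewrite powR_mulrn// normrX.
Qed.

Lemma L2_msr f : L2 f -> msr f. Proof. by case/L2P. Qed.

Lemma L2_mul f g : L2 f -> L2 g -> itg (fun x => f x * g x).
Proof.
move=> /L2P[mf f2] /L2P[mg g2].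
apply: (itg_le _ (itgD f2 g2)); first exact: msrM.
(* |f g| <= f^2 + g^2 *)
move=> x; rewrite ler_norml; have := sqr_ge0 (f x + g x).
by have := sqr_ge0 (f x - g x); have := sqr_ge0 (f x); have := sqr_ge0 (g x); nra.
Qed.

Lemma L2_bounded_mul (m : R3 R -> R) (C : R) f : msr m ->
  (forall x, `|m x| <= C) -> L2 f -> L2 (fun x => m x * f x).
Proof.
move=> mm mC /L2P[mf f2]; apply/L2P; split; first exact: msrM.
apply: (itg_le _ (itgZ (C ^+ 2) f2)).
  by rewrite /msr; under eq_fun do rewrite expr2; do 2 apply: msrM.
move=> x; rewrite ger0_norm ?sqr_ge0// exprMn ler_wpM2r ?sqr_ge0//.
by rewrite -[m x ^+ 2]real_normK ?num_real// ler_sqr ?nnegrE// (le_trans _ (mC x)).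
Qed.

Lemma L2D f g : L2 f -> L2 g -> L2 (fun x => f x + g x).
Proof.
move=> /L2P[mf f2] /L2P[mg g2]; apply/L2P; split; first exact: msrD.
apply: (itg_le _ (itgZ 2 (itgD f2 g2))).
  by rewrite /msr; under eq_fun do rewrite expr2; apply: msrM; apply: msrD.
by move=> x; rewrite ger0_norm ?sqr_ge0//; have := sqr_ge0 (f x - g x); nra.
Qed.

Lemma L2Z (c : R) f : L2 f -> L2 (fun x => c * f x).
Proof. by apply: (@L2_bounded_mul (fun=> c) `|c|) => //; exact: msr_cst. Qed.

Lemma L2N f : L2 f -> L2 (fun x => - f x).
Proof. by move=> /(L2Z (-1)); under eq_fun do rewrite mulN1r. Qed.

End MeasureOnSpace.

(** * Measurability, reflection and slices of space *)

Section SpaceTopology.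
Context {R : realType}.
Notation mu := (leb3 R).
Notation lam := (@lebesgue_measure R).
Implicit Types (f g : R3 R -> R).
Notation "'∫' f" := (Rintegral mu setT f) (at level 36).

Definition leb2 := sprod lam lam.
HB.instance Definition _ := SigmaFiniteMeasure.on leb2.

Lemma measurable_ball1 (a r : R) : measurable (ball a r).
Proof. by rewrite ball_itv; exact: measurable_itv. Qed.

(** The Borel sets of the topology are those of the product sigma-algebra
    because an open set is the union of the countably many rational cubes that
    it contains. *)
Lemma open_measurable_R3 (U : set (R3 R)) : open U -> measurable U.
Proof.
move=> oU.
pose B (q : rat * rat * rat * rat) : set (R3 R) :=
  (ball (ratr q.1.1.1 : R) (ratr q.2) `*` ball (ratr q.1.1.2 : R) (ratr q.2)) `*`
  ball (ratr q.1.2 : R) (ratr q.2).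
pose F q := if `[< B q `<=` U >] then B q else set0.
have -> : U = \bigcup_q F q.
  apply/seteqP; split=> [x Ux|x [q _]]; last first.
    by rewrite /F; case: ifPn => // /asboolP BU /BU.
  have : nbhs x U by exact: open_nbhs_nbhs.
  case/nbhs_ballP => e /= e0 xU.
  have e2 : 0 < e / 2 by rewrite divr_gt0.
  have [r] := rat_in_itvoo e2.
  rewrite in_itv /= => /andP[r0 re].
  have H (a : R) : exists q : rat, `|ratr q - a| < ratr r.
    have ar : a - ratr r < a + ratr r by lra.
    have [q] := rat_in_itvoo ar.
    by rewrite in_itv /= => q1; exists q; rewrite ltr_norml; lra.
  case: x Ux xU => [[x1 x2] x3] Ux xU.
  have [q1 h1] := H x1; have [q2 h2] := H x2; have [q3 h3] := H x3.
  exists (q1, q2, q3, r) => //; rewrite /F.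
  case: asboolP => [_|[]].
    by split; [split|]; rewrite /= /ball /=.
  move=> [[y1 y2] y3] [[]] /=; rewrite /ball /= => k1 k2 k3.
  apply: xU; split; [split|] => /=; rewrite /ball /=.
  - by move: h1 k1; rewrite !ltr_norml; lra.
  - by move: h2 k2; rewrite !ltr_norml; lra.
  - by move: h3 k3; rewrite !ltr_norml; lra.
apply: countable_bigcupT_measurable; first exact: countableP.
move=> q; rewrite /F; case: ifP => _; last exact: measurable0.
by apply: measurableX; [apply: measurableX|]; exact: measurable_ball1.
Qed.

Lemma continuous_msr f : continuous f -> msr f.
Proof.
move=> cf; apply: (measurability _ (RGenOInfty.measurableE R)).
move=> _ [_ [a ->] <-]; rewrite setTI; apply: open_measurable_R3.
by apply: open_comp => //; exact: rray_open.
Qed.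

Lemma lebN (A : set R) : measurable A -> lam ((-%R : R -> R) @^-1` A) = lam A.
Proof. exact: lebesgue_measureN. Qed.

Let M3 := (measurableTypeR R * measurableTypeR R * measurableTypeR R)%type.

Definition refl (x : R3 R) : R3 R := (- x.1.1, - x.1.2, - x.2).

Lemma measurable_refl : measurable_fun setT (refl : R3 R -> R3 R).
Proof.
apply: measurable_fun_pair; first apply: measurable_fun_pair.
- exact: (msrN (msr_coord o0)).
- exact: (msrN (msr_coord o1)).
- exact: (msrN (msr_coord o2)).
Qed.

Lemma leb3_refl (A : set (R3 R)) : measurable A -> mu (refl @^-1` A) = mu A.
Proof.
move=> mA.
have mN : measurable_fun setT (-%R : R -> R) by exact: oppr_measurable.
have H2 : forall B : set (R * R), measurable B ->
    (lam \x lam)%E ((fun z : R * R => (- z.1, - z.2)) @^-1` B) = (lam \x lam)%E B.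
  exact: (@prod_pushforward _ _ _ _ R lam lam _ _ mN mN lebN lebN).
have m2 : measurable_fun [set: R * R] (fun z : R * R => (- z.1, - z.2)).
  apply: measurable_fun_pair.
    by apply: (measurableT_comp mN); exact: measurable_fst.
  by apply: (measurableT_comp mN); exact: measurable_snd.
have H3 := @prod_pushforward _ _ _ _ R leb2 lam _ _ m2 mN H2 lebN A mA.
exact: H3.
Qed.

Lemma msr_refl f : msr f -> msr (f \o refl).
Proof. by move=> mf; exact: measurableT_comp mf measurable_refl. Qed.

Lemma itg_refl f : itg f -> itg (f \o refl).
Proof. exact: (@integrable_preserved _ M3 R mu refl measurable_refl leb3_refl). Qed.

Lemma Int_refl f : itg f -> ∫ (f \o refl) = ∫ f.
Proof. exact: (@Rintegral_preserved _ M3 R mu refl measurable_refl leb3_refl). Qed.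

Definition upd (i : 'I_3) (t : R) (x : R3 R) : R3 R :=
  (if i == 0 :> nat then t else x.1.1, if i == 1 :> nat then t else x.1.2,
   if i == 2 :> nat then t else x.2).

(** Fubini with the i-th coordinate integrated first; the other two coordinates
    are the outer variables of the iterated product. *)
Lemma fubini_slice0 f i : itg f ->
  (forall x, \int[lam]_t f (upd i t x) = 0) -> ∫ f = 0.
Proof.
move=> fi f0.
have E0 x : lam.-integrable setT (fun t => (f (upd i t x))%:E) ->
    (\int[lam]_t (f (upd i t x))%:E = 0)%E.
  move=> /integrable_fin_num => /(_ measurableT) H.
  by rewrite -(fineK H); congr (_%:E); exact: f0.
rewrite /Rintegral.
suff -> : (\int[mu]_x (f x)%:E = 0)%E by [].
case: i f0 E0 => -[|[|[|//]]] Hi f0 E0.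
- apply: (integral_prod_slice0l (m1 := leb2) (m2 := lam) fi) => z iz.
  apply: (integral_prod_slice0l (m1 := lam) (m2 := lam) iz) => y iy.
  exact: (E0 (0, y, z)).
- apply: (integral_prod_slice0l (m1 := leb2) (m2 := lam) fi) => z iz.
  apply: (integral_prod_slice0r (m1 := lam) (m2 := lam) iz) => x ix.
  exact: (E0 (x, 0, z)).
- apply: (integral_prod_slice0r (m1 := leb2) (m2 := lam) fi) => -[p1 p2] ip.
  exact: (E0 (p1, p2, 0)).
Qed.

End SpaceTopology.

(** * Integrals over the line *)

Section OneDim.
Context {R : realType}.
Notation lam := (@lebesgue_measure R).
Implicit Types (f g : R -> R).

Lemma Rintegral_dct d (T : measurableType d) (m : {measure set T -> \bar R})
    (f_ : nat -> T -> R) (f g : T -> R) :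
  (forall n, measurable_fun setT (f_ n)) ->
  (forall x, f_ n x @[n --> \oo] --> f x) ->
  m.-integrable setT (EFin \o g) -> (forall n x, `|f_ n x| <= g x) ->
  \int[m]_x f_ n x @[n --> \oo] --> \int[m]_x f x.
Proof.
move=> mf_ cf ig fg.
have mf : measurable_fun setT f by apply: measurable_fun_cvg (fun x _ => cf x).
have me n : measurable_fun setT (EFin \o f_ n) by exact/measurable_EFinP.
have [] := @dominated_convergence _ _ _ m setT measurableT
  (fun n => EFin \o f_ n) (EFin \o f) (EFin \o g) me _ _ ig _.
- exact/measurable_EFinP.
- by apply: aeW => x _; apply: cvg_EFin; [exact: nearW|exact: cf].
- by apply: aeW => x n _; rewrite /= lee_fin.
move=> H1 _ H3.
by apply: fine_cvg; rewrite fineK//; exact: integrable_fin_num.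
Qed.

Lemma integrable_inv_oneDsqr : lam.-integrable setT (EFin \o (fun t => (1 + t ^+ 2)^-1)).
Proof.
have c1 : continuous (fun t : R => (1 + t ^+ 2)^-1).
  exact: continuous_oneDsqrV.
have p t : 0 <= (1 + t ^+ 2)^-1 :> R by rewrite invr_ge0 addr_ge0// sqr_ge0.
apply/integrableP; split; first by apply/measurable_EFinP; exact: continuous_measurable_fun.
under eq_integral do rewrite /= ger0_norm//.
rewrite ge0_symfun_integralT//; last by move=> t; rewrite /= sqrrN.
rewrite (_ : [set x | _] = `[0, +oo[%classic); last first.
  by apply/seteqP; split => x/=; rewrite in_itv/= andbT.
by rewrite integral0y_oneDsqr -EFinM ltry.
Qed.

Let pw (t : R) := t `^ (- (2 / 3)).

Let int_pw (a : R) : 0 < a < 1 ->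
  (\int[lam]_(t in `[a, 1%R]) (pw t)%:E <= 3%:E)%E.
Proof.
move=> /andP[a0 a1].
have pos x : x \in `]a, 1[ -> 0 < x.
  by rewrite in_itv /= => /andP[/(lt_trans a0)].
have cont (p : R) x : 0 < x -> {for x, continuous (fun t : R => t `^ p)}.
  move=> x0; apply: differentiable_continuous; apply/derivable1_diffP.
  by apply: derivable_powR; rewrite in_itv /= x0.
rewrite (@continuous_FTC2 _ pw (fun t => 3 * t `^ (1 / 3)))//.
- by rewrite -EFinB lee_fin powR1; have := powR_ge0 a (1 / 3); lra.
- apply: continuous_in_subspaceT => x; rewrite inE /= in_itv /= => /andP[ax _].
  by apply: cont; exact: lt_le_trans ax.
- split.
  + move=> x xa; apply: derivableM => //; apply: derivable_powR.
    by rewrite in_itv /= pos.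
  + apply: cvg_at_right_filter; apply: cvgM; [exact: cvg_cst|exact: cont].
  + apply: cvg_at_left_filter; apply: cvgM; [exact: cvg_cst|exact: cont].
- move=> x xa; have x0 := pos x xa.
  rewrite derive1Ml; last by apply: derivable_powR; rewrite in_itv /= x0.
  rewrite powR_derive1; last by rewrite in_itv /= x0.
  rewrite mulrA (_ : 3 * (1 / 3) = 1); last by field.
  rewrite !mul1r /pw /=; congr powR; lra.
Qed.

Lemma measurable_pw : measurable_fun setT pw.
Proof. exact: measurable_powR. Qed.

Let E n : set R := `[n.+2%:R^-1, 1]%classic.

(** The integrals from 1 / (n + 2) to 1 are bounded by 3 thanks to the primitive
    3 t^(1/3). *)
Lemma integrable_pw01 : lam.-integrable `]0, 1] (EFin \o pw).
Proof.
apply/integrableP; split.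
  by apply/measurable_EFinP; apply: measurable_funTS; exact: measurable_pw.
under eq_integral do rewrite /= ger0_norm ?powR_ge0//.
have UE : `]0, 1]%classic = \bigcup_n E n.
  apply/seteqP; split=> [x|x [n _]]; rewrite /= /E /= !in_itv /=.
    move=> /andP[x0 x1]; exists (Num.truncn x^-1) => //.
    rewrite /E /= in_itv /= x1 andbT -[leRHS]invrK lef_pV2 ?posrE ?invr_gt0//.
    have : 0 <= x^-1 by rewrite invr_ge0 ltW.
    by move=> /truncn_itv /andP[_ h]; rewrite (le_trans (ltW h))// ler_nat.
  by move=> /andP[h ->]; rewrite andbT (lt_le_trans _ h)// invr_gt0.
have H : (\int[lam]_(x in E n) (pw x)%:E @[n --> \oo] --> \int[lam]_(x in \bigcup_i E i) (pw x)%:E)%E.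
  apply: ge0_nondecreasing_set_cvg_integral.
  - apply/nondecreasing_seqP => n; apply/subsetPset => x; rewrite /E /= !in_itv /=.
    move=> /andP[h ->]; rewrite andbT (le_trans _ h)// lef_pV2 ?posrE ?ltr0n//.
    by rewrite ler_nat.
  - by move=> i; exact: measurable_itv.
  - by move=> i; apply/measurable_EFinP; apply: measurable_funTS; exact: measurable_pw.
  - by move=> i x _; rewrite lee_fin powR_ge0.
rewrite UE -(cvg_lim _ H)//; apply: (@le_lt_trans _ _ 3%:E); last exact: ltry.
apply: lime_le; first by apply/cvg_ex; eexists; exact: H.
apply: nearW => n; apply: int_pw; rewrite invr_gt0 ltr0n /= invf_lt1 ?ltr0n//.
by rewrite ltr1n.
Qed.

(** The factor in one variable of the bound on |x|^-2 in [itg_inv_dot]: the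
    power is integrable near 0, and the denominator makes the function
    integrable at infinity. *)
Lemma integrable_inv_cuberoot :
  lam.-integrable setT (EFin \o (fun t : R => `|t| `^ (- (2 / 3)) / (1 + t ^+ 2))).
Proof.
pose p := pw \_ `]0%R, 1%R].
have ip : lam.-integrable setT (EFin \o p).
  rewrite /p -restrict_EFin; apply/(integrable_mkcond _ _).1 => //.
  exact: integrable_pw01.
have ipN : lam.-integrable setT (EFin \o (p \o -%R)).
  have mN : measurable_fun setT (-%R : R -> R) by exact: oppr_measurable.
  have H := @integrable_preserved _ (measurableTypeR R) R lam -%R mN lebN p.
  by have := H ip.
have mp : measurable_fun setT (fun t : R => `|t| `^ (- (2 / 3)) / (1 + t ^+ 2)).
  apply: measurable_funM.
    apply: (measurableT_comp (f := fun x => x `^ (- (2 / 3))) (measurable_powR _)).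
    exact: normr_measurable.
  by apply/measurable_EFinP; exact: (measurable_int lam integrable_inv_oneDsqr).
have ib := integrableD measurableT (integrableD measurableT ip ipN) integrable_inv_oneDsqr.
apply: (le_integrable _ _ _ ib) => //; first exact/measurable_EFinP.
move=> t _; rewrite /= lee_fin.
have d0 : 0 < 1 + t ^+ 2 by rewrite ltr_pwDl// sqr_ge0.
have i0 : 0 <= (1 + t ^+ 2)^-1 by rewrite invr_ge0 ltW.
have p0 x : 0 <= p x by rewrite /p patchE; case: ifP => // _; exact: powR_ge0.
have S0 : 0 <= p t + p (- t) + (1 + t ^+ 2)^-1 by rewrite !addr_ge0.
rewrite (ger0_norm S0) ger0_norm; last by rewrite mulr_ge0// powR_ge0.
have [t1|t1] := leP `|t| 1; last first.
  rewrite (le_trans (y := (1 + t ^+ 2)^-1)) ?lerDr ?addr_ge0//.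
  rewrite ler_piMl// powRN invf_le1 ?powR_gt0 ?(lt_trans _ t1)//.
  by rewrite -(powRr0 `|t|) ler_powR ?(ltW t1)//; lra.
suff H : `|t| `^ (- (2 / 3)) <= p t + p (- t).
  rewrite (le_trans (y := `|t| `^ (- (2 / 3))))//.
    rewrite ler_piMr ?powR_ge0// invf_le1//; have := sqr_ge0 t; lra.
  by rewrite (le_trans H)// lerDl.
have pE x : p x = if (0 < x) && (x <= 1) then x `^ (- (2 / 3)) else 0.
  by rewrite /p patchE mem_setE in_itv.
rewrite !pE.
have [t0|t0|->] := ltgtP t 0.
- by rewrite (ltr0_norm t0) in t1 *; rewrite oppr_gt0 t0 t1 /= add0r.
- by rewrite (gtr0_norm t0) in t1 *; rewrite t1 oppr_gt0 (lt_gtF t0) /= addr0.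
- by rewrite oppr0 ltxx /= normr0 powR0 ?addr0//; lra.
Qed.

(** The integral from - (n + 1) to n + 1 is a difference of boundary values of
    F, which are O(1/n). *)
Lemma Rintegral_derive0 (F f : R -> R) (C : R) :
  (forall t : R, is_derive t (1 : R) F (f t)) -> continuous f ->
  (forall t, `|F t| <= C / (1 + t ^+ 2)) ->
  lam.-integrable setT (EFin \o f) -> \int[lam]_t f t = 0.
Proof.
move=> dF cf FC fi.
have mf : measurable_fun setT f by exact: continuous_measurable_fun.
pose I n : set R := `[- n.+1%:R, n.+1%:R]%classic.
have cvgI : \int[lam]_(t in I n) f t @[n --> \oo] --> \int[lam]_t f t.
  rewrite (_ : (fun n => _) = fun n => \int[lam]_t (f \_ (I n)) t); last first.
    by apply/funext => n; rewrite Rintegral_mkcond.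
  apply: (@Rintegral_dct _ _ lam (fun n => f \_ (I n)) f (fun t => `|f t|)).
  - move=> n; apply: (measurable_restrictT f (measurable_itv _)).1.
    exact: measurable_funTS.
  - move=> t; apply: cvg_near_cst; near=> n.
    rewrite patchE mem_set// /I /= in_itv /= -ler_norml.
    near: n; exists (Num.truncn `|t|) => // n /= h.
    have /andP[_ /ltW h2] := truncn_itv (normr_ge0 t).
    by rewrite (le_trans h2)// ler_nat ltnS.
  - by rewrite (_ : _ \o _ = abse \o (EFin \o f))//; exact: integrable_abse.
  - by move=> n t; rewrite patchE; case: ifP => // _; rewrite normr0.
have IE n : \int[lam]_(t in I n) f t = F n.+1%:R - F (- n.+1%:R).
  rewrite /Rintegral (@continuous_FTC2 _ f F)//.
  - by rewrite -subr_gt0 opprK addr_gt0.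
  - exact: continuous_subspaceT.
  - have cF : continuous F.
      move=> t; apply: differentiable_continuous; apply/derivable1_diffP.
      by have [] := dF t.
    split; first by move=> t _; have [] := dF t.
      by apply: cvg_at_right_filter; exact: cF.
    by apply: cvg_at_left_filter; exact: cF.
  - by move=> t _; rewrite derive1E; have [_ ->] := dF t.
have cvg0 : \int[lam]_(t in I n) f t @[n --> \oo] --> (0 : R).
  apply: norm_cvg0; apply: (@squeeze_cvgr _ _ _ _ (cst 0) (fun n => 2 * C * n.+1%:R^-1)).
  - apply: nearW => n; rewrite normr_ge0 /= IE.
    apply: (le_trans (ler_normB _ _)); rewrite -mulrA mulr2n mulrDl !mul1r.
    have C0 : 0 <= C by have := FC 0; rewrite expr0n addr0 divr1; apply: le_trans.
    have H : C / (1 + n.+1%:R ^+ 2) <= C / n.+1%:R.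
      have d0 : 0 < 1 + n.+1%:R ^+ 2 :> R by rewrite ltr_pwDl// sqr_ge0.
      rewrite ler_wpM2l// lef_pV2 ?posrE ?ltr0n//.
      have : 1 <= n.+1%:R :> R by rewrite ler1n.
      by nra.
    by apply: lerD; apply: le_trans H; [exact: FC|have := FC (- n.+1%:R); rewrite sqrrN].
  - exact: cvg_cst.
  - by rewrite -[X in _ --> X](mulr0 (2 * C)); apply: cvgM; [exact: cvg_cst|exact: cvg_harmonic].
exact: cvg_unique cvgI cvg0.
Unshelve. all: by end_near. Qed.

End OneDim.

(** * Integrable weights and the singularity at the origin *)

Section Weights.
Context {R : realType}.
Notation mu := (leb3 R).
Notation lam := (@lebesgue_measure R).
Implicit Types (f g : R3 R -> R).
Notation "'∫' f" := (Rintegral mu setT f) (at level 36).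

Lemma itg_prod3 (f1 f2 f3 : R -> R) : lam.-integrable setT (EFin \o f1) ->
  lam.-integrable setT (EFin \o f2) -> lam.-integrable setT (EFin \o f3) ->
  itg (fun x => f1 x.1.1 * f2 x.1.2 * f3 x.2).
Proof.
move=> i1 i2 i3.
have i12 := integrable_prod_fun i1 i2.
exact: (integrable_prod_fun (m1 := leb2) (m2 := lam) i12 i3).
Qed.

Lemma Int_prod3 (f1 f2 f3 : R -> R) : lam.-integrable setT (EFin \o f1) ->
  lam.-integrable setT (EFin \o f2) -> lam.-integrable setT (EFin \o f3) ->
  ∫ (fun x => f1 x.1.1 * f2 x.1.2 * f3 x.2) =
  (\int[lam]_t f1 t) * (\int[lam]_t f2 t) * (\int[lam]_t f3 t).
Proof.
move=> i1 i2 i3.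
have i12 := integrable_prod_fun i1 i2.
rewrite -(Rintegral_prod_fun i1 i2).
exact: (Rintegral_prod_fun (m1 := leb2) (m2 := lam) i12 i3).
Qed.

(** The weight in the Schwartz seminorms. *)
Definition wt (x : R3 R) : R := 1 + dot x x.

Lemma wt_ge1 x : 1 <= wt x. Proof. by rewrite lerDl dot_ge0. Qed.
Lemma wt_gt0 x : 0 < wt x. Proof. exact: lt_le_trans (wt_ge1 x). Qed.
Lemma wt_ge0 x : 0 <= wt x. Proof. exact: ltW (wt_gt0 x). Qed.

Lemma msr_dot : msr (fun x : R3 R => dot x x).
Proof.
rewrite /dot /msr; apply: measurable_sum => i; apply: msrM; exact: msr_coord.
Qed.

Lemma msr_wt : msr wt.
Proof. by apply: msrD; [exact: msr_cst|exact: msr_dot]. Qed.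

Lemma msrX n f : msr f -> msr (fun x => f x ^+ n).
Proof. exact: measurable_funX. Qed.

Lemma msrV f : (forall x, 0 <= f x) -> msr f -> msr (fun x => (f x)^-1).
Proof.
move=> f0 mf; under eq_fun do rewrite -powR_inv1//.
exact: (measurableT_comp (measurable_powR _) mf).
Qed.

Lemma wt_prod_le x :
  (1 + x.1.1 ^+ 2) * (1 + x.1.2 ^+ 2) * (1 + x.2 ^+ 2) <= wt x ^+ 3.
Proof.
have := sqr_ge0 x.1.1; have := sqr_ge0 x.1.2; have := sqr_ge0 x.2.
rewrite /wt dotE -!expr2 => a b c.
have h1 : 0 <= 1 + x.1.1 ^+ 2 by lra.
have h2 : 0 <= 1 + x.1.2 ^+ 2 by lra.
have h3 : 0 <= 1 + x.2 ^+ 2 by lra.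
set w := 1 + (_ + _ + _); rewrite (_ : w ^+ 3 = w * w * w); last by ring.
rewrite {}/w; apply: ler_pM => //; first exact: mulr_ge0.
  by apply: ler_pM => //; lra.
by lra.
Qed.

Lemma msr_wtV3 : msr (fun x => (wt x ^+ 3)^-1).
Proof.
apply: msrV => [x|]; first by rewrite exprn_ge0 ?wt_ge0.
by apply: msrX; exact: msr_wt.
Qed.

(** The third power of the weight dominates the product of the weights in each
    variable, which reduces the claim to three integrals over the line. *)
Lemma itg_wtV3 : itg (fun x => (wt x ^+ 3)^-1).
Proof.
have H := itg_prod3 (@integrable_inv_oneDsqr R) integrable_inv_oneDsqr
  integrable_inv_oneDsqr.
apply: (itg_le _ H) => [|x]; first exact: msr_wtV3.
have p (t : R) : 0 < 1 + t ^+ 2 by rewrite ltr_pwDl// sqr_ge0.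
rewrite ger0_norm ?invr_ge0 ?exprn_ge0 ?wt_ge0// -!invfM.
by rewrite lef_pV2 ?posrE ?mulr_gt0 ?exprn_gt0 ?wt_gt0//; exact: wt_prod_le.
Qed.

Lemma ae_coord_neq0 i : {ae mu, forall x : R3 R, coord i x != 0}.
Proof.
exists [set x | coord i x = 0]; split.
- rewrite (_ : [set _ | _] = setT `&` coord i @^-1` [set 0]); last by rewrite setTI.
  by apply: (msr_coord i) => //; exact: measurable_set1.
- have l0 : lam [set (0 : R)] = 0%E by rewrite lebesgue_measure_set1.
  have -> : [set x | coord i x = 0] =
    ((if i == 0 :> nat then [set 0] else setT) `*`
     (if i == 1 :> nat then [set 0] else setT)) `*`
     (if i == 2 :> nat then [set 0] else setT) :> set (R3 R).
    apply/seteqP; case: i => -[|[|[|//]]] Hi; rewrite /coord /=;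
      by split=> [[[x y] z] /= //|[[x y] z] /= [[]]].
  have m1 (b : bool) : measurable (if b then [set 0] else setT : set R).
    by case: b => //; exact: measurable_set1.
  have m12 := measurableX (m1 (i == 0 :> nat)) (m1 (i == 1 :> nat)).
  have := @product_measure1E _ _ _ _ R leb2 lam _ _ m12 (m1 (i == 2 :> nat)).
  have := @product_measure1E _ _ _ _ R lam lam _ _
    (m1 (i == 0 :> nat)) (m1 (i == 1 :> nat)).
  rewrite -/leb2 => E1 E2; apply: (etrans E2); rewrite [X in (X * _)%E]E1.
  by case: i {m12 E1 E2} => -[|[|[|//]]] Hi /=; rewrite ?l0 ?mul0e ?mule0 ?mul0e.
- by move=> x /= /negP; rewrite negbK => /eqP.
Qed.

Lemma itg_ae_le f g : msr f -> itg g -> {ae mu, forall x, `|f x| <= g x} -> itg f.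
Proof.
move=> mf ig [N [mN N0 fgN]].
apply/integrableP; split; first exact/measurable_EFinP.
have mf' : measurable_fun setT (EFin \o f) by exact/measurable_EFinP.
rewrite (ge0_negligible_integral mN)//; last by apply: measurableT_comp mf'; exact: abse_measurable.
case/integrableP : ig => mg; apply: le_lt_trans.
have mD : measurable (setT `\` N) by exact: measurableD.
apply: (@le_trans _ _ (\int[mu]_(x in setT `\` N) `|(g x)%:E|)%E).
  apply: ge0_le_integral => //.
  - by apply: measurable_funTS; apply: measurableT_comp mf'; exact: abse_measurable.
  - by apply: measurable_funTS; apply: measurableT_comp mg; exact: abse_measurable.
  move=> x [_ Nx]; rewrite /= lee_fin; apply: le_trans (ler_norm _).
  by apply: contrapT => H; exact/Nx/fgN.
by apply: ge0_subset_integral => //; apply: measurableT_comp mg; exact: abse_measurable.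
Qed.

(** Since |x|^2 is a sum of three terms |x_i|^2, the inequality of arithmetic
    and geometric means bounds |x|^-2 by the product of the |x_i|^(-2/3). Each
    factor has an integrable singularity. *)
Lemma itg_inv_dot : itg (fun x => (dot x x)^-1 * (wt x ^+ 3)^-1).
Proof.
have H := itg_prod3 (@integrable_inv_cuberoot R) integrable_inv_cuberoot
  integrable_inv_cuberoot.
apply: (itg_ae_le _ H).
  apply: msrM; last exact: msr_wtV3.
  by apply: msrV; [exact: dot_ge0|exact: msr_dot].
move: (ae_coord_neq0 o0) (ae_coord_neq0 o1)
  (ae_coord_neq0 o2).
apply: filterS3; first exact: (ae_filter_ringOfSetsType mu).
move=> x x1 x2 x3.
have p (t : R) : 0 < 1 + t ^+ 2 by rewrite ltr_pwDl// sqr_ge0.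
have cr (t : R) : (`|t| `^ (2 / 3)) ^+ 3 = t ^+ 2.
  rewrite -powR_mulrn ?powR_ge0// -powRrM -[RHS]real_normK ?num_real//.
  by rewrite -powR_mulrn//; congr powR; lra.
have cr0 (t : R) : t != 0 -> 0 < `|t| `^ (2 / 3) by move=> t0; rewrite powR_gt0 ?normr_gt0.
have := cr0 _ x1; have := cr0 _ x2; have := cr0 _ x3.
have := cr x.1.1; have := cr x.1.2; have := cr x.2; rewrite /coord /= !powRN.
set a := _ `^ _; set b := _ `^ _; set c := _ `^ _ => Ea Eb Ec a0 b0 c0.
have d0 : 0 < dot x x by rewrite dotE -!expr2 -Ea -Eb -Ec !addr_gt0// exprn_gt0.
rewrite ger0_norm; last by rewrite mulr_ge0 ?invr_ge0 ?exprn_ge0 ?wt_ge0 ?dot_ge0.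
rewrite -!invfM lef_pV2 ?posrE ?mulr_gt0 ?exprn_gt0 ?wt_gt0//.
rewrite (_ : _ * _ = (a * b * c) * ((1 + x.1.1 ^+ 2) * (1 + x.1.2 ^+ 2) * (1 + x.2 ^+ 2))); last by ring.
apply: ler_pM; last exact: wt_prod_le.
- by rewrite !mulr_ge0// ltW.
- by rewrite !mulr_ge0// ltW.
rewrite dotE -!expr2 -Ea -Eb -Ec.
(* with a, b, c the |x_i|^(2/3), the claim a b c <= a^3 + b^3 + c^3 follows
   from a^3 + b^3 + c^3 - 3 a b c = (a + b + c) (sum of squares) / 2 *)
have : 0 <= (a + b + c) * ((a - b) ^+ 2 + (b - c) ^+ 2 + (c - a) ^+ 2).
  by rewrite mulr_ge0// ?addr_ge0 ?sqr_ge0// ltW.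
have : 0 <= a * b * c by rewrite !mulr_ge0// ltW.
nra.
Qed.
End Weights.

(** * The Schwartz class *)

Section SchwartzClass.
Context {R : realType}.
Notation mu := (leb3 R).
Implicit Types (f g phi : R3 R -> R) (x : R3 R) (i j : 'I_3).
Notation "'∫' f" := (Rintegral mu setT f) (at level 36).

Lemma is_derive_mul (V : normedModType R) (f g : V -> R) (x v : V) (df dg : R) :
  is_derive x v f df -> is_derive x v g dg ->
  is_derive x v (fun y => f y * g y) (f x * dg + df * g x).
Proof. by move=> d1 d2; rewrite (mulrC df); exact: is_deriveM. Qed.

Lemma is_derive_scal (V : normedModType R) (a : R) (f : V -> R) (x v : V) (df : R) :
  is_derive x v f df -> is_derive x v (fun y => a * f y) (a * df).
Proof. exact: is_deriveZ. Qed.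

Lemma is_derive_add (V : normedModType R) (f g : V -> R) (x v : V) (df dg : R) :
  is_derive x v f df -> is_derive x v g dg ->
  is_derive x v (fun y => f y + g y) (df + dg).
Proof. exact: is_deriveD. Qed.

Lemma upd_basis i (h : R) x : h *: basis i + x = upd i (h + coord i x) x.
Proof.
have lin (a b c y1 y2 y3 : R) : h *: ((a, b, c) : R3 R) + ((y1, y2, y3) : R3 R) =
  (h * a + y1, h * b + y2, h * c + y3) by [].
case: x => -[x1 x2] x3; case: i => -[|[|[|//]]] Hi;
  by rewrite /upd /basis /coord /= lin !mulr0 mulr1 !add0r.
Qed.

(** Reduces partial derivatives to derivatives of functions of one real
    variable. *)
Lemma is_derive_slice i f x (l : R) :
  is_derive x (basis i) f l <->
  is_derive (coord i x) (1 : R) (fun t => f (upd i t x)) l.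
Proof.
have E : (fun h : R => h^-1 *: (((fun t => f (upd i t x)) \o shift (coord i x)) (h *: (1 : R))
           - f (upd i (coord i x) x))) =
         (fun h : R => h^-1 *: ((f \o shift x) (h *: basis i) - f x)).
  apply/funext => h /=; rewrite upd_basis scaler1.
  by have := upd_basis i 0 x; rewrite scale0r !add0r => <-.
by split=> -[d e]; split; rewrite /derivable /derive ?E in d e *.
Qed.

Lemma coordE i j x (t : R) : coord j (upd i t x) = if j == i then t else coord j x.
Proof.
by case: i => -[|[|[|//]]] Hi; case: j => -[|[|[|//]]] Hj.
Qed.

Lemma is_derive_coord i j x : is_derive x (basis i) (coord j) ((j == i)%:R : R).
Proof.
apply/is_derive_slice; under eq_fun do rewrite coordE.
by case: (j == i); [exact: is_derive_id|exact: is_derive_cst].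
Qed.

(** All iterated derivatives of a member of P lie in P, so the bound is only
    needed without derivatives. It replaces inductions over multi-indices: to
    show that a function is Schwartz, put it into a class that is stable under
    differentiation. *)
Lemma schwartz_coind (P : (R3 R -> R) -> Prop) :
  (forall f, P f -> continuous f) ->
  (forall f i, P f -> exists2 f', P f' & forall x, is_derive x (basis i) f (f' x)) ->
  (forall f N, P f -> exists C, forall x, wt x ^+ N * `|f x| <= C) ->
  forall f, P f -> schwartz f.
Proof.
move=> Pc Pd Pb f Pf.
have Pp g i : P g -> P (partial i g).
  move=> /Pd - /(_ i) [g' Pg' gg']; rewrite (_ : partial i g = g')//.
  by apply/funext => x; rewrite /partial; have [_ ->] := gg' x.
have Ps s : P (partials s f) by elim: s => //= i s IH; exact: Pp.
split=> [s|N s]; last exact: Pb.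
split=> [|x i]; first exact: Pc.
by have [f' _ /(_ x) []] := Pd _ i (Ps s).
Qed.

Lemma schwartz_continuous f : schwartz f -> continuous f.
Proof. by case=> /(_ [::]) []. Qed.

Lemma schwartz_derive f i x : schwartz f -> is_derive x (basis i) f (partial i f x).
Proof. by case=> /(_ [::]) [_ d] _; split => //; exact: d. Qed.

Lemma partials_rcons f s i : partials (rcons s i) f = partials s (partial i f).
Proof. by rewrite /partials foldr_rcons. Qed.

Lemma schwartz_partial f i : schwartz f -> schwartz (partial i f).
Proof.
move=> [sf bf]; split=> [s|N s]; first by rewrite -partials_rcons; exact: sf.
have [C HC] := bf N (rcons s i); exists C => x.
by have := HC x; rewrite /weighted partials_rcons.
Qed.

Lemma schwartz_bounded f N : schwartz f -> exists C, forall x, wt x ^+ N * `|f x| <= C.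
Proof. by move=> [_ /(_ N [::])]. Qed.

Lemma schwartz_lin (a : R) f g : schwartz f -> schwartz g ->
  schwartz (fun x => a * f x + g x).
Proof.
move=> sf sg.
pose P h := exists2 u, schwartz u & exists2 v, schwartz v & h = (fun x => a * u x + v x).
apply: (@schwartz_coind P); last by exists f => //; exists g.
- move=> _ [u su [v sv ->]] x; apply: cvgD; last exact: schwartz_continuous.
  by apply: cvgM; [exact: cvg_cst|exact: schwartz_continuous].
- move=> _ i [u su [v sv ->]]; exists (fun x => a * partial i u x + partial i v x).
    by exists (partial i u); [exact: schwartz_partial|exists (partial i v) => //; exact: schwartz_partial].
  move=> x; apply: is_derive_add; last exact: schwartz_derive.
  by apply: is_derive_scal; exact: schwartz_derive.
- move=> _ N [u su [v sv ->]].
  have [C HC] := schwartz_bounded N su; have [D HD] := schwartz_bounded N sv.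
  exists (`|a| * C + D) => x.
  have w0 : 0 <= wt x ^+ N by rewrite exprn_ge0 ?wt_ge0.
  apply: (le_trans (ler_wpM2l w0 (ler_normD _ _))); rewrite mulrDr lerD// normrM.
  by rewrite mulrCA ler_wpM2l.
Qed.

Lemma schwartz0 : schwartz (fun=> 0 : R).
Proof.
apply: (@schwartz_coind (fun h => h = fun=> 0)) => // [_ ->|_ i ->|_ N ->].
- exact: cst_continuous.
- by exists (fun=> 0) => // x; exact: is_derive_cst.
- by exists 0 => x; rewrite normr0 mulr0.
Qed.

Lemma schwartzZ (a : R) f : schwartz f -> schwartz (fun x => a * f x).
Proof. by move=> /(schwartz_lin a) /(_ schwartz0); under eq_fun do rewrite addr0. Qed.

Lemma schwartzN f : schwartz f -> schwartz (fun x => - f x).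
Proof. by move=> /(schwartzZ (-1)); under eq_fun do rewrite mulN1r. Qed.

Lemma continuous_coord i : continuous (coord i : R3 R -> R).
Proof.
case: i => -[|[|[|//]]] Hi x; rewrite /coord /=.
- by apply: (cvg_comp fst fst); exact: cvg_fst.
- by apply: (cvg_comp fst snd); [exact: cvg_fst|exact: cvg_snd].
- exact: cvg_snd.
Qed.

Lemma coord_le_wt i x : `|coord i x| <= wt x.
Proof.
have := coord_sqr_le i x; rewrite -[_ ^+ 2]real_normK ?num_real// /wt.
have := sqr_ge0 (`|coord i x| - 1); nra.
Qed.

Lemma schwartz_coordM i f : schwartz f -> schwartz (fun x => coord i x * f x).
Proof.
move=> sf.
pose P h := exists2 u, schwartz u & exists2 v, schwartz v & h = (fun x => coord i x * u x + v x).
apply: (@schwartz_coind P).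
- move=> _ [u su [v sv ->]] x; apply: cvgD; last exact: schwartz_continuous.
  by apply: cvgM; [exact: continuous_coord|exact: schwartz_continuous].
- move=> _ k [u su [v sv ->]].
  exists (fun x => coord i x * partial k u x + ((i == k)%:R * u x + partial k v x)).
    exists (partial k u); first exact: schwartz_partial.
    by exists (fun x => (i == k)%:R * u x + partial k v x) => //; apply: schwartz_lin => //; exact: schwartz_partial.
  move=> x; rewrite addrA; apply: is_derive_add; last exact: schwartz_derive.
  by apply: is_derive_mul; [exact: is_derive_coord|exact: schwartz_derive].
- move=> _ N [u su [v sv ->]].
  have [C HC] := schwartz_bounded N.+1 su; have [D HD] := schwartz_bounded N sv.
  exists (C + D) => x.
  have w0 : 0 <= wt x ^+ N by rewrite exprn_ge0 ?wt_ge0.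
  apply: (le_trans (ler_wpM2l w0 (ler_normD _ _))); rewrite mulrDr lerD// normrM.
  by apply: le_trans (HC x); rewrite mulrA exprSr ler_wpM2r// ler_wpM2l// coord_le_wt.
- by exists f => //; exists (fun=> 0) => //; [exact: schwartz0|under [RHS]eq_fun do rewrite addr0].
Qed.

Lemma schwartz_refl f : schwartz f -> schwartz (f \o refl).
Proof.
move=> sf.
pose P h := exists2 u : R3 R -> R, schwartz u & h = u \o refl.
apply: (@schwartz_coind P); last by exists f.
- move=> _ [u su ->] x; apply: continuous_comp; last exact: schwartz_continuous.
  have c i : {for x, continuous (fun y : R3 R => - coord i y)}.
    by apply: cvgN; exact: continuous_coord.
  have Fx : Filter (nbhs (x : R3 R)) by exact: nbhs_filter.
  have FR (t : R) : Filter (nbhs t) by exact: nbhs_filter.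
  have c01 := cvg_pair (FF := Fx) (FG := FR _) (FH := FR _) (c o0) (c o1).
  exact: (cvg_pair (FF := Fx) (FH := FR _) c01 (c o2)).
- move=> _ k [u su ->]; exists ((fun x => - partial k u x) \o refl).
    by exists (fun x => - partial k u x) => //; apply: schwartzN; exact: schwartz_partial.
  move=> x; apply/is_derive_slice.
  have := schwartz_derive k (refl x) su => /is_derive_slice d.
  have -> : (fun t => (u \o refl) (upd k t x)) = (fun t => u (upd k t (refl x))) \o -%R.
    by apply/funext => t; congr u; case: k {d} => -[|[|[|//]]] Hk.
  have cE : coord k (refl x) = - coord k x by case: k {d} => -[|[|[|//]]] Hk.
  rewrite cE in d.
  have dN : is_derive (coord k x) (1 : R) (-%R : R -> R) (-1).
    exact: (is_deriveN (is_derive_id (coord k x) (1 : R))).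
  by have := is_derive1_comp d dN; rewrite mulrN1.
- move=> _ N [u su ->]; have [C HC] := schwartz_bounded N su.
  exists C => x; have := HC (refl x); rewrite /wt !dotE /= !mulrNN; exact.
Qed.

Lemma schwartz_le_wtV f N : schwartz f -> exists C, forall x, `|f x| <= C * (wt x ^+ N)^-1.
Proof.
move=> /(schwartz_bounded N) [C HC]; exists C => x.
by rewrite ler_pdivlMr ?exprn_gt0 ?wt_gt0// mulrC.
Qed.

Lemma schwartz_itg f : schwartz f -> itg f.
Proof.
move=> sf; have [C HC] := schwartz_le_wtV 3 sf.
by apply: (itg_le _ (itgZ C itg_wtV3)) => //; apply: continuous_msr; exact: schwartz_continuous.
Qed.

Lemma schwartz_L2 f : schwartz f -> L2 f.
Proof.
move=> sf; have mf := continuous_msr (schwartz_continuous sf).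
apply/L2P; split=> //.
have [C HC] := schwartz_le_wtV 0 sf.
have ifn : itg (fun x => `|f x|) by exact: integrable_abse (schwartz_itg sf).
apply: (itg_le _ (itgZ C ifn)); first exact: msrX.
move=> x; rewrite normrX expr2 ler_wpM2r//.
by have := HC x; rewrite expr0 invr1 mulr1.
Qed.

End SchwartzClass.

(** * The Fourier transform and its derivatives *)

Section Trigo.
Context {R : realType}.
Implicit Types (a b t : R).

Lemma mean_value_bound (f f' : R -> R) (M a b : R) :
  (forall t, is_derive t (1 : R) f (f' t)) ->
  (forall t, `|t - a| <= `|b - a| -> `|f' t| <= M) ->
  `|f b - f a| <= M * `|b - a|.
Proof.
move=> df fM.
have cf : continuous f.
  by move=> t; apply: differentiable_continuous; apply/derivable1_diffP; have [] := df t.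
have [ab|ba|->] := ltgtP a b; last by rewrite !subrr normr0 mulr0.
- have [c cab ->] := MVT ab (fun t _ => df t) (continuous_subspaceT cf).
  rewrite normrM ler_wpM2r// fM//; move: cab; rewrite in_itv /= => /andP[ac cb].
  by rewrite !gtr0_norm ?subr_gt0//; lra.
- have [c cab E] := MVT ba (fun t _ => df t) (continuous_subspaceT cf).
  rewrite distrC E normrM (distrC a b) ler_wpM2r// fM//.
  move: cab; rewrite in_itv /= => /andP[ac cb].
  by rewrite !ltr0_norm ?subr_lt0//; lra.
Qed.

Lemma cos_abs_le1 t : `|cos t| <= 1.
Proof. by rewrite ler_norml cos_geN1 cos_le1. Qed.

Lemma sin_abs_le1 t : `|sin t| <= 1.
Proof. by rewrite ler_norml sin_geN1 sin_le1. Qed.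

Lemma cos_lipschitz a b : `|cos b - cos a| <= `|b - a|.
Proof.
rewrite -[leRHS]mul1r; apply: (@mean_value_bound cos (fun t => - sin t)).
by move=> t _; rewrite normrN sin_abs_le1.
Qed.

Lemma sin_lipschitz a b : `|sin b - sin a| <= `|b - a|.
Proof.
rewrite -[leRHS]mul1r; apply: (@mean_value_bound sin cos).
by move=> t _; exact: cos_abs_le1.
Qed.

Lemma cos_taylor1 a t : `|cos (a + t) - cos a + t * sin a| <= t ^+ 2.
Proof.
pose f s := cos s + s * sin a.
have -> : cos (a + t) - cos a + t * sin a = f (a + t) - f a by rewrite /f; ring.
have -> : t ^+ 2 = `|t| * `|(a + t) - a| by rewrite addrC addKr -expr2 real_normK ?num_real.
apply: (@mean_value_bound f (fun s => - sin s + sin a)).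
  move=> s; apply: is_derive_add.
  have := is_derive_mul (is_derive_id s (1 : R)) (is_derive_cst (sin a) s (1 : R)).
  by rewrite mulr0 add0r mul1r.
move=> s; have -> : a + t - a = t by ring.
by rewrite (addrC (- sin s)) distrC; apply: le_trans; exact: sin_lipschitz.
Qed.

(** For an integral that depends on a parameter, the remainder of the integrand
    can be integrated, so a quadratic bound on it gives the derivative without a
    limit under the integral sign. *)
Lemma is_derive_quadratic (V : normedModType R) (f : V -> R) (x v : V) (l M : R) :
  (forall h : R, `|f (h *: v + x) - f x - h * l| <= M * h ^+ 2) -> is_derive x v f l.
Proof.
move=> H.
suff H2 : h^-1 *: (f (h *: v + x) - f x) @[h --> 0^'] --> l.
  split; first by apply/cvg_ex; exists l; exact: H2.
  by apply/cvg_lim => //; exact: H2.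
apply/cvgrPdist_le => /= e e0.
have M0 : 0 <= M by have := H 1; rewrite expr1n mulr1; apply: le_trans.
near=> h.
have h0 : h != 0 by near: h; exact: nbhs_dnbhs_neq.
have -> : l - h^-1 *: (f (h *: v + x) - f x) = - (h^-1 * (f (h *: v + x) - f x - h * l)).
  by rewrite /GRing.scale /=; field.
rewrite normrN normrM normfV ler_pdivrMl ?normr_gt0//.
apply: (le_trans (H h)).
rewrite -[h ^+ 2]real_normK ?num_real// expr2 mulrCA ler_wpM2l//.
have : `|h| <= e / (M + 1).
  near: h; apply: dnbhs0_le; rewrite divr_gt0//; lra.
rewrite ler_pdivlMr; last lra.
have := normr_ge0 h; nra.
Unshelve. all: by end_near. Qed.

End Trigo.

Section Fourier.
Context {R : realType}.
Notation mu := (leb3 R).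
Implicit Types (f g phi : R3 R -> R) (x xi : R3 R) (i j : 'I_3) (th : R).
Notation "'∫' f" := (Rintegral mu setT f) (at level 36).

(** The phase th puts [cos_tr] and [sin_tr] into one family, for th = 0 and th =
    - pi / 2. Differentiating the transform shifts the phase by pi / 2, and
    transforming a derivative shifts it back, so the family is stable under
    both. *)
Definition ft th phi xi := ∫ (fun x => cos (2 * pi * dot x xi + th) * phi x).

Lemma cos_trE phi : cos_tr phi = ft 0 phi.
Proof.
by apply/funext => xi; congr Rintegral; apply/funext => x; rewrite addr0.
Qed.

Lemma sin_trE phi : sin_tr phi = ft (- (pi / 2)) phi.
Proof.
by apply/funext => xi; congr Rintegral; apply/funext => x; rewrite cosBpihalf.
Qed.

Lemma msr_dotr xi : msr (dot^~ xi).
Proof.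
rewrite /dot /msr; apply: measurable_sum => i; apply: msrM; last exact: msr_cst.
exact: msr_coord.
Qed.

Lemma msr_wave th xi : msr (fun x => cos (2 * pi * dot x xi + th)).
Proof.
have mcos : measurable_fun setT (cos : R -> R).
  by apply: continuous_measurable_fun; exact: continuous_cos.
apply: (measurableT_comp mcos); apply: msrD; last exact: msr_cst.
by apply: msrM; [exact: msr_cst|exact: msr_dotr].
Qed.

Lemma itg_abs f : itg f -> itg (fun x => `|f x|).
Proof. exact: integrable_abse. Qed.

Lemma itg_wave th xi phi : itg phi -> itg (fun x => cos (2 * pi * dot x xi + th) * phi x).
Proof.
move=> ip; apply: (itg_le _ (itg_abs ip)).
  by apply: msrM; [exact: msr_wave|exact: itg_msr].
by move=> x; rewrite normrM ler_piMl// cos_abs_le1.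
Qed.

Lemma ft_bound th phi xi : itg phi -> `|ft th phi xi| <= ∫ (fun x => `|phi x|).
Proof.
move=> ip; apply: Int_abs; [exact: itg_msr (itg_wave th xi ip)|exact: itg_abs|].
by move=> x; rewrite normrM ler_piMl// cos_abs_le1.
Qed.

Lemma ft_lin th (a : R) f g xi : itg f -> itg g ->
  ft th (fun x => a * f x + g x) xi = a * ft th f xi + ft th g xi.
Proof.
move=> fi gi; rewrite /ft -IntZ; last exact: itg_wave.
rewrite -IntD; [|apply: itgZ|]; [|exact: itg_wave|exact: itg_wave].
by congr Rintegral; apply/funext => x; ring.
Qed.

Lemma dotC x y : dot x y = dot y x.
Proof. by rewrite !dotE; ring. Qed.

Lemma dot_upd x xi i (h : R) :
  dot x (h *: basis i + xi) = h * coord i x + dot x xi.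
Proof.
rewrite upd_basis !dotE; case: i => -[|[|[|//]]] Hi; rewrite /upd /coord /=; ring.
Qed.

Lemma is_derive_ft th phi xi i : itg phi -> itg (fun x => coord i x * phi x) ->
  itg (fun x => coord i x ^+ 2 * phi x) ->
  is_derive xi (basis i) (ft th phi)
    (2 * pi * ft (th + pi / 2) (fun x => coord i x * phi x) xi).
Proof.
move=> i0 i1 i2.
pose M := ∫ (fun x => (2 * pi) ^+ 2 * `|coord i x ^+ 2 * phi x|).
apply: (@is_derive_quadratic _ _ _ _ _ _ M) => h.
have j2 : itg (fun x => (2 * pi) ^+ 2 * `|coord i x ^+ 2 * phi x|).
  by apply: itgZ; exact: itg_abs.
rewrite mulrA /ft -IntB ?itg_wave//.
rewrite -IntZ ?itg_wave// -IntB; last 2 first.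
- by apply: itgB; exact: itg_wave.
- by apply: itgZ; exact: itg_wave.
rewrite /M [leRHS]mulrC -IntZ//; apply: Int_abs.
- apply: itg_msr; apply: itgB; [apply: itgB|apply: itgZ]; exact: itg_wave.
- exact: itgZ.
move=> x; rewrite addrA cosDpihalf dot_upd.
set a := 2 * pi * dot x xi + th.
have -> : 2 * pi * (h * coord i x + dot x xi) + th = a + 2 * pi * h * coord i x.
  by rewrite /a; ring.
set t := 2 * pi * h * coord i x.
have -> : cos (a + t) * phi x - cos a * phi x - h * (2 * pi) * (- sin a * (coord i x * phi x))
  = (cos (a + t) - cos a + t * sin a) * phi x by rewrite /t; ring.
rewrite (normrM (coord i x ^+ 2)) (ger0_norm (sqr_ge0 _)) normrM mulrA mulrA.
apply: ler_wpM2r => //; apply: (le_trans (cos_taylor1 _ _)).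
by rewrite /t; lra.
Qed.

Lemma wave_lipschitz th xi eta x :
  `|cos (2 * pi * dot x xi + th) - cos (2 * pi * dot x eta + th)| <=
  2 * pi * \sum_(i < 3) `|coord i xi - coord i eta| * `|coord i x|.
Proof.
apply: (le_trans (cos_lipschitz _ _)).
have -> : 2 * pi * dot x xi + th - (2 * pi * dot x eta + th) =
  2 * pi * \sum_(i < 3) (coord i xi - coord i eta) * coord i x.
  by rewrite !dotE !big_ord_recl big_ord0 /coord /=; ring.
rewrite normrM ger0_norm ?mulr_ge0 ?pi_ge0// ler_wpM2l ?mulr_ge0 ?pi_ge0//.
by apply: (le_trans (ler_norm_sum _ _ _)); apply: ler_sum => i _; rewrite normrM.
Qed.

Lemma itg_sum n (F : 'I_n -> R3 R -> R) : (forall k, itg (F k)) ->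
  itg (fun x => \sum_(k < n) F k x).
Proof.
elim: n F => [|n IH] F iF.
  by under eq_fun do rewrite big_ord0; exact: itg0.
by under eq_fun do rewrite big_ord_recr /=; apply: itgD => //; exact: IH.
Qed.

Lemma Int_sum n (F : 'I_n -> R3 R -> R) : (forall k, itg (F k)) ->
  ∫ (fun x => \sum_(k < n) F k x) = \sum_(k < n) ∫ (F k).
Proof.
elim: n F => [|n IH] F iF.
  by under eq_fun do rewrite big_ord0; rewrite big_ord0 Int0.
under eq_fun do rewrite big_ord_recr /=.
by rewrite IntD ?IH ?big_ord_recr//; apply: itg_sum.
Qed.

Lemma continuous_ft th phi : itg phi -> (forall i, itg (fun x => coord i x * phi x)) ->
  continuous (ft th phi).
Proof.
move=> i0 i1 xi.
pose M i := ∫ (fun x => `|coord i x * phi x|).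
pose D (eta : R3 R) := 2 * pi * \sum_(i < 3) `|coord i xi - coord i eta| * M i.
have H eta : `|ft th phi xi - ft th phi eta| <= D eta.
  pose F i x := `|coord i xi - coord i eta| * `|coord i x * phi x|.
  have iF i : itg (F i) by apply: itgZ; exact: itg_abs.
  rewrite /D; under eq_bigr do rewrite /M -IntZ ?itg_abs//.
  rewrite -(Int_sum iF) -IntZ; last exact: itg_sum.
  rewrite /ft -IntB; [|exact: itg_wave|exact: itg_wave].
  apply: Int_abs.
  - by apply: itg_msr; apply: itgB; exact: itg_wave.
  - by apply: itgZ; exact: itg_sum.
  move=> x; rewrite -mulrBl normrM.
  have -> : \sum_(i < 3) F i x = (\sum_(i < 3) `|coord i xi - coord i eta| * `|coord i x|) * `|phi x|.
    by rewrite mulr_suml; apply: eq_bigr => i _; rewrite /F normrM mulrA.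
  by rewrite mulrA ler_wpM2r// wave_lipschitz.
have cD : D eta @[eta --> xi] --> (0 : R).
  have ci i : {for xi, continuous (fun eta => `|coord i xi - coord i eta| * M i)}.
    apply: cvgM; last exact: cvg_cst.
    by apply: cvg_norm; apply: cvgB; [exact: cvg_cst|exact: continuous_coord].
  have -> : 0 = D xi.
    by rewrite /D big1 ?mulr0// => i _; rewrite subrr normr0 mul0r.
  apply: cvgM; first exact: cvg_cst.
  under eq_fun do rewrite !big_ord_recl big_ord0 addr0.
  rewrite !big_ord_recl big_ord0 addr0.
  by apply: cvgD; [exact: ci|apply: cvgD; exact: ci].
apply/cvgrPdist_le => e e0; near=> eta.
apply: (le_trans (H eta)).
by near: eta; exact: (cvgr_le _ cD _ e0).
Unshelve. all: by end_near. Qed.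

End Fourier.

(** * The Fourier transform preserves the Schwartz class *)

Section FourierSchwartz.
Context {R : realType}.
Notation mu := (leb3 R).
Implicit Types (f g phi : R3 R -> R) (x xi : R3 R) (i j : 'I_3) (th : R).
Notation "'∫' f" := (Rintegral mu setT f) (at level 36).

Lemma continuous_upd i x : continuous (fun t : R => upd i t x).
Proof.
move=> t.
have c (b : bool) (y : R) : {for t, continuous (fun s => if b then s else y)}.
  by case: b; [exact: cvg_id|exact: cvg_cst].
have FR (s : R) : Filter (nbhs s) by exact: nbhs_filter.
have c01 := cvg_pair (FF := FR t) (FG := FR _) (FH := FR _) (c (i == 0 :> nat) x.1.1) (c (i == 1 :> nat) x.1.2).
exact: (cvg_pair (FF := FR t) (FH := FR _) c01 (c (i == 2 :> nat) x.2)).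
Qed.

(** On every line in the i-th direction, F' is the derivative of a function that
    vanishes at infinity. *)
Lemma Int_partial0 i (F F' : R3 R -> R) (C : R) :
  (forall x, is_derive x (basis i) F (F' x)) -> continuous F' ->
  (forall x, `|F x| <= C * (wt x ^+ 3)^-1) ->
  (forall x, `|F' x| <= C * (wt x ^+ 3)^-1) -> ∫ F' = 0.
Proof.
move=> dF cF' bF bF'.
have C0 : 0 <= C.
  have := le_trans (normr_ge0 _) (bF 0).
  by rewrite pmulr_lge0// invr_gt0 exprn_gt0// wt_gt0.
have iF' : itg F' by apply: (itg_le _ (itgZ C itg_wtV3)) => //; exact: continuous_msr.
apply: (fubini_slice0 (i := i) iF') => x.
have wle t : (wt (upd i t x) ^+ 3)^-1 <= (1 + t ^+ 2)^-1.
  have p : 0 < 1 + t ^+ 2 by rewrite ltr_pwDl// sqr_ge0.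
  rewrite lef_pV2 ?posrE ?exprn_gt0 ?wt_gt0//.
  have h : 1 + t ^+ 2 <= wt (upd i t x).
    by rewrite lerD2l; have := coord_sqr_le i (upd i t x); rewrite coordE eqxx.
  by apply: (le_trans h); rewrite -[leLHS]expr1; apply: ler_weXn2l => //; exact: wt_ge1.
have cF's : continuous (fun t : R => F' (upd i t x)).
  by move=> t; apply: continuous_comp; [exact: continuous_upd|exact: cF'].
apply: (@Rintegral_derive0 _ (fun t => F (upd i t x)) (fun t => F' (upd i t x)) C) => //.
- move=> t; have := dF (upd i t x) => /is_derive_slice.
  rewrite coordE eqxx (_ : (fun s => F (upd i s (upd i t x))) = (fun s => F (upd i s x)))//.
  by apply/funext => s; congr F; case: i {dF iF' wle cF's} => -[|[|[|//]]].
- by move=> t; apply: (le_trans (bF _)); exact: ler_wpM2l.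
- apply: (le_integrable _ _ _ (integrableZl measurableT C integrable_inv_oneDsqr)) => //.
    by apply/measurable_EFinP; exact: continuous_measurable_fun.
  move=> t _; rewrite /= lee_fin; apply: (le_trans (bF' _)).
  by apply: le_trans (ler_norm _); exact: ler_wpM2l.
Qed.

Lemma schwartz_coord_itg i phi : schwartz phi -> itg (fun x => coord i x * phi x).
Proof. by move=> sp; apply/schwartz_itg/schwartz_coordM. Qed.

Lemma schwartz_coord2_itg i phi : schwartz phi -> itg (fun x => coord i x ^+ 2 * phi x).
Proof.
move=> sp; under eq_fun do rewrite expr2 -mulrA.
by apply/schwartz_coord_itg/schwartz_coordM.
Qed.

Lemma continuous_wave th xi : continuous (fun x => cos (2 * pi * dot x xi + th)).
Proof.
move=> x; apply: (cvg_comp _ cos); last exact: continuous_cos.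
apply: cvgD; last exact: cvg_cst.
apply: cvgM; first exact: cvg_cst.
under eq_fun do rewrite dotE; rewrite dotE.
have c i : {for x, continuous (fun y => coord i y * coord i xi)}.
  by apply: cvgM; [exact: continuous_coord|exact: cvg_cst].
apply: cvgD; first apply: cvgD.
- exact: (c o0).
- exact: (c o1).
- exact: (c o2).
Qed.

Lemma is_derive_wave th xi i x :
  is_derive x (basis i) (fun x => cos (2 * pi * dot x xi + th))
    (2 * pi * coord i xi * cos (2 * pi * dot x xi + (th + pi / 2))).
Proof.
apply: (@is_derive_quadratic _ _ _ _ _ _ ((2 * pi * coord i xi) ^+ 2)) => h.
rewrite addrA cosDpihalf dotC dot_upd (dotC xi x).
set a := 2 * pi * dot x xi + th.
have -> : 2 * pi * (h * coord i xi + dot x xi) + th = a + 2 * pi * coord i xi * h.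
  by rewrite /a; ring.
set t := 2 * pi * coord i xi * h.
have -> : cos (a + t) - cos a - h * (2 * pi * coord i xi * - sin a) =
  cos (a + t) - cos a + t * sin a by rewrite /t; ring.
by rewrite -exprMn; exact: cos_taylor1.
Qed.

(** Integration by parts: the derivative of the product of the wave and phi has
    integral 0. *)
Lemma ft_partial th i phi xi : schwartz phi ->
  ft th (partial i phi) xi = 2 * pi * coord i xi * ft (th - pi / 2) phi xi.
Proof.
move=> sp; have sdp := schwartz_partial i sp.
pose W th x := cos (2 * pi * dot x xi + th).
pose F' x := W th x * partial i phi x - 2 * pi * coord i xi * (W (th - pi / 2) x * phi x).
suff : ∫ F' = 0.
  rewrite IntB; [|exact: itg_wave (schwartz_itg sdp)|]; last first.
    by apply: itgZ; exact: itg_wave (schwartz_itg sp).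
  by rewrite IntZ; [move/eqP; rewrite subr_eq0 => /eqP|exact: itg_wave (schwartz_itg sp)].
have [C HC] := schwartz_le_wtV 3 sp; have [D HD] := schwartz_le_wtV 3 sdp.
have W1 t x : `|W t x| <= 1 by exact: cos_abs_le1.
have C0 : 0 <= C.
  have := le_trans (normr_ge0 _) (HC 0).
  by rewrite pmulr_lge0// invr_gt0 exprn_gt0// wt_gt0.
have D0 : 0 <= D.
  have := le_trans (normr_ge0 _) (HD 0).
  by rewrite pmulr_lge0// invr_gt0 exprn_gt0// wt_gt0.
have w0 x : 0 <= (wt x ^+ 3)^-1 by rewrite invr_ge0 exprn_ge0// wt_ge0.
pose K := `|2 * pi * coord i xi|.
have K0 : 0 <= K by exact: normr_ge0.
apply: (@Int_partial0 i (fun x => W th x * phi x) F' (C + (D + K * C))).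
- move=> x; have := is_derive_mul (is_derive_wave th xi i x) (schwartz_derive i x sp).
  congr is_derive; rewrite /F' /W !addrA cosDpihalf cosB cos_pihalf sin_pihalf.
  by ring.
- move=> x; apply: cvgB; first by apply: cvgM; [exact: continuous_wave|exact: schwartz_continuous].
  apply: cvgM; first exact: cvg_cst.
  by apply: cvgM; [exact: continuous_wave|exact: schwartz_continuous].
- move=> x; rewrite normrM (le_trans (y := `|phi x|)) ?ler_piMl//.
  by apply: (le_trans (HC x)); rewrite ler_wpM2r// lerDl addr_ge0// mulr_ge0//.
- move=> x; apply: (le_trans (ler_normB _ _)).
  apply: (le_trans (y := (D + K * C) * (wt x ^+ 3)^-1)); last first.
    by rewrite ler_wpM2r// lerDr.
  rewrite [leRHS]mulrDl; apply: lerD.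
    by rewrite normrM (le_trans (y := `|partial i phi x|)) ?ler_piMl.
  rewrite normrM -[leRHS]mulrA ler_wpM2l// normrM.
  by rewrite (le_trans (y := `|phi x|)) ?ler_piMl.
Qed.

Lemma ftZ th (a : R) phi xi : itg phi -> ft th (fun x => a * phi x) xi = a * ft th phi xi.
Proof.
move=> ip; rewrite /ft -IntZ; last exact: itg_wave.
by congr Rintegral; apply/funext => x; rewrite mulrCA.
Qed.

Lemma ftBpi th phi xi : itg phi -> ft (th - pi / 2 - pi / 2) phi xi = - ft th phi xi.
Proof.
move=> ip; rewrite -[RHS]mulN1r -[RHS]ftZ//; congr Rintegral; apply/funext => x.
rewrite !addrA !cosB !sinB cos_pihalf sin_pihalf; ring.
Qed.

(** The operator 1 - Laplacian / (2 pi)^2, whose Fourier symbol is the weight. *)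
Definition bessel phi : R3 R -> R := fun x =>
  - ((2 * pi) ^+ 2)^-1 * partial o0 (partial o0 phi) x +
  (- ((2 * pi) ^+ 2)^-1 * partial o1 (partial o1 phi) x +
  (- ((2 * pi) ^+ 2)^-1 * partial o2 (partial o2 phi) x + phi x)).

Lemma schwartz_bessel phi : schwartz phi -> schwartz (bessel phi).
Proof.
move=> sp; apply: schwartz_lin; first by do 2 apply: schwartz_partial.
apply: schwartz_lin; first by do 2 apply: schwartz_partial.
by apply: schwartz_lin => //; do 2 apply: schwartz_partial.
Qed.

Lemma ft_bessel th phi xi : schwartz phi -> ft th (bessel phi) xi = wt xi * ft th phi xi.
Proof.
move=> sp.
have pp i : schwartz (partial i (partial i phi)) by do 2 apply: schwartz_partial.
have E i : - ((2 * pi) ^+ 2)^-1 * ft th (partial i (partial i phi)) xi =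
    coord i xi ^+ 2 * ft th phi xi.
  rewrite ft_partial; last exact: schwartz_partial.
  rewrite ft_partial// ftBpi; last exact: schwartz_itg.
  have : 2 * pi != 0 :> R by rewrite mulf_neq0// gt_eqF// pi_gt0.
  by move: (2 * pi) (coord i xi) (ft _ _ _) => a b c a0; field.
have s2 := schwartz_lin (- ((2 * pi) ^+ 2)^-1) (pp o2) sp.
have s1 := schwartz_lin (- ((2 * pi) ^+ 2)^-1) (pp o1) s2.
apply: (etrans (ft_lin _ _ _ (schwartz_itg (pp o0)) (schwartz_itg s1))).
rewrite (E o0).
have -> := ft_lin th (- ((2 * pi) ^+ 2)^-1) xi (schwartz_itg (pp o1)) (schwartz_itg s2).
rewrite (E o1).
have -> := ft_lin th (- ((2 * pi) ^+ 2)^-1) xi (schwartz_itg (pp o2)) (schwartz_itg sp).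
rewrite (E o2) /wt dotE; move: (ft _ _ _) => c; rewrite /coord /=; ring.
Qed.

(** Since the symbol of [bessel] is the weight, each power of the weight is paid
    for by one application of [bessel] to phi. *)
Lemma ft_decay N th phi : schwartz phi ->
  exists C, forall xi, wt xi ^+ N * `|ft th phi xi| <= C.
Proof.
elim: N phi => [|N IH] phi sp.
  by exists (∫ (fun x => `|phi x|)) => xi; rewrite mul1r ft_bound//; exact: schwartz_itg.
have [C HC] := IH _ (schwartz_bessel sp); exists C => xi.
have := HC xi; rewrite ft_bessel// normrM ger0_norm ?wt_ge0//.
by rewrite mulrA -exprSr.
Qed.

(** The class of all transforms, over all phases and Schwartz functions, is
    stable under differentiation. *)
Lemma schwartz_ft th phi : schwartz phi -> schwartz (ft th phi).
Proof.
move=> sp.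
pose P f := exists th phi, schwartz phi /\ f = ft th phi.
apply: (@schwartz_coind _ P); last by exists th, phi.
- move=> _ [t [f [sf ->]]]; apply: continuous_ft; first exact: schwartz_itg.
  by move=> i; exact: schwartz_coord_itg.
- move=> _ i [t [f [sf ->]]].
  exists (fun xi => 2 * pi * ft (t + pi / 2) (fun x => coord i x * f x) xi).
    exists (t + pi / 2), (fun x => 2 * pi * (coord i x * f x)); split.
      by apply: schwartzZ; exact: schwartz_coordM.
    by apply/funext => xi; rewrite ftZ//; exact: schwartz_coord_itg.
  move=> xi; apply: is_derive_ft; first exact: schwartz_itg.
    exact: schwartz_coord_itg.
  exact: schwartz_coord2_itg.
- by move=> _ N [t [f [sf ->]]]; exact: ft_decay.
Qed.

Lemma schwartz_cos_tr phi : schwartz phi -> schwartz (cos_tr phi).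
Proof. by rewrite cos_trE; exact: schwartz_ft. Qed.

Lemma schwartz_sin_tr phi : schwartz phi -> schwartz (sin_tr phi).
Proof. by rewrite sin_trE; exact: schwartz_ft. Qed.

Lemma partials_lin s (a : R) f g : schwartz f -> schwartz g ->
  partials s (fun x => a * f x + g x) = (fun x => a * partials s f x + partials s g x).
Proof.
move=> [sf _] [sg _]; elim: s => //= i s ->; apply/funext => x.
rewrite [LHS]/partial; apply: derive_val.
apply: is_derive_add; last by split => //; have [_] := sg s; exact.
by apply: is_derive_scal; split => //; have [_] := sf s; exact.
Qed.

Lemma weighted_bound N n phi : schwartz phi ->
  exists C, forall s x, (size s <= n)%N -> weighted N s phi x <= C.
Proof.
elim: n phi => [|n IH] phi sp.
  have [C HC] := schwartz_bounded N sp; exists C => s x.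
  by rewrite leqn0 size_eq0 => /eqP ->; exact: HC.
have [C HC] := IH _ sp.
have [C0 H0] := IH _ (schwartz_partial o0 sp).
have [C1 H1] := IH _ (schwartz_partial o1 sp).
have [C2 H2] := IH _ (schwartz_partial o2 sp).
exists (Num.max (Num.max C C0) (Num.max C1 C2)) => s x.
case/lastP: s => [_|s i]; first by rewrite !le_max HC.
rewrite size_rcons ltnS => sn.
have E : weighted N (rcons s i) phi x = weighted N s (partial i phi) x.
  by rewrite /weighted partials_rcons.
rewrite E !le_max; case: i {E} => -[|[|[|//]]] Hi.
- by rewrite (_ : Ordinal Hi = o0) ?H0 ?orbT//; exact: val_inj.
- by rewrite (_ : Ordinal Hi = o1) ?H1 ?orbT//; exact: val_inj.
- by rewrite (_ : Ordinal Hi = o2) ?H2 ?orbT//; exact: val_inj.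
Qed.

(** The supremum that defines the norm is finite, because there are finitely
    many words of bounded length. *)
Lemma weighted_le_norm N s phi x : schwartz phi -> (size s <= N)%N ->
  weighted N s phi x <= schwartz_norm N phi.
Proof.
move=> sp sN; apply: ub_le_sup; last by exists s, x.
have [C HC] := weighted_bound N N sp; exists C => r [s' [x' [ss ->]]].
exact: HC.
Qed.

Let bd k (A : R) phi := forall s, (size s <= k)%N ->
  forall x, `|partials s phi x| <= A * (wt x ^+ 3)^-1.

Let bd_bessel k A phi : schwartz phi -> bd k.+2 A phi -> bd k (4 * A) (bessel phi).
Proof.
move=> sp bA s sk x.
have pp i : schwartz (partial i (partial i phi)) by do 2 apply: schwartz_partial.
have s2 := schwartz_lin (- ((2 * pi) ^+ 2)^-1) (pp o2) sp.
have s1 := schwartz_lin (- ((2 * pi) ^+ 2)^-1) (pp o1) s2.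
rewrite (partials_lin _ _ (pp o0) s1) (partials_lin _ _ (pp o1) s2) (partials_lin _ _ (pp o2) sp).
pose B := A * (wt x ^+ 3)^-1.
have c1 (c y : R) : `|c| <= 1 -> `|y| <= B -> `|c * y| <= B.
  by move=> ? ?; rewrite normrM -[leRHS]mul1r ler_pM.
have cpi : `|- ((2 * pi) ^+ 2)^-1 : R| <= 1.
  rewrite normrN ger0_norm ?invr_ge0 ?sqr_ge0// invf_le1 ?exprn_gt0 ?mulr_gt0 ?pi_gt0//.
  by have := pi_ge2 R; nra.
have H i : `|- ((2 * pi) ^+ 2)^-1 * partials s (partial i (partial i phi)) x| <= B.
  by apply: c1 => //; rewrite -!partials_rcons; apply: bA; rewrite !size_rcons !ltnS.
have H0 : `|partials s phi x| <= B by apply: bA; exact: leq_trans sk (leqW (leqnSn k)).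
rewrite (_ : 4 * A * _ = B + (B + (B + B))); last by rewrite /B; ring.
apply: (le_trans (ler_normD _ _)); apply: lerD => //.
apply: (le_trans (ler_normD _ _)); apply: lerD => //.
by apply: (le_trans (ler_normD _ _)); apply: lerD.
Qed.

(** The continuity of the transform in the Schwartz topology, as needed for
    tempered distributions. Two applications of [bessel] give the decay; each
    involves two derivatives and has four terms with coefficients at most 1,
    hence the order 4 of the norm and the factor 16. *)
Lemma ft_norm_bound : exists K : R, forall phi th xi, schwartz phi ->
  `|ft th phi xi| <= K * schwartz_norm 4 phi * (wt xi ^+ 2)^-1.
Proof.
exists (16 * ∫ (fun x : R3 R => (wt x ^+ 3)^-1)) => phi th xi sp.
have sbb := schwartz_bessel (schwartz_bessel sp).
rewrite ler_pdivlMr ?exprn_gt0 ?wt_gt0// mulrC.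
rewrite -[wt xi ^+ 2]ger0_norm ?exprn_ge0 ?wt_ge0// -normrM expr2 -mulrA.
rewrite -ft_bessel// -ft_bessel; last exact: schwartz_bessel.
apply: (le_trans (ft_bound _ _ (schwartz_itg sbb))).
set M := schwartz_norm 4 phi.
have b4 : bd 4 M phi.
  move=> s s4 x; have := weighted_le_norm x sp s4; rewrite -/M /weighted -/(wt x) => H.
  rewrite ler_pdivlMr ?exprn_gt0 ?wt_gt0// (le_trans _ H)// mulrC ler_wpM2r//.
  by rewrite ler_weXn2l// wt_ge1.
have b0 := bd_bessel (schwartz_bessel sp) (bd_bessel sp b4).
rewrite (_ : 16 * _ * M = (4 * (4 * M)) * ∫ (fun x : R3 R => (wt x ^+ 3)^-1)); last by ring.
rewrite -IntZ; last exact: itg_wtV3.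
apply: le_Rintegral => //; [exact: itg_abs (schwartz_itg sbb)|exact: itgZ itg_wtV3|].
by move=> x _; exact: (b0 [::]).
Qed.

End FourierSchwartz.

(** * Gaussians *)

Section Gaussians.
Context {R : realType}.
Notation mu := (leb3 R).
Notation lam := (@lebesgue_measure R).
Implicit Types (f g phi : R3 R -> R) (x xi : R3 R) (i j : 'I_3) (th : R).
Notation "'∫' f" := (Rintegral mu setT f) (at level 36).

(** Moves from a to x by changing one coordinate at a time. *)
Lemma lipschitz_R3 (f : R3 R -> R) (f' : 'I_3 -> R3 R -> R) (M : R) a x :
  (forall i x, is_derive x (basis i) f (f' i x)) -> (forall i x, `|f' i x| <= M) ->
  `|f x - f a| <= M * (`|x.1.1 - a.1.1| + `|x.1.2 - a.1.2| + `|x.2 - a.2|).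
Proof.
move=> df bf.
have step i y (s t : R) : `|f (upd i s y) - f (upd i t y)| <= M * `|s - t|.
  apply: (@mean_value_bound _ (fun u => f (upd i u y)) (fun u => f' i (upd i u y))).
    move=> u; have := df i (upd i u y) => /is_derive_slice; rewrite coordE eqxx.
    rewrite (_ : (fun s => f (upd i s (upd i u y))) = (fun s => f (upd i s y)))//.
    by apply/funext => v; congr f; case: i => -[|[|[|//]]].
  by move=> u _; exact: bf.
case: x a => [[x1 x2] x3] [[a1 a2] a3] /=.
have -> : f (x1, x2, x3) - f (a1, a2, a3) =
  (f (x1, x2, x3) - f (a1, x2, x3)) + (f (a1, x2, x3) - f (a1, a2, x3)) +
  (f (a1, a2, x3) - f (a1, a2, a3)) by ring.
rewrite 2!mulrDr; apply: (le_trans (ler_normD _ _)); apply: lerD.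
  apply: (le_trans (ler_normD _ _)); apply: lerD.
    exact: (step o0 (x1, x2, x3) x1 a1).
  exact: (step o1 (a1, x2, x3) x2 a2).
exact: (step o2 (a1, a2, x3) x3 a3).
Qed.

Definition gauss (c : R) x := expR (- c * dot x x).

Lemma gauss_gt0 c x : 0 < gauss c x. Proof. exact: expR_gt0. Qed.

Lemma dot_upd_sqr i t x :
  dot (upd i t x) (upd i t x) = t ^+ 2 + (dot x x - coord i x ^+ 2).
Proof. by rewrite !dotE; case: i => -[|[|[|//]]] Hi; rewrite /upd /coord /=; ring. Qed.

Lemma is_derive_exp_comp (h : R -> R) (h' t : R) : is_derive t (1 : R) h h' ->
  is_derive t (1 : R) (expR \o h) (h' * expR (h t)).
Proof. by move=> d; rewrite mulrC; apply: is_derive1_comp. Qed.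

Lemma is_derive_affine_sqr (c r t : R) :
  is_derive t (1 : R) (fun s => c * (s ^+ 2 + r)) (2 * c * t).
Proof.
have := is_derive_scal c (is_derive_add (is_derive_mul (is_derive_id t (1 : R))
  (is_derive_id t (1 : R))) (is_derive_cst r t (1 : R))).
rewrite mul1r mulr1 addr0 (_ : c * (t + t) = 2 * c * t); last by ring.
by under eq_fun do rewrite /= -expr2.
Qed.

Lemma is_derive_gauss c i x :
  is_derive x (basis i) (gauss c) (- 2 * c * (coord i x * gauss c x)).
Proof.
apply/is_derive_slice; rewrite /gauss.
under eq_fun do rewrite dot_upd_sqr.
have := is_derive_exp_comp (is_derive_affine_sqr (- c) (dot x x - coord i x ^+ 2) (coord i x)).
rewrite (_ : coord i x ^+ 2 + (dot x x - coord i x ^+ 2) = dot x x); last by ring.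
by rewrite (_ : 2 * - c * coord i x * _ = - 2 * c * (coord i x * expR (- c * dot x x))); last by ring.
Qed.

Lemma continuous_dot : continuous (fun x : R3 R => dot x x).
Proof.
rewrite (_ : (fun x => dot x x) = fun x => x.1.1 * x.1.1 + x.1.2 * x.1.2 + x.2 * x.2); last first.
  by apply/funext => x; rewrite dotE.
move=> x; have c i : {for x, continuous (fun y : R3 R => coord i y * coord i y)}.
  by apply: cvgM; exact: continuous_coord.
apply: cvgD; first apply: cvgD; [exact: (c o0)|exact: (c o1)|exact: (c o2)].
Qed.

Lemma continuous_gauss c : continuous (gauss c).
Proof.
move=> x; apply: (cvg_comp _ expR); last exact: continuous_expR.
by apply: cvgM; [exact: cvg_cst|exact: continuous_dot].
Qed.

Lemma gauss_decay c N : 0 < c -> exists C, forall x, wt x ^+ N * `|gauss c x| <= C.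
Proof.
move=> c0; exists (expR c * (N.+1`!%:R / c ^+ N.+1)) => x.
rewrite gtr0_norm ?gauss_gt0// /gauss.
(* exp (- c |x|^2) = exp c / exp (c wt), and exp s >= s^(N+1) / (N+1)! *)
have -> : expR (- c * dot x x) = expR c * (expR (c * wt x))^-1.
  by rewrite -expRN -expRD /wt; congr expR; ring.
rewrite mulrCA ler_wpM2l ?expR_ge0//.
rewrite ler_pdivrMr ?expR_gt0//.
have := expR_ge1Dxn N (mulr_ge0 (ltW c0) (wt_ge0 x)).
have f0 : 0 < N.+1`!%:R :> R by rewrite ltr0n fact_gt0.
have cN : 0 < c ^+ N.+1 by rewrite exprn_gt0.
rewrite exprMn => h.
apply: (le_trans (y := wt x ^+ N.+1)); first by rewrite ler_weXn2l// wt_ge1.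
have -> : wt x ^+ N.+1 = N.+1`!%:R / c ^+ N.+1 * (c ^+ N.+1 * wt x ^+ N.+1 / N.+1`!%:R).
  by field; rewrite !gt_eqF.
rewrite ler_wpM2l ?divr_ge0 ?ltW//.
by apply: lt_le_trans h; rewrite ltrDr.
Qed.

(** The Gaussian times polynomials: the smallest class that contains the
    Gaussian and is stable under differentiation and linear combinations. *)
Inductive gauss_poly (c : R) : (R3 R -> R) -> Prop :=
| GP0 : gauss_poly c (gauss c)
| GPM i f : gauss_poly c f -> gauss_poly c (fun x => coord i x * f x)
| GPL (a : R) f g : gauss_poly c f -> gauss_poly c g ->
    gauss_poly c (fun x => a * f x + g x).

Lemma schwartz_gauss c : 0 < c -> schwartz (gauss c).
Proof.
move=> c0; apply: (@schwartz_coind _ (gauss_poly c)); last exact: GP0.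
- move=> f; elim=> [|i {}f _ cf|a {}f g _ cf _ cg]; first exact: continuous_gauss.
    by move=> x; apply: cvgM; [exact: continuous_coord|exact: cf].
  by move=> x; apply: cvgD; [apply: cvgM; [exact: cvg_cst|exact: cf]|exact: cg].
- have zero : gauss_poly c (fun=> 0).
    have := GPL (-1) (GP0 c) (GP0 c).
    by under eq_fun do rewrite mulN1r addNr.
  move=> f k; elim=> [|i {}f gf [f' gf' df]|a {}f g gf [f' gf' df] gg [g' gg' dg]].
  + exists (fun x => (- 2 * c) * (coord k x * gauss c x) + 0).
      by apply: (@GPL c _ (fun x => coord k x * gauss c x)) => //; apply: GPM; exact: GP0.
    by move=> x; rewrite addr0; exact: is_derive_gauss.
  + exists (fun x => (i == k)%:R * f x + coord i x * f' x).
      by apply: (@GPL c _ f) => //; exact: GPM.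
    move=> x; rewrite addrC; have := is_derive_mul (is_derive_coord k i x) (df x).
    exact.
  + exists (fun x => a * f' x + g' x); first exact: GPL.
    by move=> x; apply: is_derive_add => //; exact: is_derive_scal.
- move=> f N gf; elim: gf N => [|i {}f _ IH|a {}f g _ IHf _ IHg] N.
  + exact: gauss_decay.
  + have [C HC] := IH N.+1; exists C => x; apply: (le_trans _ (HC x)).
    by rewrite normrM mulrA exprSr ler_wpM2r// ler_wpM2l ?exprn_ge0 ?wt_ge0// coord_le_wt.
  + have [C HC] := IHf N; have [D HD] := IHg N; exists (`|a| * C + D) => x.
    have w0 : 0 <= wt x ^+ N by rewrite exprn_ge0 ?wt_ge0.
    apply: (le_trans (ler_wpM2l w0 (ler_normD _ _))); rewrite mulrDr lerD// normrM.
    by rewrite mulrCA ler_wpM2l.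
Qed.

Definition gauss1 (b m t : R) := expR (- b * (t - m) ^+ 2).

(** A Gaussian is a multiple of a normal density, which gives its integral. *)
Lemma gauss1_normal b m t : 0 < b ->
  gauss1 b m t = Num.sqrt (pi / b) * normal_pdf m (Num.sqrt (2 * b))^-1 t.
Proof.
move=> b0; have b2 : 0 < 2 * b by rewrite mulr_gt0.
have s0 : (Num.sqrt (2 * b))^-1 != 0 by rewrite invr_neq0// gt_eqF// sqrtr_gt0.
have s2 : (Num.sqrt (2 * b))^-1 ^+ 2 = (2 * b)^-1 by rewrite exprVn sqr_sqrtr// ltW.
rewrite normal_pdfE// /normal_peak /normal_fun s2.
have -> : (2 * b)^-1 * pi *+ 2 = pi / b by rewrite -mulr_natr; field; rewrite gt_eqF.
rewrite mulVKf; last by rewrite gt_eqF// sqrtr_gt0 divr_gt0// pi_gt0.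
rewrite /gauss1; congr expR; rewrite -mulr_natr; field; rewrite gt_eqF//.
Qed.

Lemma integrable_gauss1 b m : 0 < b -> lam.-integrable setT (EFin \o gauss1 b m).
Proof.
move=> b0; rewrite (_ : _ \o _ = (fun t => (Num.sqrt (pi / b))%:E *
    (normal_pdf m (Num.sqrt (2 * b))^-1 t)%:E)%E).
  by apply: integrableZl => //; exact: integrable_normal_pdf.
by apply/funext => t; rewrite /= gauss1_normal.
Qed.

Lemma Rintegral_gauss1 b m : 0 < b -> \int[lam]_t gauss1 b m t = Num.sqrt (pi / b).
Proof.
move=> b0; under eq_Rintegral do rewrite gauss1_normal//.
rewrite RintegralZl//; last exact: integrable_normal_pdf.
by rewrite /Rintegral integral_normal_pdf mulr1.
Qed.

Lemma gauss_shiftE b (a x : R3 R) :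
  gauss b (x - a) = gauss1 b a.1.1 x.1.1 * gauss1 b a.1.2 x.1.2 * gauss1 b a.2 x.2.
Proof.
case: x a => [[x1 x2] x3] [[a1 a2] a3]; rewrite /gauss /gauss1 -!expRD /=.
have -> : ((x1, x2, x3) : R3 R) - ((a1, a2, a3) : R3 R) = (x1 - a1, x2 - a2, x3 - a3) by [].
by congr expR; rewrite dotE /=; ring.
Qed.

Definition gauss_mass (b : R) := Num.sqrt (pi / b) ^+ 3.

Lemma itg_gauss_shift b a : 0 < b -> itg (fun x => gauss b (x - a)).
Proof.
move=> b0; under eq_fun do rewrite gauss_shiftE.
by apply: itg_prod3; exact: integrable_gauss1.
Qed.

Lemma Int_gauss_shift b a : 0 < b -> ∫ (fun x => gauss b (x - a)) = gauss_mass b.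
Proof.
move=> b0; under eq_fun do rewrite gauss_shiftE.
rewrite Int_prod3; [|exact: integrable_gauss1..].
by rewrite !Rintegral_gauss1// /gauss_mass !exprS expr0 mulr1 mulrA.
Qed.

End Gaussians.

(** * The Fourier transform of a Gaussian and the multiplication formula *)

Section GaussianTransform.
Context {R : realType}.
Notation mu := (leb3 R).
Notation lam := (@lebesgue_measure R).
Implicit Types (f g phi : R3 R -> R) (x xi a : R3 R) (i j : 'I_3) (th : R).
Notation "'∫' f" := (Rintegral mu setT f) (at level 36).

Lemma itg_gauss (c : R) : 0 < c -> itg (gauss c).
Proof. by move=> c0; apply: schwartz_itg; exact: schwartz_gauss. Qed.

Lemma Int_gauss (c : R) : 0 < c -> ∫ (gauss c) = gauss_mass c.
Proof.
move=> c0; rewrite -(Int_gauss_shift 0 c0); congr Rintegral.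
by apply/funext => x; rewrite subr0.
Qed.

Lemma dot0r x : dot x 0 = 0 :> R.
Proof. by rewrite dotE /= !mulr0 !addr0. Qed.

(** The derivative of a Gaussian is a coordinate times the Gaussian, so its
    transform solves the same kind of first-order equation: the quotient of the
    transform by the expected Gaussian has gradient 0, and its value at the
    origin is the integral of the Gaussian. *)
Lemma ft_gauss (c : R) xi : 0 < c ->
  ft 0 (gauss c) xi = gauss_mass c * gauss (pi ^+ 2 / c) xi.
Proof.
move=> c0; have cn0 : c != 0 by rewrite gt_eqF.
have sg := schwartz_gauss c0.
pose b := - (pi ^+ 2 / c) : R.
pose F xi := ft 0 (gauss c) xi * gauss b xi.
have pE i : partial i (gauss c) = (fun x => - 2 * c * (coord i x * gauss c x)).
  by apply/funext => x; apply: derive_val; exact: is_derive_gauss.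
have dF i x : is_derive x (basis i) F 0.
  have d1 := is_derive_ft 0 x (schwartz_itg sg) (schwartz_coord_itg i sg) (schwartz_coord2_itg i sg).
  have E := ft_partial (0 + pi / 2) i x sg.
  rewrite pE ftZ in E; last exact: schwartz_coord_itg.
  rewrite (_ : 0 + pi / 2 - pi / 2 = 0) in E; last by ring.
  have := is_derive_mul d1 (is_derive_gauss b i x).
  rewrite (_ : _ + _ = 0)//.
  have -> : ft (0 + pi / 2) (fun x => coord i x * gauss c x) x = - pi / c * coord i x * ft 0 (gauss c) x.
    apply: (@mulfI _ (- 2 * c)); first by rewrite mulf_neq0// oppr_eq0.
    by rewrite E; field.
  by rewrite /b; field.
have F0 : F xi = F 0.
  apply/eqP; rewrite -subr_eq0 -normr_le0.
  have := @lipschitz_R3 _ F (fun _ _ => 0) 0 0 xi dF; rewrite mul0r; apply.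
  by move=> *; rewrite normr0.
have E0 : F 0 = gauss_mass c.
  rewrite /F /gauss dot0r mulr0 expR0 mulr1 -Int_gauss//; congr Rintegral.
  by apply/funext => x; rewrite dot0r mulr0 addr0 cos0 mul1r.
(* b is negative, so gauss b is the inverse of the expected transform *)
have gg : gauss b xi * gauss (pi ^+ 2 / c) xi = 1.
  by rewrite /gauss -expRD -[RHS]expR0; congr expR; rewrite /b; ring.
by rewrite -E0 -F0 /F -mulrA gg mulr1.
Qed.

Lemma gauss_mass_dual (c : R) : 0 < c -> gauss_mass c * gauss_mass (pi ^+ 2 / c) = 1.
Proof.
move=> c0; rewrite /gauss_mass -exprMn -sqrtrM; last by rewrite divr_ge0 ?pi_ge0 ?ltW.
rewrite (_ : _ * _ = 1) ?sqrtr1 ?expr1n//.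
have p0 : (pi : R) != 0 by rewrite gt_eqF// pi_gt0.
have cn0 : c != 0 by rewrite gt_eqF.
by move: (pi : R) p0 => p p0; field; rewrite p0 cn0.
Qed.

Lemma gauss_mass_half (b : R) : 0 < b -> gauss_mass (b / 2) <= 8 * gauss_mass b.
Proof.
move=> b0; rewrite /gauss_mass (_ : 8 = 2 ^+ 3); last by ring.
have p := pi_ge0 R.
rewrite -exprMn; apply: lerXn2r; rewrite ?nnegrE ?mulr_ge0 ?sqrtr_ge0//.
have -> : 2 * Num.sqrt (pi / b) = Num.sqrt (2 ^+ 2 * (pi / b)).
  by rewrite [RHS]sqrtrM ?sqr_ge0// sqrtr_sqr ger0_norm.
rewrite ler_wsqrtr// (_ : pi / (b / 2) = 2 * (pi / b)).
  have : 0 <= pi / b by rewrite divr_ge0// ltW.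
  by move: (pi / b) => y y0; rewrite expr2; lra.
by field; rewrite gt_eqF.
Qed.

(** With s = sqrt b |x_i|, half of the exponent absorbs the coordinate because s
    <= 1 + s^2 / 2 <= exp (s^2 / 2). *)
Lemma gauss_moment (b : R) i x : 0 < b ->
  `|coord i x| * gauss b x <= (Num.sqrt b)^-1 * gauss (b / 2) x.
Proof.
move=> b0; have s0 : 0 < Num.sqrt b by rewrite sqrtr_gt0.
rewrite ler_pdivlMl//.
have -> : gauss b x = gauss (b / 2) x * (expR (b / 2 * dot x x))^-1.
  by rewrite /gauss -expRN -expRD; congr expR; field.
set e := expR _; rewrite (_ : _ * _ = (Num.sqrt b * `|coord i x| / e) * gauss (b / 2) x); last by ring.
rewrite ler_piMl ?expR_ge0// ler_pdivrMr ?expR_gt0// mul1r.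
apply: (le_trans _ (expR_ge1Dx _)).
have h : (Num.sqrt b * `|coord i x|) ^+ 2 = b * coord i x ^+ 2.
  by rewrite exprMn sqr_sqrtr ?ltW// real_normK ?num_real.
have := coord_sqr_le i x; rewrite -(ler_pM2l b0) -h.
move: (Num.sqrt b * _) => v; have := sqr_ge0 (v - 1); nra.
Qed.

(** The integral over x of cos (2 pi (x - a) . xi) phi x. Its integral over xi
    is the double transform of phi at a. *)
Definition wave_pair phi a xi : R := ft (- (2 * pi * dot a xi)) phi xi.

Lemma wave_pairE phi a xi : itg phi -> wave_pair phi a xi =
  cos (2 * pi * dot xi a) * cos_tr phi xi + sin (2 * pi * dot xi a) * sin_tr phi xi.
Proof.
move=> ip; rewrite cos_trE sin_trE /wave_pair /ft -!IntZ ?itg_wave//.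
rewrite -IntD; [|apply: itgZ; exact: itg_wave|apply: itgZ; exact: itg_wave].
congr Rintegral; apply/funext => x.
rewrite addr0 cosB (cosB (2 * pi * dot x xi) (pi / 2)) cos_pihalf sin_pihalf (dotC xi a).
by ring.
Qed.

Lemma itg_wave_pair phi a : schwartz phi -> itg (wave_pair phi a).
Proof.
move=> sp.
have [sc ss] := (schwartz_cos_tr sp, schwartz_sin_tr sp).
rewrite /itg (_ : wave_pair phi a = (fun xi => cos (2 * pi * dot xi a + 0) * cos_tr phi xi +
  cos (2 * pi * dot xi a + - (pi / 2)) * sin_tr phi xi)); last first.
  apply/funext => xi; rewrite wave_pairE ?addr0 ?cosB ?cos_pihalf ?sin_pihalf ?mulr0 ?mulr1 ?add0r//.
  exact: schwartz_itg.
by apply: itgD; apply: itg_wave; exact: schwartz_itg.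
Qed.

Lemma Int_wave_pair phi a : schwartz phi ->
  ∫ (wave_pair phi a) = cos_tr (cos_tr phi) a + sin_tr (sin_tr phi) a.
Proof.
move=> sp; have [sc ss] := (schwartz_cos_tr sp, schwartz_sin_tr sp).
rewrite (cos_trE (cos_tr phi)) (sin_trE (sin_tr phi)) /ft -IntD; last 2 first.
- exact: itg_wave (schwartz_itg sc).
- exact: itg_wave (schwartz_itg ss).
congr Rintegral; apply/funext => xi.
rewrite wave_pairE; last exact: schwartz_itg.
by rewrite addr0 (cosB _ (pi / 2)) cos_pihalf sin_pihalf mulr0 add0r mulr1.
Qed.

Let mu3 := sprod leb2 lam.
HB.instance Definition _ := SigmaFiniteMeasure.on mu3.

Lemma dotBl x y xi : dot (x - y) xi = dot x xi - dot y xi :> R.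
Proof.
case: x y => [[x1 x2] x3] [[y1 y2] y3].
have -> : ((x1, x2, x3) : R3 R) - ((y1, y2, y3) : R3 R) = (x1 - y1, x2 - y2, x3 - y3) by [].
by rewrite !dotE /=; ring.
Qed.

Let M3 := (measurableTypeR R * measurableTypeR R * measurableTypeR R)%type.

(** Fubini for cos (2 pi (x - a) . xi) phi x gauss c xi, which the Gaussian
    makes integrable in (x, xi). *)
Lemma multiplication_formula phi a (c : R) : 0 < c -> schwartz phi ->
  ∫ (fun xi => wave_pair phi a xi * gauss c xi) =
  ∫ (fun x => phi x * ft 0 (gauss c) (x - a)).
Proof.
move=> c0 sp; have ip := schwartz_itg sp; have ig := itg_gauss c0.
pose q (z : M3 * M3) := cos (2 * pi * dot z.1 z.2 + - (2 * pi * dot a z.2)) * phi z.1 * gauss c z.2.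
have iq1 x : itg (fun xi => q (x, xi)).
  apply: (itg_le _ (itgZ `|phi x| ig)).
    rewrite /q /=; under eq_fun do rewrite -mulrBr -dotBl dotC.
    rewrite /msr; apply: msrM; last exact: itg_msr ig.
    apply: msrM; last exact: msr_cst.
    by have := msr_wave 0 (x - a); under eq_fun do rewrite addr0.
  move=> xi; rewrite /q /= 2!normrM (gtr0_norm (gauss_gt0 _ _)).
  by rewrite ler_wpM2r ?expR_ge0// ler_piMl// cos_abs_le1.
have iq2 xi : itg (fun x => q (x, xi)).
  rewrite /q /=; have := itgZ (gauss c xi) (itg_wave (- (2 * pi * dot a xi)) xi ip).
  by under eq_fun do rewrite mulrC.
have iq : (mu3 \x mu3)%E.-integrable setT (EFin \o q).
  have H : (mu3 \x mu3)%E.-integrable setT (EFin \o (fun z : M3 * M3 => `|phi z.1| * gauss c z.2)).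
    apply: (integrable_prod_fun (m1 := mu3) (m2 := mu3) (f := fun x => `|phi x|) (g := gauss c)).
      exact: itg_abs ip.
    exact: ig.
  apply: (le_integrable _ _ _ H) => //; last first.
    move=> [x xi] _; rewrite /= lee_fin /q /= 2!normrM [leRHS]normrM normr_id.
    by rewrite ler_wpM2r ?expR_ge0// ler_piMl// cos_abs_le1.
  have m1 f : msr f -> measurable_fun setT (fun z : M3 * M3 => f z.1).
    by move=> mf; apply: (measurableT_comp (f := f)) => //; exact: measurable_fst.
  have m2 f : msr f -> measurable_fun setT (fun z : M3 * M3 => f z.2).
    by move=> mf; apply: (measurableT_comp (f := f)) => //; exact: measurable_snd.
  apply/measurable_EFinP; apply: measurable_funM; last exact: m2 (itg_msr ig).
  apply: measurable_funM; last exact: m1 (itg_msr ip).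
  have mcos : measurable_fun setT (cos : R -> R).
    by apply: continuous_measurable_fun; exact: continuous_cos.
  apply: (measurableT_comp mcos); apply: measurable_funD.
    apply: measurable_funM => //; apply: measurable_sum => i.
    by apply: measurable_funM; [apply: m1|apply: m2]; exact: msr_coord.
  apply: (m2 (fun y => - (2 * pi * dot a y))); apply: msrN; apply: msrM; first exact: msr_cst.
  by have := msr_dotr a; under eq_fun do rewrite dotC.
have := Rintegral_Fubini (m1 := mu3) (m2 := mu3) iq iq1 iq2.
move=> E; symmetry.
transitivity (\int[mu3]_x \int[mu3]_y q (x, y)).
  congr Rintegral; apply/funext => x.
  rewrite /ft -IntZ; last exact: itg_wave.
  congr Rintegral; apply/funext => xi; rewrite /q /= addr0 (dotC xi) dotBl mulrBr.
  by ring.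
rewrite E; congr Rintegral; apply/funext => xi.
rewrite mulrC /wave_pair /ft -IntZ; last exact: itg_wave.
by congr Rintegral; apply/funext => x; rewrite /q /= mulrC.
Qed.

End GaussianTransform.

(** * Fourier inversion *)

Section Inversion.
Context {R : realType}.
Notation mu := (leb3 R).
Implicit Types (f g phi : R3 R -> R) (x xi a : R3 R) (i j : 'I_3) (th : R).
Notation "'∫' f" := (Rintegral mu setT f) (at level 36).

Lemma schwartz_lipschitz phi : schwartz phi -> exists2 M, 0 <= M &
  forall x a, `|phi x - phi a| <= M * \sum_(i < 3) `|coord i (x - a)|.
Proof.
move=> sp.
have H i : exists C, forall x, `|partial i phi x| <= C.
  have [C HC] := schwartz_bounded 0 (schwartz_partial i sp).
  by exists C => x; have := HC x; rewrite mul1r.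
have [C0 H0] := H o0; have [C1 H1] := H o1; have [C2 H2] := H o2.
pose M := Num.max C0 (Num.max C1 C2).
have HM i x : `|partial i phi x| <= M.
  rewrite !le_max; case: i => -[|[|[|//]]] Hi.
  - by rewrite (_ : Ordinal Hi = o0) ?H0//; exact: val_inj.
  - by rewrite (_ : Ordinal Hi = o1) ?H1 ?orbT//; exact: val_inj.
  - by rewrite (_ : Ordinal Hi = o2) ?H2 ?orbT//; exact: val_inj.
exists M => [|x a]; first exact: le_trans (HM o0 0).
have := @lipschitz_R3 _ phi (fun i => partial i phi) M a x
  (fun i x => schwartz_derive i x sp) HM.
by rewrite !big_ord_recl big_ord0 addr0 addrA.
Qed.

Lemma itg_schwartz_gauss phi a (b : R) : 0 < b -> schwartz phi ->
  itg (fun x => phi x * gauss b (x - a)).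
Proof.
move=> b0 sp; have ig := itg_gauss_shift a b0.
have [C HC] := schwartz_bounded 0 sp.
apply: (itg_le _ (itgZ C ig)).
  by apply: msrM; apply: itg_msr => //; exact: schwartz_itg.
move=> x; have := HC x; rewrite mul1r => h.
by rewrite normrM (gtr0_norm (gauss_gt0 _ _)) ler_wpM2r// ltW// gauss_gt0.
Qed.

(** phi is Lipschitz, and the first moments of the Gaussian are O(1 / sqrt b)
    relative to its mass. *)
Lemma gauss_concentration phi a : schwartz phi -> exists K : R, forall b : R, 0 < b ->
  `|∫ (fun x => phi x * gauss b (x - a)) - phi a * gauss_mass b| <=
  K * (Num.sqrt b)^-1 * gauss_mass b.
Proof.
move=> sp; have [M M0 HM] := schwartz_lipschitz sp.
exists (24 * M) => b b0; have b2 : 0 < b / 2 by rewrite divr_gt0.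
have ig := itg_gauss_shift a b0; have ig2 := itg_gauss_shift a b2.
have mg := itg_msr ig.
have ipg := itg_schwartz_gauss a b0 sp.
have g0 x : 0 <= gauss b (x - a) by exact: ltW (gauss_gt0 _ _).
rewrite -(Int_gauss_shift a b0) -IntZ// -IntB//; last exact: itgZ.
have s0 : 0 <= (Num.sqrt b)^-1 by rewrite invr_ge0 sqrtr_ge0.
apply: (le_trans (y := ∫ (fun x => (3 * M * (Num.sqrt b)^-1) * gauss (b / 2) (x - a)))).
  apply: Int_abs; last move=> x.
  - by apply: itg_msr; apply: itgB => //; exact: itgZ.
  - exact: itgZ.
  rewrite -mulrBl normrM (ger0_norm (g0 x)).
  apply: (le_trans (ler_wpM2r (g0 x) (HM x a))).
  rewrite (_ : 3 * M * _ * _ = M * (\sum_(i < 3) (Num.sqrt b)^-1 * gauss (b / 2) (x - a))).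
    rewrite -mulrA ler_wpM2l// mulr_suml; apply: ler_sum => i _; exact: gauss_moment.
  by rewrite !big_ord_recl big_ord0; ring.
rewrite IntZ// !Int_gauss_shift//.
have k0 : 0 <= 3 * M * (Num.sqrt b)^-1 by rewrite !mulr_ge0.
apply: (le_trans (ler_wpM2l k0 (gauss_mass_half b0))).
by move: (gauss_mass b) (Num.sqrt b)^-1 => u v; lra.
Qed.

(** The frequency integral is the limit of integrals damped by wide Gaussians.
    By the multiplication formula a damped integral is the average of phi
    against a narrow Gaussian of total mass 1 centred at a, which tends to phi
    a. *)
Lemma fourier_inversion phi : schwartz phi ->
  (fun a => cos_tr (cos_tr phi) a + sin_tr (sin_tr phi) a) = phi.
Proof.
move=> sp; apply/funext => a; rewrite -Int_wave_pair//.
have iw := itg_wave_pair a sp.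
pose c n : R := (n.+1%:R ^+ 2)^-1.
have c0 n : 0 < c n by rewrite invr_gt0 exprn_gt0// ltr0n.
have cvgc : c n @[n --> \oo] --> (0 : R).
  have h : n.+1%:R^-1 * n.+1%:R^-1 @[n --> \oo] --> (0 * 0 : R).
    by apply: cvgM; exact: cvg_harmonic.
  rewrite mulr0 in h; rewrite (_ : c = fun n => n.+1%:R^-1 * n.+1%:R^-1)//.
  by apply/funext => n; rewrite /c expr2 invfM.
have cvg1 : ∫ (fun xi => wave_pair phi a xi * gauss (c n) xi) @[n --> \oo] --> ∫ (wave_pair phi a).
  apply: (@Rintegral_dct _ _ _ mu (fun n xi => wave_pair phi a xi * gauss (c n) xi) _
     (fun xi => `|wave_pair phi a xi|)).
  - by move=> n; apply: msrM; [exact: itg_msr|exact: itg_msr (itg_gauss (c0 n))].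
  - move=> xi; rewrite -[X in _ --> X]mulr1; apply: cvgM; first exact: cvg_cst.
    rewrite /gauss -expR0 (_ : 0 = - 0 * dot xi xi); last by rewrite oppr0 mul0r.
    apply: (cvg_comp _ expR); last exact: continuous_expR.
    by apply: cvgM; [apply: cvgN; exact: cvgc|exact: cvg_cst].
  - exact: itg_abs.
  - move=> n xi; rewrite normrM (gtr0_norm (gauss_gt0 _ _)) ler_piMr//.
    by rewrite /gauss -expR0 ler_expR mulNr oppr_le0 mulr_ge0 ?dot_ge0 ?ltW.
have [K HK] := gauss_concentration a sp.
have p0 := pi_gt0 R.
have b0 n : 0 < pi ^+ 2 / c n by rewrite divr_gt0// exprn_gt0.
have E n : ∫ (fun xi => wave_pair phi a xi * gauss (c n) xi) =
  gauss_mass (c n) * ∫ (fun x => phi x * gauss (pi ^+ 2 / c n) (x - a)).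
  rewrite multiplication_formula// -IntZ; last exact: itg_schwartz_gauss.
  by congr Rintegral; apply/funext => x; rewrite ft_gauss// mulrCA.
have sqrtb n : Num.sqrt (pi ^+ 2 / c n) = pi * n.+1%:R.
  by rewrite /c invrK -exprMn sqrtr_sqr ger0_norm// mulr_ge0// ltW.
have cvg2 : ∫ (fun xi => wave_pair phi a xi * gauss (c n) xi) @[n --> \oo] --> phi a.
  apply/subr_cvg0; apply: norm_cvg0.
  apply: (@squeeze_cvgr _ _ _ _ (cst 0) (fun n => K / pi * n.+1%:R^-1)).
  - apply: nearW => n; rewrite normr_ge0 /= E.
    have m0 : 0 <= gauss_mass (c n) by rewrite exprn_ge0// sqrtr_ge0.
    rewrite -[phi a]mulr1 -(gauss_mass_dual (c0 n)) mulrCA -mulrBr normrM (ger0_norm m0).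
    apply: (le_trans (ler_wpM2l m0 (HK _ (b0 n)))).
    rewrite mulrCA gauss_mass_dual// mulr1 sqrtb invfM mulrA.
    by rewrite lexx.
  - exact: cvg_cst.
  - by rewrite -[X in _ --> X](mulr0 (K / pi)); apply: cvgM; [exact: cvg_cst|exact: cvg_harmonic].
exact: cvg_unique cvg1 cvg2.
Qed.

End Inversion.

(** * Schwartz functions separate square-integrable functions *)

Section Separation.
Context {R : realType}.
Notation mu := (leb3 R).
Implicit Types (f g phi : R3 R -> R) (x xi a : R3 R) (i j : 'I_3) (th : R).
Notation "'∫' f" := (Rintegral mu setT f) (at level 36).

(** A smooth step whose derivative is a polynomial in itself, so that its
    products with Schwartz functions are easily seen to be Schwartz. *)
Definition sigmoid (t : R) : R := (1 + expR (- t))^-1.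

Lemma sigmoid_den_gt0 (t : R) : 0 < 1 + expR (- t).
Proof. by rewrite ltr_pwDl// expR_ge0. Qed.

Lemma sigmoid_ge0 (t : R) : 0 <= sigmoid t.
Proof. by rewrite invr_ge0 ltW ?sigmoid_den_gt0. Qed.

Lemma sigmoid_le1 (t : R) : sigmoid t <= 1.
Proof. by rewrite invf_le1 ?sigmoid_den_gt0// lerDl expR_ge0. Qed.

Lemma is_derive_sigmoid (t : R) :
  is_derive t (1 : R) sigmoid (sigmoid t * (1 - sigmoid t)).
Proof.
have d0 := sigmoid_den_gt0 t.
have dN : is_derive t (1 : R) (-%R : R -> R) (-1).
  exact: (is_deriveN (is_derive_id t (1 : R))).
have d1 := is_derive_add (is_derive_cst (1 : R) t (1 : R)) (is_derive_exp_comp dN).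
have := @is_deriveV R (fun y : R => 1 + expR (- y)) t _ 1 (lt0r_neq0 d0) d1.
congr is_derive.
rewrite /sigmoid /GRing.scale /=; field.
by rewrite gt_eqF.
Qed.

Lemma continuous_sigmoid : continuous sigmoid.
Proof.
move=> t; apply: differentiable_continuous; apply/derivable1_diffP.
by have [] := is_derive_sigmoid t.
Qed.

Lemma sigmoid_le_expR (t : R) : sigmoid t <= expR t.
Proof.
rewrite /sigmoid -[leRHS]invrK -expRN lef_pV2 ?posrE ?expR_gt0 ?sigmoid_den_gt0//.
by rewrite lerDr.
Qed.

Lemma onem_sigmoid_le_expR (t : R) : 1 - sigmoid t <= expR (- t).
Proof.
have d0 := sigmoid_den_gt0 t; have e0 := expR_gt0 (- t).
have -> : 1 - sigmoid t = expR (- t) / (1 + expR (- t)).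
  by rewrite /sigmoid; field; rewrite gt_eqF.
by rewrite ler_pdivrMr// mulrDr mulr1 lerDl mulr_ge0 ?expR_ge0.
Qed.

Lemma expRN_le_inv (s t : R) : 0 < s -> s <= t -> expR (- t) <= s^-1.
Proof.
move=> s0 st; rewrite expRN lef_pV2 ?posrE ?expR_gt0//.
by apply: (le_trans _ (expR_ge1Dx t)); lra.
Qed.

(** The slope makes the step steep, and the shift by 1 makes the limit at d = 0
    vanish, so that the limit is the indicator of the open half-line. *)
Definition sharp n (d : R) : R := sigmoid (n.+1%:R * (n.+1%:R * d - 1)).

Lemma sharp_cvg d : sharp n d @[n --> \oo] --> (if 0 < d then 1 else 0 : R).
Proof.
have near0 (l : R) : (\forall n \near \oo, `|sharp n d - l| <= n.+1%:R^-1) ->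
    sharp n d @[n --> \oo] --> l.
  move=> H; apply/subr_cvg0; apply: norm_cvg0.
  apply: (@squeeze_cvgr _ _ _ _ (cst 0) (fun n => n.+1%:R^-1)); last exact: cvg_harmonic.
    by apply: filterS H => n Hn; rewrite normr_ge0.
  exact: cvg_cst.
case: ltP => d0; apply: near0; last first.
  apply: nearW => n; rewrite subr0 ger0_norm ?sigmoid_ge0//.
  apply: (le_trans (sigmoid_le_expR _)).
  rewrite -[X in expR X]opprK; apply: expRN_le_inv; first by rewrite ltr0n.
  have : 0 < n.+1%:R :> R by rewrite ltr0n.
  by move: (n.+1%:R : R) => s s0; nra.
near=> n.
rewrite distrC ger0_norm; last by rewrite subr_ge0 sigmoid_le1.
apply: (le_trans (onem_sigmoid_le_expR _)); apply: expRN_le_inv; first by rewrite ltr0n.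
have h : 2 / d <= n.+1%:R.
  near: n; exists (Num.truncn (2 / d)) => // n /= h.
  have : 0 <= 2 / d by rewrite divr_ge0// ltW.
  by move=> /truncn_itv /andP[_ h2]; rewrite (le_trans (ltW h2))// ler_nat ltnS.
rewrite ler_pdivrMr// in h.
have : 0 < n.+1%:R :> R by rewrite ltr0n.
by move: (n.+1%:R : R) h => s h s0; nra.
Unshelve. all: by end_near. Qed.

Definition sigm i (p q : R) x : R := sigmoid (p * coord i x + q).

Lemma sigm_abs_le1 i p q x : `|sigm i p q x| <= 1.
Proof. by rewrite ger0_norm ?sigmoid_le1 ?sigmoid_ge0. Qed.

Lemma is_derive_sigm i p q k x : is_derive x (basis k) (sigm i p q)
  ((p * (i == k)%:R) * (sigm i p q x * (1 - sigm i p q x))).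
Proof.
apply/is_derive_slice; rewrite /sigm.
under eq_fun do rewrite coordE.
have [->|ik] := eqVneq i k; last first.
  by rewrite mulr0 mul0r; exact: is_derive_cst.
have d := is_derive_add (is_derive_scal p (is_derive_id (coord k x) (1 : R)))
  (is_derive_cst q (coord k x) (1 : R)).
have := is_derive1_comp (is_derive_sigmoid _) d.
by rewrite addr0 mulrC.
Qed.

(** Polynomials in the step with Schwartz coefficients: a class that contains
    the products with the step and is stable under differentiation. *)
Inductive sigm_poly i p q : (R3 R -> R) -> Prop :=
| SP0 f : schwartz f -> sigm_poly i p q f
| SPM f : sigm_poly i p q f -> sigm_poly i p q (fun x => sigm i p q x * f x)
| SPL (a : R) f g : sigm_poly i p q f -> sigm_poly i p q g ->
    sigm_poly i p q (fun x => a * f x + g x).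

Lemma continuous_sigm i p q : continuous (sigm i p q).
Proof.
move=> x; apply: (cvg_comp _ sigmoid); last exact: continuous_sigmoid.
apply: cvgD; last exact: cvg_cst.
by apply: cvgM; [exact: cvg_cst|exact: continuous_coord].
Qed.

Lemma schwartz_sigmM i p q f : schwartz f -> schwartz (fun x => sigm i p q x * f x).
Proof.
move=> sf; apply: (@schwartz_coind _ (sigm_poly i p q)); last by apply: SPM; exact: SP0.
- move=> h; elim=> [{}h sh|{}h _ ch|a {}h g _ ch _ cg]; first exact: schwartz_continuous.
    by move=> x; apply: cvgM; [exact: continuous_sigm|exact: ch].
  by move=> x; apply: cvgD; [apply: cvgM; [exact: cvg_cst|exact: ch]|exact: cg].
- move=> h k; elim=> [{}h sh|{}h gh [h' gh' dh]|a {}h g gh [h' gh' dh] gg [g' gg' dg]].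
  + exists (partial k h); first by apply: SP0; exact: schwartz_partial.
    by move=> x; exact: schwartz_derive.
  + pose c := p * (i == k)%:R.
    exists (fun x => - c * (sigm i p q x * (sigm i p q x * h x)) +
       (c * (sigm i p q x * h x) + sigm i p q x * h' x)).
      apply: (@SPL i p q (- c) (fun x => sigm i p q x * (sigm i p q x * h x))).
        by do 2 apply: SPM.
      by apply: (@SPL i p q c (fun x => sigm i p q x * h x)); exact: SPM.
    move=> x; have := is_derive_mul (is_derive_sigm i p q k x) (dh x).
    by congr is_derive; rewrite -/c; ring.
  + exists (fun x => a * h' x + g' x); first exact: SPL.
    by move=> x; apply: is_derive_add => //; exact: is_derive_scal.
- move=> h N gh; elim: gh N => [{}h sh|{}h _ IH|a {}h g _ IHf _ IHg] N.
  + exact: schwartz_bounded.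
  + have [C HC] := IH N; exists C => x; apply: (le_trans _ (HC x)).
    by rewrite ler_wpM2l ?exprn_ge0 ?wt_ge0// normrM ler_piMl// sigm_abs_le1.
  + have [C HC] := IHf N; have [D HD] := IHg N; exists (`|a| * C + D) => x.
    have w0 : 0 <= wt x ^+ N by rewrite exprn_ge0 ?wt_ge0.
    apply: (le_trans (ler_wpM2l w0 (ler_normD _ _))); rewrite mulrDr lerD// normrM.
    by rewrite mulrCA ler_wpM2l.
Qed.

Implicit Type l : seq ('I_3 * R).

(** Finite intersections of coordinate half-spaces: they are stable under
    intersection and generate the sigma-algebra. *)
Definition octant l : set (R3 R) := [set x | all (fun p => p.2 < coord p.1 x) l].

(** Replaces each half-space indicator in phi \_ (octant l) by a smooth step. *)
Definition smooth_octant n l phi : R3 R -> R :=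
  foldr (fun p f => fun x => sharp n (coord p.1 x - p.2) * f x) phi l.

Lemma schwartz_smooth_octant n l phi : schwartz phi -> schwartz (smooth_octant n l phi).
Proof.
move=> sp; elim: l => //= -[i a] l IH.
pose N : R := n.+1%:R.
rewrite (_ : (fun x => _) = (fun x => sigm i (N * N) (- (N * (N * a + 1))) x * smooth_octant n l phi x)).
  exact: schwartz_sigmM.
by apply/funext => x; rewrite /sharp /sigm -/N /=; congr (sigmoid _ * _); ring.
Qed.

Lemma smooth_octant_le n l phi x : `|smooth_octant n l phi x| <= `|phi x|.
Proof.
elim: l => //= -[i a] l IH; rewrite normrM; apply: le_trans IH.
by rewrite ler_piMl// ger0_norm ?sigmoid_le1 ?sigmoid_ge0.
Qed.

Lemma smooth_octant_cvg l phi x :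
  smooth_octant n l phi x @[n --> \oo] --> (phi \_ (octant l)) x.
Proof.
elim: l => [|[i a] l IH] /=.
  by rewrite patchE mem_set//; exact: cvg_cst.
rewrite (_ : (phi \_ _) x = (if 0 < coord i x - a then 1 else 0) * (phi \_ (octant l)) x).
  by apply: cvgM => //; exact: sharp_cvg.
rewrite !patchE subr_gt0.
have -> : (x \in octant ((i, a) :: l)) = (a < coord i x) && (x \in octant l).
  by apply/idP/andP; rewrite !inE /octant /= => /andP.
by case: (_ < coord i x) => /=; rewrite ?mul1r ?mul0r.
Qed.

Lemma octantI l1 l2 : octant l1 `&` octant l2 = octant (l1 ++ l2).
Proof.
by apply/seteqP; split=> x; rewrite /octant /= all_cat => /andP.
Qed.

Let M3 := (measurableTypeR R * measurableTypeR R * measurableTypeR R)%type.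

Lemma octant_nil : octant [::] = setT.
Proof. exact/seteqP. Qed.

Lemma measurable_octant l : measurable (octant l : set M3).
Proof.
elim: l => [|[i a] l IH].
  by rewrite octant_nil; exact: (@measurableT _ M3).
rewrite (_ : octant _ = (coord i @^-1` `]a, +oo[) `&` octant l); last first.
  by apply/seteqP; split=> x; rewrite /octant /= in_itv /= andbT => /andP.
apply: measurableI => //; rewrite -[X in measurable X]setTI.
by apply: (msr_coord i) => //; exact: measurable_itv.
Qed.

Lemma octants_generate (A : set M3) : measurable A -> <<s range octant >> A.
Proof.
move=> mA.
pose T := g_sigma_algebraType (range octant).
have mc i : measurable_fun [set: T] (coord i : T -> R).
  apply: (measurability _ (RGenOInfty.measurableE R)).
  move=> _ [_ [a ->] <-]; rewrite setTI; apply: sub_sigma_algebra.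
  exists [:: (i, a)] => //; apply/seteqP; split=> x; rewrite /octant /= in_itv /= !andbT//.
have mid : measurable_fun [set: T] (fun x : T => ((coord o0 x, coord o1 x), coord o2 x) : M3).
  by apply: measurable_fun_pair; [apply: measurable_fun_pair|]; exact: mc.
have := mid measurableT A mA; rewrite setTI.
by rewrite (_ : _ @^-1` A = A)//; apply/seteqP; split=> -[[x y] z].
Qed.

Section LambdaSystem.
Variable k : R3 R -> R.
Hypothesis ik : itg k.

Let mk : msr k. Proof. exact: itg_msr. Qed.

Lemma msr_patch (A : set M3) f : measurable A -> msr f -> msr (f \_ A).
Proof.
move=> mA mf; apply: (@measurable_restrictT _ _ M3 R _ f mA).1.
exact: (@measurable_funTS _ _ M3 R A f mf).
Qed.

Lemma patch_le (A : set M3) f x : `|(f \_ A) x| <= `|f x|.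
Proof. by rewrite patchE; case: ifP => // _; rewrite normr0. Qed.

Lemma itg_patch (A : set M3) f : measurable A -> itg f -> itg (f \_ A).
Proof.
move=> mA fi; apply: (itg_le _ (itg_abs fi)); last exact: patch_le.
by apply: msr_patch => //; exact: itg_msr.
Qed.

Lemma Int_patch_lambda : ∫ k = 0 ->
  lambda_system setT [set A : set M3 | measurable A /\ ∫ (k \_ A) = 0].
Proof.
move=> k0; split=> //.
- by split; [exact: measurableT|rewrite patch_setT].
- move=> A B BA [mA A0] [mB B0]; split; first exact: measurableD.
  have -> : k \_ (A `\` B) = (fun x => (k \_ A) x - (k \_ B) x).
    apply/funext => x; rewrite !patchE.
    rewrite in_setD; case: (boolP (x \in B)) => xB; last by rewrite andbT subr0.
    by rewrite (mem_set (BA _ (set_mem xB))) /= subrr.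
  by rewrite IntB ?A0 ?B0 ?subrr//; exact: itg_patch.
- move=> F ndF HF; split; first by apply: bigcup_measurable => n _; have [] := HF n.
  have cF : ∫ (k \_ (F n)) @[n --> \oo] --> ∫ (k \_ (\bigcup_n F n)).
    apply: (@Rintegral_dct _ _ _ mu (fun n => k \_ (F n)) _ (fun x => `|k x|)).
    + by move=> n; apply: msr_patch => //; have [] := HF n.
    + move=> x; rewrite [X in _ --> X]patchE.
      case: ifPn => [/set_mem [m _ Fmx]|xF].
        apply: cvg_near_cst; exists m => // n /= mn.
        by rewrite patchE mem_set//; have /subsetPset := ndF _ _ mn; apply.
      apply: cvg_near_cst; apply: nearW => n; rewrite patchE ifN//.
      by apply: contra xF => /set_mem xF; apply/mem_set; exists n.
    + exact: itg_abs.
    + by move=> n x; exact: patch_le.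
  have c0 : ∫ (k \_ (F n)) @[n --> \oo] --> (0 : R).
    by apply: cvg_near_cst; apply: nearW => n; have [] := HF n.
  exact: cvg_unique cF c0.
Qed.

(** The measurable sets over which k has integral 0 form a lambda-system
    containing the octants, hence all measurable sets, so k vanishes almost
    everywhere. *)
Lemma octant_ae0 : (forall l, ∫ (k \_ (octant l)) = 0) ->
  {ae mu, forall x, k x = 0}.
Proof.
move=> H.
have sub : <<s range octant >> `<=` [set A : set M3 | measurable A /\ ∫ (k \_ A) = 0].
  apply: (lambda_system_subset _ (Int_patch_lambda _)) => //.
  - by move=> _ _ [l1 _ <-] [l2 _ <-]; exists (l1 ++ l2) => //; rewrite octantI.
  - by have := H [::]; rewrite octant_nil patch_setT.
  - by move=> _ [l _ <-]; split; [exact: measurable_octant|exact: H].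
have : ae_eq mu setT (EFin \o k) (cst 0%E).
  apply: integral_ae_eq => // E _ mE.
  have [_] := sub E (octants_generate mE).
  rewrite integral0 integral_mkcond restrict_EFin => E0.
  rewrite -[LHS]fineK; first by rewrite [X in X%:E]E0.
  apply: integrable_fin_num => //; exact: itg_patch.
by apply: filterS => x /(_ I) [].
Qed.

End LambdaSystem.

(** The test functions are a Gaussian times smooth octants. In the limit, f
    times the Gaussian has integral 0 over every octant, so that it vanishes
    almost everywhere; the Gaussian is positive. *)
Lemma schwartz_separating f : L2 f ->
  (forall phi, schwartz phi -> ∫ (fun x => f x * phi x) = 0) ->
  {ae mu, forall x, f x = 0}.
Proof.
move=> L2f H; have g1 : schwartz (gauss (1 : R)) by exact: schwartz_gauss.
pose k x := f x * gauss 1 x.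
have ik : itg k by apply: L2_mul => //; exact: schwartz_L2.
have : {ae mu, forall x, k x = 0}.
  apply: octant_ae0 => // l.
  have c0 : ∫ (fun x => f x * smooth_octant n l (gauss 1) x) @[n --> \oo] --> (0 : R).
    by apply: cvg_near_cst; apply: nearW => n; rewrite H//; exact: schwartz_smooth_octant.
  have ck : ∫ (fun x => f x * smooth_octant n l (gauss 1) x) @[n --> \oo] --> ∫ (k \_ (octant l)).
    apply: (@Rintegral_dct _ _ _ mu (fun n x => f x * smooth_octant n l (gauss 1) x) _ (fun x => `|k x|)).
    + move=> n; apply: msrM; first exact: L2_msr.
      by apply: itg_msr; apply: schwartz_itg; exact: schwartz_smooth_octant.
    + move=> x; rewrite [X in _ --> X](_ : _ = f x * ((gauss 1) \_ (octant l)) x).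
        by apply: cvgM; [exact: cvg_cst|exact: smooth_octant_cvg].
      by rewrite !patchE; case: ifP => // _; rewrite mulr0.
    + exact: itg_abs.
    + by move=> n x; rewrite !normrM ler_wpM2l// smooth_octant_le.
  exact: cvg_unique ck c0.
apply: ae_imp => x /eqP; rewrite /k mulf_eq0 (gt_eqF (gauss_gt0 _ _)) orbF.
by move/eqP.
Qed.

End Separation.

(** * Symmetries and uniqueness of the Fourier transform *)

Section Parity.
Context {R : realType}.
Notation mu := (leb3 R).
Implicit Types (f g h phi psi : R3 R -> R) (x xi a : R3 R) (i j : 'I_3) (th : R).
Notation "'∫' f" := (Rintegral mu setT f) (at level 36).

Lemma ae_forall_I3 (P : 'I_3 -> R3 R -> Prop) :
  (forall i, {ae mu, forall x, P i x}) -> {ae mu, forall x, forall i, P i x}.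
Proof.
move=> H; apply: ae_imp (ae_conj (H o0) (ae_conj (H o1) (H o2))) => x [p0 [p1 p2]].
case=> -[|[|[|//]]] Hi.
- by rewrite (_ : Ordinal Hi = o0)//; exact: val_inj.
- by rewrite (_ : Ordinal Hi = o1)//; exact: val_inj.
- by rewrite (_ : Ordinal Hi = o2)//; exact: val_inj.
Qed.

Lemma ae_eq_Int f g : msr f -> msr g -> {ae mu, forall x, f x = g x} -> ∫ f = ∫ g.
Proof.
move=> mf mg fg; rewrite /Rintegral; congr fine.
apply: ae_eq_integral => //; [exact/measurable_EFinP|exact/measurable_EFinP|].
by apply: ae_imp fg => x -> _.
Qed.

Lemma Int_odd_ae f : itg f -> {ae mu, forall x, f (refl x) = - f x} -> ∫ f = 0.
Proof.
move=> fi fo; have mf := itg_msr fi.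
have : ∫ f = - ∫ f.
  rewrite -[LHS](Int_refl fi) -IntN//; apply: ae_eq_Int fo; first exact: msr_refl.
  exact: msrN.
move: (∫ f) => s; lra.
Qed.

Lemma dot_reflr x xi : dot x (refl xi) = - dot x xi.
Proof. by rewrite !dotE /=; ring. Qed.

Lemma dot_refl2 x xi : dot (refl x) xi = - dot x xi.
Proof. by rewrite dotC dot_reflr dotC. Qed.

Lemma reflK x : refl (refl x) = x.
Proof. by case: x => [[x y] z]; rewrite /refl /= !opprK. Qed.

Lemma coord_refl i x : coord i (refl x) = - coord i x.
Proof. by case: i => -[|[|[|//]]] Hi. Qed.

Lemma cos_tr_refl phi xi : cos_tr phi (refl xi) = cos_tr phi xi.
Proof.
by congr Rintegral; apply/funext => x; rewrite dot_reflr mulrN cosN.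
Qed.

Lemma sin_tr_refl phi xi : schwartz phi -> sin_tr phi (refl xi) = - sin_tr phi xi.
Proof.
move=> sp; have ip := schwartz_itg sp; rewrite sin_trE /ft -IntN; last exact: itg_wave.
congr Rintegral; apply/funext => x.
by rewrite dot_reflr !cosB cos_pihalf sin_pihalf mulrN sinN; ring.
Qed.

Lemma cos_tr_comp_refl phi : schwartz phi -> cos_tr (phi \o refl) = cos_tr phi.
Proof.
move=> sp; apply/funext => xi.
have iw := itg_wave 0 xi (schwartz_itg sp).
rewrite !cos_trE /ft -[RHS]Int_refl//; congr Rintegral; apply/funext => x /=.
by rewrite dot_refl2 !addr0 mulrN cosN.
Qed.

Lemma sin_tr_comp_refl phi : schwartz phi ->
  sin_tr (phi \o refl) = (fun xi => - sin_tr phi xi).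
Proof.
move=> sp; apply/funext => xi.
have iw := itg_wave (- (pi / 2)) xi (schwartz_itg sp).
rewrite !sin_trE /ft -IntN// -[RHS]Int_refl; last exact: itgN.
congr Rintegral; apply/funext => x /=.
by rewrite dot_refl2 !cosB cos_pihalf sin_pihalf mulrN sinN; ring.
Qed.

Lemma sin_tr_cos_tr phi : schwartz phi -> sin_tr (cos_tr phi) = fun=> 0.
Proof.
move=> sp; have sc := schwartz_cos_tr sp; apply/funext => xi.
have := sin_tr_comp_refl sc.
rewrite (_ : cos_tr phi \o refl = cos_tr phi); last by apply/funext => x /=; rewrite cos_tr_refl.
by move=> /(congr1 (@^~ xi)); move: (sin_tr _ _) => s; lra.
Qed.

Lemma cos_tr_sin_tr phi : schwartz phi -> cos_tr (sin_tr phi) = fun=> 0.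
Proof.
move=> sp; have ss := schwartz_sin_tr sp; apply/funext => xi.
have := cos_tr_comp_refl ss.
rewrite (_ : sin_tr phi \o refl = (fun x => -1 * sin_tr phi x)); last first.
  by apply/funext => x /=; rewrite sin_tr_refl// mulN1r.
move=> /(congr1 (@^~ xi)); rewrite !cos_trE ftZ; last exact: schwartz_itg.
by move: (ft _ _ _) => s; lra.
Qed.

Lemma partial_cos_tr i phi : schwartz phi ->
  partial i (cos_tr phi) = sin_tr (fun x => - (2 * pi) * (coord i x * phi x)).
Proof.
move=> sp; apply/funext => xi; rewrite sin_trE ftZ; last exact: schwartz_coord_itg.
rewrite cos_trE; apply: derive_val.
have := is_derive_ft 0 xi (schwartz_itg sp) (schwartz_coord_itg i sp) (schwartz_coord2_itg i sp).
have ix := schwartz_coord_itg i sp.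
congr is_derive; have := ftBpi (0 + pi / 2) xi ix.
rewrite (_ : 0 + pi / 2 - pi / 2 - pi / 2 = - (pi / 2)); last by ring.
by move=> ->; rewrite mulrNN.
Qed.

Lemma partial_sin_tr i phi : schwartz phi ->
  partial i (sin_tr phi) = cos_tr (fun x => (2 * pi) * (coord i x * phi x)).
Proof.
move=> sp; apply/funext => xi; rewrite cos_trE ftZ; last exact: schwartz_coord_itg.
rewrite sin_trE; apply: derive_val.
have := is_derive_ft (- (pi / 2)) xi (schwartz_itg sp) (schwartz_coord_itg i sp) (schwartz_coord2_itg i sp).
by rewrite addNr.
Qed.

Lemma cos_tr_partial i phi xi : schwartz phi ->
  cos_tr (partial i phi) xi = 2 * pi * coord i xi * sin_tr phi xi.
Proof. by move=> sp; rewrite cos_trE ft_partial// sub0r sin_trE. Qed.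

Lemma sin_tr_partial i phi xi : schwartz phi ->
  sin_tr (partial i phi) xi = - (2 * pi * coord i xi * cos_tr phi xi).
Proof.
move=> sp; rewrite sin_trE ft_partial// cos_trE -[RHS]mulrN.
by rewrite -ftBpi ?sub0r//; exact: schwartz_itg.
Qed.

Lemma fourier_unique T (g1 g2 : R3 R -> R[i]) : L2C g1 -> L2C g2 ->
  fourier_is T g1 -> fourier_is T g2 -> {ae mu, forall xi, g1 xi = g2 xi}.
Proof.
move=> [r1 i1] [r2 i2] f1 f2.
have H (h1 h2 : R3 R -> R) : L2 h1 -> L2 h2 ->
    (forall phi, schwartz phi -> dist_of h1 phi = dist_of h2 phi) ->
    {ae mu, forall x, h1 x = h2 x}.
  move=> l1 l2 e.
  have := schwartz_separating (L2D l1 (L2N l2)) => /(_ _)/ae_imp; apply.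
    by move=> x /eqP; rewrite subr_eq0 => /eqP.
  move=> phi sp; have lp := schwartz_L2 sp.
  under eq_fun do rewrite mulrBl.
  rewrite IntB; [|exact: L2_mul|exact: L2_mul].
  by apply/eqP; rewrite subr_eq0; apply/eqP; exact: e.
have Hr := H _ _ r1 r2 (fun phi sp => etrans (proj1 (f1 phi sp)) (esym (proj1 (f2 phi sp)))).
have Hi := H _ _ i1 i2 (fun phi sp => etrans (proj2 (f1 phi sp)) (esym (proj2 (f2 phi sp)))).
apply: ae_imp (ae_conj Hr Hi) => x [].
by case: (g1 x) (g2 x) => [a b] [c d] /= -> ->.
Qed.

Lemma L2_refl f : L2 f -> L2 (f \o refl).
Proof.
move=> /L2P[mf f2]; apply/L2P; split; first exact: msr_refl.
exact: (itg_refl f2).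
Qed.

(** Because f is real, reflecting a test function shows that the conjugate of
    the reflection of g is a transform of f too; uniqueness concludes. *)
Lemma fourier_hermitian f (g : R3 R -> R[i]) : L2 f -> L2C g ->
  fourier_is (dist_of f) g ->
  {ae mu, forall xi, g (refl xi) = (complex.Re (g xi) +i* - complex.Im (g xi))%C}.
Proof.
move=> lf [gr gi] fg.
pose g' xi := (complex.Re (g (refl xi)) +i* - complex.Im (g (refl xi)))%C.
have lg' : L2C g' by split; [exact: (L2_refl gr)|exact: (L2N (L2_refl gi))].
have fg' : fourier_is (dist_of f) g'.
  move=> phi sp; have sr := schwartz_refl sp; have [e1 e2] := fg _ sr.
  rewrite cos_tr_comp_refl// in e1; rewrite sin_tr_comp_refl// in e2.
  have I h : L2 h -> dist_of (h \o refl) phi = dist_of h (phi \o refl).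
    move=> lh; rewrite /dist_of -[RHS]Int_refl; last by apply: L2_mul => //; exact: schwartz_L2.
    by congr Rintegral; apply/funext => x /=; rewrite reflK.
  split; first by rewrite -e1 -I.
  have i1 := L2_mul lf (schwartz_L2 (schwartz_sin_tr sp)).
  have -> : dist_of (fun xi => complex.Im (g' xi)) phi = - dist_of (fun xi => complex.Im (g (refl xi))) phi.
    rewrite /dist_of -IntN; last by apply: L2_mul; [exact: (L2_refl gi)|exact: schwartz_L2].
    by congr Rintegral; apply/funext => x; rewrite /= mulNr.
  have -> := I _ gi; rewrite e2; congr (- _).
  rewrite /dist_of (_ : (fun x => _) = fun x => - (f x * sin_tr phi x)); last first.
    by apply/funext => x; rewrite mulrN.
  by rewrite IntN// opprK.
have := fourier_unique lg' (conj gr gi) fg' fg.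
apply: ae_imp => xi; rewrite /g'; case: (g xi) => a b; case: (g (refl xi)) => c d /=.
by move=> [-> <-]; rewrite opprK.
Qed.

End Parity.

(** * Strains satisfy the equation *)

Section Necessity.
Context {R : realType}.
Notation mu := (leb3 R).
Implicit Types (f g h phi psi : R3 R -> R) (x xi a : R3 R) (i j : 'I_3) (th : R).
Notation "'∫' f" := (Rintegral mu setT f) (at level 36).

Lemma msr_enorm : msr (@enorm R).
Proof.
have msq : measurable_fun setT (Num.sqrt : R -> R).
  by apply: continuous_measurable_fun; exact: sqrt_continuous.
exact: (measurableT_comp msq msr_dot).
Qed.

Lemma enorm_ge0 x : 0 <= enorm x. Proof. exact: sqrtr_ge0. Qed.

Lemma msr_unit_coord i : msr (fun x => coord i x * (enorm x)^-1).
Proof.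
apply: msrM; first exact: msr_coord.
by apply: msrV; [exact: enorm_ge0|exact: msr_enorm].
Qed.

Lemma unit_coord_le1 i x : `|coord i x * (enorm x)^-1| <= 1.
Proof.
have [e0|e0] := eqVneq (enorm x) 0; first by rewrite e0 invr0 mulr0 normr0.
rewrite normrM normfV (ger0_norm (enorm_ge0 x)) ler_pdivrMr.
  by rewrite mul1r coord_le_enorm.
by rewrite lt_def e0 enorm_ge0.
Qed.

Lemma enorm0_coord i x : enorm x = 0 -> coord i x = 0.
Proof. by move=> e0; have := coord_le_enorm i x; rewrite e0 normr_le0 => /eqP. Qed.

(** The ratio of a coordinate to the norm is bounded; at the origin both sides
    vanish, so dividing by the norm is harmless. *)
Lemma L2_coordM i h : L2 (fun x => enorm x * h x) -> L2 (fun x => coord i x * h x).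
Proof.
move=> lh; have := L2_bounded_mul (msr_unit_coord i) (unit_coord_le1 i) lh.
rewrite (_ : (fun x => _ * (_ * _)) = (fun x => coord i x * h x))//.
apply/funext => x; have [e0|e0] := eqVneq (enorm x) 0.
  by rewrite e0 mul0r mulr0 (enorm0_coord i e0) mul0r.
by rewrite mulrA divfK.
Qed.

Lemma Re_scale (a : R) (z : R[i]) : complex.Re (a%:C%C * z) = a * complex.Re z.
Proof. by case: z => b c /=; rewrite mul0r subr0. Qed.

Lemma Im_scale (a : R) (z : R[i]) : complex.Im (a%:C%C * z) = a * complex.Im z.
Proof. by case: z => b c /=; rewrite mul0r addr0. Qed.

Lemma L2_sum n (F : 'I_n -> R3 R -> R) : (forall k, L2 (F k)) ->
  L2 (fun x => \sum_(k < n) F k x).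
Proof.
elim: n F => [|n IH] F lF.
  under eq_fun do rewrite big_ord0; apply/L2P; split; first exact: msr_cst.
  by rewrite expr0n; exact: itg0.
by under eq_fun do rewrite big_ord_recl; apply: L2D => //; exact: IH.
Qed.

Lemma Re_sum n (F : 'I_n -> R[i]) : complex.Re (\sum_k F k) = \sum_k complex.Re (F k).
Proof.
elim: n F => [|n IH] F; first by rewrite !big_ord0.
by rewrite !big_ord_recl -IH; case: (F ord0) (\sum_(i < n) _) => a b [c d].
Qed.

Lemma Im_sum n (F : 'I_n -> R[i]) : complex.Im (\sum_k F k) = \sum_k complex.Im (F k).
Proof.
elim: n F => [|n IH] F; first by rewrite !big_ord0.
by rewrite !big_ord_recl -IH; case: (F ord0) (\sum_(i < n) _) => a b [c d].
Qed.

Implicit Type G : 'I_3 -> R3 R -> R[i].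

(** The Fourier transform of the symmetric gradient of a field whose transform
    is G. *)
Definition grad_hat G (xi : R3 R) : 'M[R[i]]_3 :=
  \matrix_(i, j) ((0 +i* pi)%C *
    ((coord i xi)%:C%C * G j xi + (coord j xi)%:C%C * G i xi)).

Lemma Re_grad_hat G i j xi : complex.Re (grad_hat G xi i j) =
  - pi * (coord i xi * complex.Im (G j xi) + coord j xi * complex.Im (G i xi)).
Proof. by rewrite mxE; case: (G i xi) (G j xi) => a b [c d] /=; ring. Qed.

Lemma Im_grad_hat G i j xi : complex.Im (grad_hat G xi i j) =
  pi * (coord i xi * complex.Re (G j xi) + coord j xi * complex.Re (G i xi)).
Proof. by rewrite mxE; case: (G i xi) (G j xi) => a b [c d] /=; ring. Qed.

Lemma enormC xi : (enorm xi ^+ 2)%:C%C = \sum_k (coord k xi)%:C%C * (coord k xi)%:C%C.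
Proof.
rewrite enorm_sqr /dot rmorph_sum; apply: eq_bigr => k _.
by rewrite rmorphM.
Qed.

(** Everything cancels except a multiple of the sum of the X k * Y k. *)
Lemma transverse_identity (A : comNzRingType) (X Y : 'I_3 -> A) (c : A) i j :
  \sum_k X k * Y k = 0 ->
  (\sum_k X k * X k) * (c * (X i * Y j + X j * Y i)) -
  \sum_k X i * X k * (c * (X k * Y j + X j * Y k)) -
  \sum_k c * (X i * Y k + X k * Y i) * (X k * X j) = 0.
Proof.
move=> H; rewrite -[RHS](mulr0 (- 2 * c * X i * X j)) -[X in _ = _ * X]H.
by rewrite !big_ord_recl !big_ord0; ring.
Qed.

Lemma grad_hat_equation G xi : \sum_(k < 3) (coord k xi)%:C%C * G k xi = 0 ->
  (enorm xi ^+ 2)%:C%C *: grad_hat G xi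
    - tens xi *m grad_hat G xi - grad_hat G xi *m tens xi = 0.
Proof.
move=> H; apply/matrixP => i j.
have := transverse_identity (X := fun k => (coord k xi)%:C%C) (Y := fun k => G k xi)
  (0 +i* pi)%C i j H.
rewrite -enormC !mxE => E; rewrite -[RHS]E; congr (_ - _ - _).
  by apply: eq_bigr => k _; rewrite !mxE rmorphM.
by apply: eq_bigr => k _; rewrite !mxE rmorphM.
Qed.

Section Forward.
Variables (S : R3 R -> 'M[R]_3) (u : 'I_3 -> (R3 R -> R) -> R) (G : 'I_3 -> R3 R -> R[i]).
Hypothesis hS : L2sym S.
Hypothesis uG : forall j, fourier_is (u j) (G j).
Hypothesis lG : forall j, L2C (fun xi => (enorm xi)%:C%C * G j xi).
Hypothesis u_div : div_free u.
Hypothesis uS : forall i j phi, schwartz phi ->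
  dist_of (fun x => S x i j) phi = grad_sym u i j phi.

Let reG j xi := complex.Re (G j xi).
Let imG j xi := complex.Im (G j xi).

Let L2re i j : L2 (fun xi => coord i xi * reG j xi).
Proof.
apply: L2_coordM; have [] := lG j; rewrite (_ : (fun x => _) = (fun x => enorm x * reG j x))//.
by apply/funext => x; rewrite Re_scale.
Qed.

Let L2im i j : L2 (fun xi => coord i xi * imG j xi).
Proof.
apply: L2_coordM; have [_] := lG j; rewrite (_ : (fun x => _) = (fun x => enorm x * imG j x))//.
by apply/funext => x; rewrite Im_scale.
Qed.

Let u_partial_cos i j phi : schwartz phi ->
  u j (partial i (cos_tr phi)) = 2 * pi * ∫ (fun xi => coord i xi * imG j xi * phi xi).
Proof.
move=> sp; have sc := schwartz_coordM i sp.
have [_ e] := uG j (schwartzZ (- (2 * pi)) sc).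
have li := L2_mul (L2im i j) (schwartz_L2 sp).
rewrite partial_cos_tr// -[LHS]opprK -e /dist_of -IntN.
  by rewrite -IntZ//; congr Rintegral; apply/funext => xi; rewrite /imG; ring.
have := itgZ (- (2 * pi)) li; rewrite (_ : (fun x => _ * (_ * _)) =
  (fun x => complex.Im (G j x) * (- (2 * pi) * (coord i x * phi x))))//.
by apply/funext => xi; rewrite /imG; ring.
Qed.

Let u_partial_sin i j phi : schwartz phi ->
  u j (partial i (sin_tr phi)) = 2 * pi * ∫ (fun xi => coord i xi * reG j xi * phi xi).
Proof.
move=> sp; have sc := schwartz_coordM i sp.
have [e _] := uG j (schwartzZ (2 * pi) sc).
have li := L2_mul (L2re i j) (schwartz_L2 sp).
rewrite partial_sin_tr// -e /dist_of -IntZ//; congr Rintegral.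
by apply/funext => xi; rewrite /reG; ring.
Qed.

Let pi2_neq0 : 2 * pi != 0 :> R.
Proof. by rewrite mulf_neq0// gt_eqF// pi_gt0. Qed.

(** The divergence constraint, tested against transforms of Schwartz functions,
    says that the real and imaginary parts of the sum are orthogonal to all
    Schwartz functions. *)
Lemma transverse_ae : {ae mu, forall xi, \sum_(k < 3) (coord k xi)%:C%C * G k xi = 0}.
Proof.
have H (h : 'I_3 -> R3 R -> R) : (forall i j, L2 (fun xi => coord i xi * h j xi)) ->
    (forall phi, schwartz phi ->
      \sum_(j < 3) 2 * pi * ∫ (fun xi => coord j xi * h j xi * phi xi) = 0) ->
    {ae mu, forall xi, \sum_(j < 3) coord j xi * h j xi = 0}.
  move=> lh e; apply: schwartz_separating.
    exact: L2_sum.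
  move=> phi sp; have := e phi sp; rewrite -mulr_sumr => /eqP.
  rewrite mulf_eq0 (negbTE pi2_neq0) /= => /eqP e0; rewrite -[RHS]e0.
  rewrite -Int_sum; last by move=> k; apply: L2_mul => //; exact: schwartz_L2.
  by congr Rintegral; apply/funext => xi; rewrite mulr_suml.
have Hre := H reG L2re _; have Him := H imG L2im _.
apply: ae_imp (ae_conj (Hre _) (Him _)) => [xi [h1 h2]|phi sp|phi sp].
- apply/eqP; rewrite eq_complex; apply/andP; split; apply/eqP.
    by rewrite Re_sum -[RHS]h1; apply: eq_bigr => k _; rewrite Re_scale.
  by rewrite Im_sum -[RHS]h2; apply: eq_bigr => k _; rewrite Im_scale.
- have := u_div (schwartz_sin_tr sp); rewrite /dpartial sumrN => /eqP.
  rewrite oppr_eq0 => /eqP e; rewrite -[RHS]e; apply: eq_bigr => j _.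
  by rewrite u_partial_sin.
- have := u_div (schwartz_cos_tr sp); rewrite /dpartial sumrN => /eqP.
  rewrite oppr_eq0 => /eqP e; rewrite -[RHS]e; apply: eq_bigr => j _.
  by rewrite u_partial_cos.
Qed.

(** Testing S against [cos_tr phi] or [sin_tr phi] moves the derivatives in the
    symmetric gradient onto these transforms, where they act as multiplications
    by coordinates. *)
Lemma strain_fourier : L2_fourier_is S (grad_hat G).
Proof.
move=> i j; split.
  split.
    under eq_fun do rewrite Re_grad_hat.
    by apply: L2Z; apply: L2D; [exact: L2im|exact: L2im].
  under eq_fun do rewrite Im_grad_hat.
  by apply: L2Z; apply: L2D; [exact: L2re|exact: L2re].
move=> phi sp; have lp := schwartz_L2 sp.
have [sc ss] := (schwartz_cos_tr sp, schwartz_sin_tr sp).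
have lre k l := L2_mul (L2re k l) lp; have lim k l := L2_mul (L2im k l) lp.
split.
  rewrite (uS i j sc) /grad_sym /dpartial (u_partial_cos i j sp) (u_partial_cos j i sp).
  transitivity (∫ (fun xi => - pi * (coord i xi * imG j xi * phi xi +
      coord j xi * imG i xi * phi xi))).
    by congr Rintegral; apply/funext => xi; rewrite Re_grad_hat /imG; ring.
  by rewrite IntZ; [rewrite IntD//; field|exact: itgD].
rewrite (uS i j ss) /grad_sym /dpartial (u_partial_sin i j sp) (u_partial_sin j i sp).
transitivity (∫ (fun xi => pi * (coord i xi * reG j xi * phi xi +
    coord j xi * reG i xi * phi xi))).
  by congr Rintegral; apply/funext => xi; rewrite Im_grad_hat /reG; ring.
by rewrite IntZ; [rewrite IntD//; field|exact: itgD].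
Qed.

(** The trace of the symmetric gradient is the divergence. *)
Lemma strain_trace0 : {ae mu, forall x, \tr (S x) = 0}.
Proof.
have lS k : L2 (fun x => S x k k) by have [_] := hS.
apply: schwartz_separating.
  exact: L2_sum.
move=> phi sp; rewrite -[RHS](u_div sp).
transitivity (\sum_(k < 3) dist_of (fun x => S x k k) phi).
  rewrite -Int_sum; last by move=> k; apply: L2_mul => //; exact: schwartz_L2.
  by congr Rintegral; apply/funext => x; rewrite /mxtrace mulr_suml.
apply: eq_bigr => k _; rewrite (uS k k sp) /grad_sym.
by move: (dpartial _ _ _) => s; lra.
Qed.

End Forward.

Lemma strain_necessary (S : R3 R -> 'M[R]_3) : L2st S ->
  (exists Shat : R3 R -> 'M[R[i]]_3,
     L2_fourier_is S Shat /\
     {ae leb3 R, forall xi : R3 R,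
        (enorm xi ^+ 2)%:C%C *: Shat xi
          - tens xi *m Shat xi - Shat xi *m tens xi = 0}) /\
  {ae leb3 R, forall x : R3 R, \tr (S x) = 0}.
Proof.
move=> [hS [u [hu u_div uS]]].
have /choice [G hG] : forall j, exists v, [/\ L1locC v, fourier_is (u j) v &
    L2C (fun xi => (enorm xi)%:C%C * v xi)] by move=> j; have [] := hu j.
have uG j : fourier_is (u j) (G j) by have [] := hG j.
have lG j : L2C (fun xi => (enorm xi)%:C%C * G j xi) by have [] := hG j.
split; last exact: strain_trace0 hS u_div uS.
exists (grad_hat G); split; first exact: strain_fourier uG lG uS.
by apply: ae_imp (transverse_ae uG lG u_div) => xi; exact: grad_hat_equation.
Qed.

End Necessity.

(** * Solutions of the equation are strains *)

Section Sufficiency.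
Context {R : realType}.
Notation mu := (leb3 R).
Implicit Types (f g h phi psi : R3 R -> R) (x xi a : R3 R) (i j : 'I_3) (th : R).
Notation "'∫' f" := (Rintegral mu setT f) (at level 36).

Lemma enorm_neq0_ae : {ae mu, forall xi : R3 R, enorm xi != 0}.
Proof.
apply: ae_imp (ae_coord_neq0 o0) => xi; apply: contra => /eqP e0.
by rewrite (enorm0_coord o0 e0).
Qed.

Lemma msr_wtV2 : msr (fun x : R3 R => (wt x ^+ 2)^-1).
Proof.
apply: msrV => [x|]; first by rewrite exprn_ge0 ?wt_ge0.
by apply: msrX; exact: msr_wt.
Qed.

(** This is where the dimension matters: the square is at most the integrable
    function of [itg_inv_dot]. *)
Lemma L2_enormV_wt : L2 (fun x : R3 R => (enorm x)^-1 * (wt x ^+ 2)^-1).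
Proof.
have m : msr (fun x : R3 R => (enorm x)^-1 * (wt x ^+ 2)^-1).
  apply: msrM; last exact: msr_wtV2.
  by apply: msrV; [exact: enorm_ge0|exact: msr_enorm].
apply/L2P; split=> //; apply: (itg_le _ itg_inv_dot) => [|x]; first exact: msrX.
rewrite ger0_norm ?sqr_ge0// exprMn !exprVn enorm_sqr.
rewrite ler_wpM2l ?invr_ge0 ?dot_ge0// lef_pV2 ?posrE ?exprn_gt0 ?wt_gt0//.
by rewrite -exprM ler_weXn2l// wt_ge1.
Qed.

Section LowFrequency.
Variable h : R3 R -> R.
Hypothesis mh : msr h.
Hypothesis lh : L2 (fun x => enorm x * h x).

(** h is the product of |xi| h and |xi|^-1; both factors are square integrable
    once the weight controls the second one at infinity. *)
Lemma itg_weighted : itg (fun x => `|h x| * (wt x ^+ 2)^-1).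
Proof.
apply: (@itg_ae_le _ _ (fun x => `|enorm x * h x * ((enorm x)^-1 * (wt x ^+ 2)^-1)|)).
- by apply: msrM; [exact: measurableT_comp|exact: msr_wtV2].
- by apply: itg_abs; exact: L2_mul L2_enormV_wt.
apply: ae_imp enorm_neq0_ae => x e0.
rewrite (_ : enorm x * h x * _ = h x * (wt x ^+ 2)^-1); last by field; rewrite e0 gt_eqF ?wt_gt0.
by rewrite !normrM normr_id.
Qed.

Lemma itg_decayM f (C : R) : msr f -> (forall x, `|f x| <= C * (wt x ^+ 2)^-1) ->
  itg (fun x => h x * f x).
Proof.
move=> mf fC; apply: (itg_le _ (itgZ C itg_weighted)); first exact: msrM.
by move=> x; rewrite normrM mulrCA ler_wpM2l.
Qed.

Lemma itg_schwartzM phi : schwartz phi -> itg (fun x => h x * phi x).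
Proof.
move=> sp; have [C HC] := schwartz_le_wtV 2 sp.
by apply: itg_decayM HC; apply: continuous_msr; exact: schwartz_continuous.
Qed.

Lemma L1loc_low : L1loc h.
Proof.
move=> r.
have mr : measurable [set x : R3 R | enorm x <= r].
  rewrite (_ : [set _ | _] = setT `&` (@enorm R) @^-1` `]-oo, r]); last first.
    by rewrite setTI; apply/seteqP; split=> x /=; rewrite in_itv.
  by apply: msr_enorm => //; exact: measurable_itv.
have i1 : mu.-integrable [set x : R3 R | enorm x <= r]
    (EFin \o (fun x => (1 + r ^+ 2) ^+ 2 * (`|h x| * (wt x ^+ 2)^-1))).
  by apply: integrableS (itgZ ((1 + r ^+ 2) ^+ 2) itg_weighted).
apply: (le_integrable _ _ _ i1) => //.
  by apply: measurable_funTS; exact/measurable_EFinP.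
move=> x /= xr; rewrite lee_fin; apply: le_trans (ler_norm _).
rewrite mulrCA ler_peMr// ler_pdivlMr ?exprn_gt0 ?wt_gt0// mul1r.
have h2 : wt x <= 1 + r ^+ 2.
  rewrite lerD2l -enorm_sqr ler_sqr// nnegrE ?enorm_ge0//.
  exact: le_trans (enorm_ge0 x) xr.
by apply: lerXn2r; rewrite ?nnegrE ?wt_ge0 ?addr_ge0 ?sqr_ge0.
Qed.

End LowFrequency.

(** The real part of the inverse Fourier transform of h1 + i h2, as a
    distribution; the imaginary part is 0 when h1 is even and h2 is odd. *)
Definition inv_ft h1 h2 psi := ∫ (fun xi => h1 xi * cos_tr psi xi - h2 xi * sin_tr psi xi).

Section InverseTransform.
Variables h1 h2 : R3 R -> R.
Hypothesis m1 : msr h1.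
Hypothesis m2 : msr h2.
Hypothesis l1 : L2 (fun x => enorm x * h1 x).
Hypothesis l2 : L2 (fun x => enorm x * h2 x).

Let itg1 psi : schwartz psi -> itg (fun xi => h1 xi * cos_tr psi xi).
Proof. by move=> sp; apply: itg_schwartzM => //; exact: schwartz_cos_tr. Qed.

Let itg2 psi : schwartz psi -> itg (fun xi => h2 xi * sin_tr psi xi).
Proof. by move=> sp; apply: itg_schwartzM => //; exact: schwartz_sin_tr. Qed.

Lemma tempered_inv_ft : tempered (inv_ft h1 h2).
Proof.
split=> [a phi psi sp sq|].
  have [ip iq] := (schwartz_itg sp, schwartz_itg sq).
  rewrite /inv_ft -IntZ; last by apply: itgB; [exact: itg1|exact: itg2].
  rewrite -IntD; last 2 first.
  - by apply: itgZ; apply: itgB; [exact: itg1|exact: itg2].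
  - by apply: itgB; [exact: itg1|exact: itg2].
  congr Rintegral; apply/funext => xi.
  by rewrite !cos_trE !sin_trE !ft_lin//; ring.
have [K HK] := @ft_norm_bound R.
pose V x := `|h1 x| * (wt x ^+ 2)^-1 + `|h2 x| * (wt x ^+ 2)^-1.
have iV : itg V by apply: itgD; exact: itg_weighted.
exists 4, (K * ∫ V) => phi sp.
rewrite mulrAC -IntZ//; apply: Int_abs; last move=> x.
- by apply: itg_msr; apply: itgB; [exact: itg1|exact: itg2].
- exact: itgZ.
apply: (le_trans (ler_normB _ _)); rewrite mulrDr !normrM.
by apply: lerD; rewrite mulrCA ler_wpM2l// ?cos_trE ?sin_trE; exact: HK.
Qed.

Hypothesis even1 : {ae mu, forall xi, h1 (refl xi) = h1 xi}.
Hypothesis odd2 : {ae mu, forall xi, h2 (refl xi) = - h2 xi}.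

Let Int_even_odd f : schwartz f -> (forall x, f (refl x) = - f x) ->
  ∫ (fun xi => h1 xi * f xi) = 0.
Proof.
move=> sf fo; apply: Int_odd_ae; first exact: itg_schwartzM.
by apply: ae_imp even1 => x ->; rewrite fo mulrN.
Qed.

Let Int_odd_even f : schwartz f -> (forall x, f (refl x) = f x) ->
  ∫ (fun xi => h2 xi * f xi) = 0.
Proof.
move=> sf fo; apply: Int_odd_ae; first exact: itg_schwartzM.
by apply: ae_imp odd2 => x ->; rewrite fo mulNr.
Qed.

(** By inversion a test function is the sum of its iterated cosine and iterated
    sine transforms, which are even and odd. Against h1 only the even one
    contributes and against h2 only the odd one, while the mixed iterated
    transforms vanish. *)
Lemma fourier_inv_ft : fourier_is (inv_ft h1 h2) (fun xi => (h1 xi +i* h2 xi)%C).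
Proof.
move=> phi sp; have [sc ss] := (schwartz_cos_tr sp, schwartz_sin_tr sp).
have [scc sss] := (schwartz_cos_tr sc, schwartz_sin_tr ss).
have inv x : phi x = cos_tr (cos_tr phi) x + sin_tr (sin_tr phi) x.
  by rewrite -[in LHS](fourier_inversion sp).
rewrite /dist_of /inv_ft /= (sin_tr_cos_tr sp) (cos_tr_sin_tr sp).
split.
  transitivity (∫ (fun xi => h1 xi * cos_tr (cos_tr phi) xi) +
      ∫ (fun xi => h1 xi * sin_tr (sin_tr phi) xi)).
    rewrite -IntD; [|exact: itg_schwartzM..].
    by congr Rintegral; apply/funext => x; rewrite {1}inv mulrDr.
  rewrite [X in _ + X](Int_even_odd sss (fun x => sin_tr_refl x ss)) addr0.
  by congr Rintegral; apply/funext => x; rewrite mulr0 subr0.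
transitivity (∫ (fun xi => h2 xi * cos_tr (cos_tr phi) xi) +
    ∫ (fun xi => h2 xi * sin_tr (sin_tr phi) xi)).
  rewrite -IntD; [|exact: itg_schwartzM..].
  by congr Rintegral; apply/funext => x; rewrite {1}inv mulrDr.
rewrite [X in X + _](Int_odd_even scc (fun x => cos_tr_refl (cos_tr phi) x)) add0r.
rewrite -IntN.
  by congr Rintegral; apply/funext => x; rewrite mulr0 sub0r opprK.
have := itgN (itg_schwartzM m2 l2 sss).
by under [X in _ -> itg X]eq_fun do rewrite mulr0 sub0r.
Qed.

Lemma Hdot1_inv_ft : Hdot1 (inv_ft h1 h2).
Proof.
split; first exact: tempered_inv_ft.
exists (fun xi => (h1 xi +i* h2 xi)%C); split.
- by split; exact: L1loc_low.
- exact: fourier_inv_ft.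
split.
  by rewrite (_ : (fun x => _) = (fun x => enorm x * h1 x))//; apply/funext => x; rewrite Re_scale.
by rewrite (_ : (fun x => _) = (fun x => enorm x * h2 x))//; apply/funext => x; rewrite Im_scale.
Qed.

Lemma inv_ft_partial i psi : schwartz psi -> inv_ft h1 h2 (partial i psi) =
  ∫ (fun xi => 2 * pi * (coord i xi * h1 xi * sin_tr psi xi + coord i xi * h2 xi * cos_tr psi xi)).
Proof.
move=> sp; congr Rintegral; apply/funext => xi.
by rewrite cos_tr_partial// sin_tr_partial//; ring.
Qed.

End InverseTransform.

Implicit Type M : 'I_3 -> 'I_3 -> R3 R -> R.

(** The vector (M xi) / (pi |xi|^2): up to the factor - i, the transverse field
    whose strain has the transform M. *)
Definition riesz M j : R3 R -> R := fun xi =>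
  (pi * dot xi xi)^-1 * \sum_(k < 3) coord k xi * M j k xi.

Lemma msr_riesz M j : (forall k, msr (M j k)) -> msr (riesz M j).
Proof.
move=> mM; apply: msrM.
  apply: msrV => [x|]; first by rewrite mulr_ge0 ?pi_ge0 ?dot_ge0.
  by apply: msrM; [exact: msr_cst|exact: msr_dot].
by rewrite /msr; apply: measurable_sum => k; apply: msrM; [exact: msr_coord|exact: mM].
Qed.

Lemma L2_enorm_riesz M j : (forall k, L2 (M j k)) -> L2 (fun x => enorm x * riesz M j x).
Proof.
move=> lM.
have := L2Z pi^-1 (L2_sum (fun k => L2_bounded_mul (msr_unit_coord k) (unit_coord_le1 k) (lM k))).
rewrite (_ : (fun x => _ * \sum_k _) = (fun x => enorm x * riesz M j x))//.
apply/funext => x; rewrite /riesz -enorm_sqr mulrA.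
have -> : enorm x * (pi * enorm x ^+ 2)^-1 = pi^-1 * (enorm x)^-1.
  have [->|e0] := eqVneq (enorm x) 0; first by rewrite mul0r invr0 mulr0.
  have p0 : (pi : R) != 0 by rewrite gt_eqF// pi_gt0.
  by move: (pi : R) p0 => p p0; field; rewrite e0 p0.
rewrite -mulrA; congr (_ * _); rewrite mulr_sumr; apply: eq_bigr => k _; ring.
Qed.

Lemma riesz_refl M j xi (s : R) : (forall k, M j k (refl xi) = s * M j k xi) ->
  riesz M j (refl xi) = - s * riesz M j xi.
Proof.
move=> H; rewrite /riesz dot_reflr dotC dot_reflr opprK mulrCA; congr (_ * _).
by rewrite mulr_sumr; apply: eq_bigr => k _; rewrite H coord_refl; ring.
Qed.

(** The frequency-space equation for a real matrix m. The real and imaginary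
    parts of the transform of S satisfy it separately, because its coefficients
    are real. *)
Definition strain_eq (m : 'I_3 -> 'I_3 -> R) (x : 'I_3 -> R) : Prop := forall i j,
  (\sum_k x k * x k) * m i j =
  (\sum_k x i * x k * m k j) + \sum_k m i k * (x k * x j).

(** The two terms on the right of the equation are |xi|^2 times the two summands
    on the left of this identity, by symmetry of M. *)
Lemma riesz_strain M xi i j : enorm xi != 0 ->
  (forall k l, M k l xi = M l k xi) -> strain_eq (fun k l => M k l xi) (coord^~ xi) ->
  pi * (coord i xi * riesz M j xi + coord j xi * riesz M i xi) = M i j xi.
Proof.
move=> e0 sym /(_ i j) E.
have d0 : dot xi xi != 0 by rewrite -enorm_sqr expf_neq0.
apply: (mulfI d0); rewrite [RHS]E /riesz.
have -> : \sum_k coord i xi * coord k xi * M k j xi = coord i xi * \sum_k coord k xi * M j k xi.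
  by rewrite mulr_sumr; apply: eq_bigr => k _; rewrite (sym k j); ring.
have -> : \sum_k M i k xi * (coord k xi * coord j xi) = coord j xi * \sum_k coord k xi * M i k xi.
  by rewrite mulr_sumr; apply: eq_bigr => k _; ring.
move: (\sum_k _) (\sum_k _) => s t.
have p0 : (pi : R) != 0 by rewrite gt_eqF// pi_gt0.
by move: (pi : R) p0 (dot xi xi) d0 => p p0 d d0; field; rewrite d0 p0.
Qed.

(** The trace of the equation is |xi|^2 tr M = 2 (xi . M xi). *)
Lemma riesz_transverse M xi : strain_eq (fun k l => M k l xi) (coord^~ xi) ->
  \sum_k M k k xi = 0 -> \sum_(j < 3) coord j xi * riesz M j xi = 0.
Proof.
move=> E tr.
have H : \sum_j \sum_k coord j xi * coord k xi * M k j xi +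
    \sum_j \sum_k M j k xi * (coord k xi * coord j xi) = 0.
  rewrite -big_split /=; under eq_bigr do rewrite -E.
  by rewrite -mulr_sumr tr mulr0.
have S1 : \sum_j \sum_k coord j xi * coord k xi * M k j xi =
    \sum_j coord j xi * \sum_k coord k xi * M j k xi.
  rewrite exchange_big /=; apply: eq_bigr => j _; rewrite mulr_sumr.
  by apply: eq_bigr => k _; ring.
have S2 : \sum_j \sum_k M j k xi * (coord k xi * coord j xi) =
    \sum_j coord j xi * \sum_k coord k xi * M j k xi.
  by apply: eq_bigr => j _; rewrite mulr_sumr; apply: eq_bigr => k _; ring.
rewrite S1 S2 in H.
have s0 : \sum_j coord j xi * \sum_k coord k xi * M j k xi = 0.
  by move: H; move: (\sum_j _) => s; lra.
rewrite -[RHS](mulr0 (pi * dot xi xi)^-1) -[X in _ = _ * X]s0 mulr_sumr.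
by apply: eq_bigr => j _; rewrite /riesz mulrCA.
Qed.

Lemma Re_tens_equation (m : 'M[R[i]]_3) xi :
  (enorm xi ^+ 2)%:C%C *: m - tens xi *m m - m *m tens xi = 0 ->
  strain_eq (fun i j => complex.Re (m i j)) (coord^~ xi) /\
  strain_eq (fun i j => complex.Im (m i j)) (coord^~ xi).
Proof.
move=> E; have e i j : (enorm xi ^+ 2)%:C%C * m i j =
    \sum_k (coord i xi * coord k xi)%:C%C * m k j +
    \sum_k (coord k xi * coord j xi)%:C%C * m i k.
  have := congr1 (fun a : 'M[R[i]]_3 => a i j) E; rewrite !mxE => /eqP.
  rewrite subr_eq0 subr_eq => /eqP ->; rewrite addrC; congr (_ + _).
    by apply: eq_bigr => k _; rewrite mxE.
  by apply: eq_bigr => k _; rewrite mxE mulrC.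
split=> i j; rewrite (_ : \sum_k _ = enorm xi ^+ 2); try by rewrite enorm_sqr.
  rewrite -Re_scale e; transitivity (complex.Re (\sum_k (coord i xi * coord k xi)%:C%C * m k j) +
    complex.Re (\sum_k (coord k xi * coord j xi)%:C%C * m i k)); first by case: (\sum_k _) (\sum_k _) => a b [].
  rewrite !Re_sum; congr (_ + _); apply: eq_bigr => k _; rewrite Re_scale//.
  by rewrite mulrC.
rewrite -Im_scale e; transitivity (complex.Im (\sum_k (coord i xi * coord k xi)%:C%C * m k j) +
  complex.Im (\sum_k (coord k xi * coord j xi)%:C%C * m i k)); first by case: (\sum_k _) (\sum_k _) => a b [].
rewrite !Im_sum; congr (_ + _); apply: eq_bigr => k _; rewrite Im_scale//.
by rewrite mulrC.
Qed.

Section Backward.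
Variables (S : R3 R -> 'M[R]_3) (H : R3 R -> 'M[R[i]]_3).
Hypothesis hS : L2sym S.
Hypothesis hF : L2_fourier_is S H.
Hypothesis H_eq : {ae mu, forall xi,
  (enorm xi ^+ 2)%:C%C *: H xi - tens xi *m H xi - H xi *m tens xi = 0}.
Hypothesis trS : {ae mu, forall x, \tr (S x) = 0}.

Let A i j xi := complex.Re (H xi i j).
Let B i j xi := complex.Im (H xi i j).

Let lS i j : L2 (fun x => S x i j). Proof. by have [_] := hS. Qed.
Let lA i j : L2 (A i j). Proof. by have [[]] := hF i j. Qed.
Let lB i j : L2 (B i j). Proof. by have [[]] := hF i j. Qed.

Let sym_ae : {ae mu, forall xi, forall i j, H xi i j = H xi j i}.
Proof.
apply: ae_forall_I3 => i; apply: ae_forall_I3 => j.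
have [l1 f1] := hF i j; have [l2 f2] := hF j i.
apply: (fourier_unique l1 l2 f1).
rewrite (_ : (fun x => S x i j) = (fun x => S x j i))//.
by apply/funext => x; have [/(_ x) sS _] := hS; rewrite -[in LHS]sS mxE.
Qed.

Let hermitian_ae : {ae mu, forall xi, forall i j,
  H (refl xi) i j = (A i j xi +i* - B i j xi)%C}.
Proof.
apply: ae_forall_I3 => i; apply: ae_forall_I3 => j.
by have [l f] := hF i j; exact: (fourier_hermitian (lS i j) l f).
Qed.

Let trace_test f : L2 f -> \sum_k dist_of (fun x => S x k k) f = 0.
Proof.
move=> lf; rewrite -Int_sum; last by move=> k; exact: L2_mul.
rewrite -[RHS]Int0; apply: ae_eq_Int; last 1 first.
- by apply: ae_imp trS => x tr0; rewrite -mulr_suml -/(\tr (S x)) tr0 mul0r.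
- by apply: itg_msr; apply: itg_sum => k; exact: L2_mul.
- exact: msr_cst.
Qed.

Let traceless_ae : {ae mu, forall xi, \sum_k A k k xi = 0 /\ \sum_k B k k xi = 0}.
Proof.
apply: ae_conj.
  apply: schwartz_separating; first exact: L2_sum.
  move=> phi sp; have lp := schwartz_L2 sp.
  have lc := schwartz_L2 (schwartz_cos_tr sp).
  rewrite -[RHS](trace_test lc).
  transitivity (\sum_k dist_of (A k k) phi).
    rewrite -Int_sum; last by move=> k; exact: L2_mul.
    by congr Rintegral; apply/funext => x; rewrite mulr_suml.
  by apply: eq_bigr => k _; have [_ /(_ _ sp) []] := hF k k.
apply: schwartz_separating; first exact: L2_sum.
move=> phi sp; have lp := schwartz_L2 sp.
have ls := schwartz_L2 (schwartz_sin_tr sp).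
apply: oppr_inj; rewrite oppr0 -[RHS](trace_test ls).
transitivity (- \sum_k dist_of (B k k) phi).
  rewrite -Int_sum; last by move=> k; exact: L2_mul.
  by congr (- _); congr Rintegral; apply/funext => x; rewrite mulr_suml.
rewrite -sumrN; apply: eq_bigr => k _.
by have [_ /(_ _ sp) [_ e]] := hF k k; rewrite [X in - X]e opprK.
Qed.

(** The transform of the velocity is - i (H xi) / (pi |xi|^2); gr and gi are its
    real and imaginary parts. *)
Let gr j := riesz B j.
Let gi j xi := - riesz A j xi.
Let u j := inv_ft (gr j) (gi j).

Let mgr j : msr (gr j).
Proof. by apply: msr_riesz => k; exact: L2_msr. Qed.
Let mgi j : msr (gi j).
Proof. by apply: msrN; apply: msr_riesz => k; exact: L2_msr. Qed.
Let lgr j : L2 (fun x => enorm x * gr j x).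
Proof. exact: L2_enorm_riesz. Qed.
Let lgi j : L2 (fun x => enorm x * gi j x).
Proof.
have := L2N (L2_enorm_riesz (fun k => lA j k)).
by under eq_fun do rewrite -mulrN.
Qed.

Let Hdot1_u j : Hdot1 (u j).
Proof.
apply: Hdot1_inv_ft => //.
  apply: ae_imp hermitian_ae => xi e.
  by rewrite /gr (@riesz_refl _ _ _ (-1)) ?opprK ?mul1r// => k; rewrite /B e mulN1r.
apply: ae_imp hermitian_ae => xi e.
by rewrite /gi (@riesz_refl _ _ _ 1) ?mulN1r// => k; rewrite /A e mul1r.
Qed.

Let good_ae : {ae mu, forall xi, [/\ enorm xi != 0,
  forall i j, H xi i j = H xi j i,
  strain_eq (fun i j => A i j xi) (coord^~ xi),
  strain_eq (fun i j => B i j xi) (coord^~ xi) &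
  \sum_k A k k xi = 0 /\ \sum_k B k k xi = 0]}.
Proof.
apply: ae_imp (ae_conj enorm_neq0_ae (ae_conj sym_ae (ae_conj H_eq traceless_ae))).
by move=> xi [e0 [s [/Re_tens_equation [E1 E2] tr]]].
Qed.

Let m_pair i j psi : schwartz psi ->
  itg (fun xi => coord i xi * gr j xi * sin_tr psi xi + coord i xi * gi j xi * cos_tr psi xi).
Proof.
move=> sp; have [sc ss] := (schwartz_cos_tr sp, schwartz_sin_tr sp).
by apply: itgD; apply: L2_mul; try (exact: L2_coordM); exact: schwartz_L2.
Qed.

Let div_free_u : div_free u.
Proof.
move=> psi sp; rewrite /dpartial sumrN; apply/eqP; rewrite oppr_eq0; apply/eqP.
under eq_bigr do rewrite /u inv_ft_partial//.
rewrite -Int_sum; last by move=> k; apply: itgZ; exact: m_pair.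
rewrite -[RHS]Int0; apply: ae_eq_Int.
- by apply: itg_msr; apply: itg_sum => k; apply: itgZ; exact: m_pair.
- exact: msr_cst.
apply: ae_imp good_ae => xi [e0 s E1 E2 [t1 t2]].
have r1 := riesz_transverse E1 t1; have r2 := riesz_transverse E2 t2.
rewrite -mulr_sumr big_split /= -!mulr_suml r2 mul0r add0r.
rewrite (_ : \sum_k coord k xi * gi k xi = - \sum_k coord k xi * riesz A k xi).
  by rewrite r1 oppr0 mul0r mulr0.
by rewrite -sumrN; apply: eq_bigr => k _; rewrite /gi mulrN.
Qed.

Let grad_sym_u i j psi : schwartz psi ->
  dist_of (fun x => S x i j) psi = grad_sym u i j psi.
Proof.
move=> sp; have [sc ss] := (schwartz_cos_tr sp, schwartz_sin_tr sp).
have [scc sss] := (schwartz_cos_tr sc, schwartz_sin_tr ss).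
have [lc ls] := (schwartz_L2 sc, schwartz_L2 ss).
have [_ f] := hF i j; have [f1 _] := f _ sc; have [_ f2] := f _ ss.
have L : dist_of (fun x => S x i j) psi =
    ∫ (fun xi => A i j xi * cos_tr psi xi - B i j xi * sin_tr psi xi).
  rewrite IntB; [|exact: L2_mul|exact: L2_mul].
  have -> : ∫ (fun xi => A i j xi * cos_tr psi xi) = dist_of (fun x => S x i j) (cos_tr (cos_tr psi)) := f1.
  have -> : ∫ (fun xi => B i j xi * sin_tr psi xi) = - dist_of (fun x => S x i j) (sin_tr (sin_tr psi)) := f2.
  rewrite opprK /dist_of -IntD; last 2 first.
  - by apply: L2_mul => //; exact: schwartz_L2.
  - by apply: L2_mul => //; exact: schwartz_L2.
  congr Rintegral; apply/funext => x.
  by rewrite -mulrDr -[in LHS](fourier_inversion sp).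
rewrite L /grad_sym /dpartial /u !inv_ft_partial//.
rewrite -opprD mulrN -IntD; [|apply: itgZ; exact: m_pair|apply: itgZ; exact: m_pair].
have ipp := itgD (itgZ (2 * pi) (m_pair i j sp)) (itgZ (2 * pi) (m_pair j i sp)).
rewrite -mulNr -IntZ//; apply: ae_eq_Int.
- by apply: itg_msr; apply: itgB; exact: L2_mul.
- by apply: itg_msr; exact: itgZ.
apply: ae_imp good_ae => xi [e0 s E1 E2 _].
have sA k l : A k l xi = A l k xi by rewrite /A s.
have sB k l : B k l xi = B l k xi by rewrite /B s.
rewrite -(riesz_strain i j e0 sA E1) -(riesz_strain i j e0 sB E2) /gr /gi.
by field.
Qed.

Lemma strain_sufficient : L2st S.
Proof. by split=> //; exists u; split. Qed.

End Backward.

End Sufficiency.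

Theorem proposition2p3 (R : realType) (S : R3 R -> 'M[R]_3) (hS : L2sym S) :
  L2st S <->
  (exists Shat : R3 R -> 'M[R[i]]_3,
     L2_fourier_is S Shat /\
     {ae leb3 R, forall xi : R3 R,
        (enorm xi ^+ 2)%:C%C *: Shat xi
          - tens xi *m Shat xi - Shat xi *m tens xi = 0}) /\
  {ae leb3 R, forall x : R3 R, \tr (S x) = 0}.
Proof.
split; first exact: strain_necessary.
by move=> [[H [hF H_eq]] trS]; exact: (strain_sufficient hS hF H_eq trS).
Qed.
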